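(* Let $E,F:\mathcal I\to\mathbb R^{m\times m}$ be sufficiently smooth and let the pair $\{E,F\}$ be regular on $\mathcal I$ with index $\mu\in\mathbb N$ and characteristics $r<m$, $\theta_0=0$ if $\mu=1$, and, for $\mu>1$, $r<m$, $\theta_0\ge\cdots\ge\theta_{\mu-2}>\theta_{\mu-1}=0$. Then the following statements are true. (a) The strangeness index $\mu_S$ is well defined for $\{E,F\}$, and $\mu_S=\mu-1$. The associated characteristics are $$r^S_0=r,\qquad s_i=\theta_i,\quad d_i=r^S_i-\theta_i,\quad a_i=m-r_i-\theta_i,\quad u_i=0,\quad r^S_{i+1}=d_i,\qquad i=0,\dots,\mu-1.$$ (b) The pair $\{E,F\}$ is regular with tractability index $\mu$ and characteristics $r^T_0=r$, $r^T_i=m-\theta_{i-1}$, $i=1,\dots,\mu$. (c) The pair $\{E,F\}$ is regular with dissection index $\mu$ and characteristics $r^D_0=r$, $r^D_i=m-\theta_{i-1}$, $i=1,\dots,\mu$.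
   Context: $\mathcal I\subseteq\mathbb R$ is an interval; $E,F:\mathcal I\to\mathbb R^{m\times m}$ are sufficiently smooth (as many continuous derivatives as the constructions require); $^*$ denotes transposition. A basis of a time-varying subspace is a (sufficiently smooth) matrix function whose columns at each $t$ form a basis of it (empty matrices allowed). Relations are meant pointwise on $\mathcal I$. PRE-REGULARITY. A pair $\{E,F\}$ of $m\times m$ matrix functions is pre-regular if, with $N(t)=\ker E(t)$, $S(t)=\{z\in\mathbb R^m:F(t)z\in\operatorname{im}E(t)\}$, one has $\operatorname{im}[E(t)\ F(t)]=\mathbb R^m$, $\operatorname{rank}E(t)=r$, $\dim(N(t)\cap S(t))=\theta$ for all $t\in\mathcal I$ with constant integers $r,\theta$. REDUCTION AND REGULARITY. Set $E_0=E,F_0=F,m_0=m$. If $\{E_i,F_i\}$ (size $m_i\times m_i$) is pre-regular with constants $r_i,\theta_i$, choose bases $Y_i$ of $\operatorname{im}E_i$, $Z_i$ of $(\operatorname{im}E_i)^\perp$ and a $C^1$ basis $C_i:\mathcal I\to\mathbb R^{m_i\times r_i}$ of $S_i=\ker Z_i^*F_i$, and put $m_{i+1}=r_i$, $E_{i+1}=Y_i^*E_iC_i$, $F_{i+1}=Y_i^*(F_iC_i+E_iC_i')$; then $\operatorname{rank}E_{i+1}=r_{i+1}=r_i-\theta_i$. A pre-regular pair with $r=r_0<m$ is regular with index $\mu\ge1$ if $\{E_i,F_i\}$, $i=0,\dots,\mu-1$, are well defined and pre-regular, $r_0>\cdots>r_{\mu-1}$, and either $r_{\mu-1}>0$ and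 $E_\mu$ is pointwise nonsingular, or $r_{\mu-1}=0$ (with $r_\mu:=r_{\mu-1}$). Its characteristics are $r$ and $\theta_0\ge\cdots\ge\theta_{\mu-2}>\theta_{\mu-1}=0$, equivalently the ranks $r_0>\dots>r_{\mu-1}=r_\mu$; they do not depend on the chosen bases. STRANGENESS INDEX. For a pair $\{E,F\}$ let $T,T^c,Z,V$ be pointwise orthonormal bases of $\ker E$, $(\ker E)^\perp$, $(\operatorname{im}E)^\perp$, $(\operatorname{im}Z^*FT)^\perp$, and set $r^S=\operatorname{rank}E$, $a=\operatorname{rank}Z^*FT$, $s=\operatorname{rank}V^*Z^*FT^c$, $d=r^S-s$, $u=m-r^S-a-s$. If these are constant on $\mathcal I$, then $\{E,F\}$ is equivalent, via $\tilde E=LEK$, $\tilde F=LFK+LEK'$ with $L$ continuous, $K$ continuously differentiable, both pointwise nonsingular, to a pair of the form $$\tilde E=\begin{bmatrix} I_s & 0 & 0 & 0 \\ 0 & I_d & 0 & 0 \\ 0 & 0 & 0 & 0 \\ 0 & 0 & 0 & 0 \\ 0 & 0 & 0 & 0 \end{bmatrix},\quad \tilde F=\begin{bmatrix} 0 & \tilde F_{12} & 0 & \tilde F_{14} \\ 0 & 0 & 0 & \tilde F_{24} \\ 0 & 0 & I_a & 0 \\ {I_s} & 0 & 0 & 0 \\ 0 & 0 & 0 & 0 \end{bmatrix}$$ with row blocks of sizes $s,d,a,s,u$ and column blocks of sizes $s,d,a,s+u$. The successor pair is obtained by replacing the block $I_s$ in $\tilde E$ by $0$ and keeping $\tilde F$.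 Starting with $\{E,F\}$ and iterating gives pairs of $m\times m$ matrix functions with values $r^S_i,a_i,s_i,d_i,u_i$, $i=0,1,\dots$ (which do not depend on the choices made). The strangeness index is well defined if these values are constant on $\mathcal I$ at every step until $s_i=0$ occurs; then $\mu_S=\min\{i\ge0:s_i=0\}$. TRACTABILITY INDEX. Let $E=AD$ be a proper factorization: $A:\mathcal I\to\mathbb R^{m\times k}$ continuous, $D:\mathcal I\to\mathbb R^{k\times m}$ continuously differentiable, $\ker A$ and $\operatorname{im}D$ are $C^1$-subspaces of $\mathbb R^k$ (i.e. the orthogonal projector functions onto them are continuously differentiable), and $\ker A\oplus\operatorname{im}D=\mathbb R^k$. Put $B=F-AD'$; let $R$ be the projector function with $\operatorname{im}R=\operatorname{im}D$, $\ker R=\ker A$. Let $Q_0$ be a continuously differentiable projector function onto $\ker D=\ker E$, $P_0=I-Q_0$, and let $D^-$ be determined by $D^-DD^-=D^-$, $DD^-D=D$, $DD^-=R$, $D^-D=P_0$. Set $G_0=AD$, $B_0=B$, $\Pi_0=P_0$, $N_0=\ker G_0$. A sequence $G_0,\dots,G_\kappa$ is admissible if for $i=1,\dots,\kappa$ $$G_i=G_{i-1}+B_{i-1}Q_{i-1},\qquad B_i=B_{i-1}P_{i-1}-G_iD^-(D\Pi_iD^-)'D\Pi_{i-1},$$ $N_i=\ker G_i$, $\widehat N_i=(N_0+\cdots+N_{i-1})\cap N_i$, $N_0+\cdots+N_{i-1}=\widehat N_i\oplus X_i$, $Q_i$ is a projector function with $\operatorname{im}Q_i=N_i$, $X_i\subseteq\ker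 Q_i$, $P_i=I-Q_i$, $\Pi_i=\Pi_{i-1}P_i$, and additionally: $G_i$ has constant rank $r^T_i$ ($i=0,\dots,\kappa$), $\widehat N_i$ has constant dimension ($i=1,\dots,\kappa$), and $\Pi_i$ is continuous and $D\Pi_iD^-$ is continuously differentiable ($i=0,\dots,\kappa$). The pair is regular with tractability index $\mu$ and characteristics $r^T_0\le\cdots\le r^T_{\mu-1}<r^T_\mu=m$ if there is an admissible sequence $G_0,\dots,G_\mu$ with $r^T_\mu=m$ and $\mu$ is the smallest such index. DISSECTION INDEX. Set $E_0=E$, $F_0=F$, $m_0=m$. At level $i$, let $E_i$ (size $m_i\times m_i$) have constant rank $\rho_i$, let $T,T^c,Z,Y$ be bases of $\ker E_i$, $(\ker E_i)^\perp$, $(\operatorname{im}E_i)^\perp$, $\operatorname{im}E_i$; require that $a_i=\operatorname{rank}Z^*F_iT$ is constant; let $V$ and $W$ be bases of $\operatorname{im}Z^*F_iT$ and $(\operatorname{im}Z^*F_iT)^\perp$; require that $W^*Z^*F_iT^c$ has full row rank. Let $G,H$ be bases of $\ker W^*Z^*F_iT^c$ and $\ker V^*Z^*F_iT$, respectively, and $G^c,H^c$ bases of complementary subspaces; then $V^*Z^*F_iTH^c$ is nonsingular. Put $\mathfrak E=-(V^*Z^*F_iTH^c)^{-1}V^*Z^*F_iT^cG$ and $C_i=[\,T^cG+TH^c\mathfrak E\ \ TH\,]$ (a matrix function of size $m_i\times\rho_i$), $m_{i+1}=\rho_i$, $E_{i+1}=Y^*E_iC_i$, $F_{i+1}=Y^*(F_iC_i+E_iC_i')$.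 Set $r^D_0=\operatorname{rank}E$ and $r^D_{i+1}=r^D_i+a_i$. The pair is regular with dissection index $\mu$ and characteristics $r^D_0,\dots,r^D_\mu$ if levels $0,\dots,\mu-1$ are well defined in this way and $r^D_{\mu-1}<r^D_\mu=m$. *)

(* Defs.v *)
From HB Require Import structures.
From mathcomp Require Import all_boot all_order all_algebra.
From mathcomp Require Import all_classical all_reals all_analysis.

Set Implicit Arguments.
Unset Strict Implicit.
Unset Printing Implicit Defensive.

Import Order.TTheory GRing.Theory Num.Theory.
Import numFieldNormedType.Exports.

Local Open Scope classical_set_scope.
Local Open Scope ring_scope.

(* Subspaces of R^n are {vspace 'cV[R]_n}; matrices act on column vectors.    *)

Section Subspaces.
Context {R : realType}.

Definition kercol n p (M : 'M[R]_(n, p)) : {vspace 'cV[R]_p} :=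
  lker (linfun (mulmx M : 'cV[R]_p -> 'cV[R]_n)).

Definition imcol n p (M : 'M[R]_(n, p)) : {vspace 'cV[R]_n} :=
  limg (linfun (mulmx M : 'cV[R]_p -> 'cV[R]_n)).

Definition preimcol n p (M : 'M[R]_(n, p)) (U : {vspace 'cV[R]_n}) :
    {vspace 'cV[R]_p} :=
  (linfun (mulmx M : 'cV[R]_p -> 'cV[R]_n) @^-1: U)%VS.

Definition orthcomp n (U : {vspace 'cV[R]_n}) : {vspace 'cV[R]_n} :=
  (\bigcap_(i < \dim U) kercol ((vbasis U)`_i)^T)%VS.

Lemma mem_kercol n p (M : 'M[R]_(n, p)) z : (z \in kercol M) = (M *m z == 0).
Proof. by rewrite memv_ker lfunE. Qed.

Lemma mem_imcol n p (M : 'M[R]_(n, p)) y :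
  reflect (exists z, y = M *m z) (y \in imcol M).
Proof.
apply: (iffP memv_imgP) => [[z _ ->]|[z ->]]; exists z; rewrite ?lfunE //.
exact: memvf.
Qed.

Lemma mem_preimcol n p (M : 'M[R]_(n, p)) U z :
  (z \in preimcol M U) = (M *m z \in U).
Proof. by rewrite -memv_preim lfunE. Qed.

Lemma mem_orthcomp n (U : {vspace 'cV[R]_n}) z :
  (z \in orthcomp U) <-> (forall y, y \in U -> y^T *m z = 0).
Proof.
split=> [|H].
  move/subv_bigcapP=> H y /coord_vbasis ->.
  rewrite linear_sum mulmx_suml big1 // => i _.
  by have := H i isT; rewrite -memvE mem_kercol linearZ /= -scalemxAl => /eqP ->;
     rewrite scaler0.
apply/subv_bigcapP=> i _; rewrite -memvE mem_kercol; apply/eqP/H.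
by apply/vbasis_mem/mem_nth; rewrite size_tuple.
Qed.

Definition is_dsum n (U V W : {vspace 'cV[R]_n}) : Prop :=
  (U + V)%VS = W /\ (U :&: V)%VS = 0%VS.

Definition is_projector n (P : 'M[R]_n) : Prop := P *m P = P.

Definition is_basis n k (C : 'M[R]_(n, k)) (U : {vspace 'cV[R]_n}) : Prop :=
  basis_of U [tuple col j C | j < k].

End Subspaces.

(* Calculus on an interval I, which may contain its endpoints: limits are     *)
(* taken within I, hence derivatives are one-sided at endpoints.  The values  *)
(* of the functions outside I are irrelevant.                                 *)

Section Smoothness.
Context {R : realType}.
Variable I : interval R.

Definition nondegenerate_interval : Prop := exists a b, [/\ a \in I, b \in I & a < b].

Definition diff_quotient (f : R -> R) (t s : R) : R := (f s - f t) / (s - t).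

Definition derivable_on (f : R -> R) : Prop :=
  forall t, t \in I -> cvg (diff_quotient f t @ within [set` I] t^').

Definition derive_on (f : R -> R) (t : R) : R :=
  lim (diff_quotient f t @ within [set` I] t^').

Fixpoint Cn (n : nat) (f : R -> R) : Prop :=
  {within [set` I], continuous f} /\
  (if n is n'.+1 then derivable_on f /\ Cn n' (derive_on f) else True).

Definition mxCn n p q (M : R -> 'M[R]_(p, q)) : Prop :=
  forall i j, Cn n (fun t => M t i j).

Definition mxderive p q (M : R -> 'M[R]_(p, q)) (t : R) : 'M[R]_(p, q) :=
  \matrix_(i, j) derive_on (fun s => M s i j) t.

(* The constructions below differentiate bases at most once, so bases of      *)
(* time-varying subspaces are taken of class C^1.                             *)
Definition is_basis_fun n k (C : R -> 'M[R]_(n, k))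
    (U : R -> {vspace 'cV[R]_n}) : Prop :=
  mxCn 1 C /\ forall t, t \in I -> is_basis (C t) (U t).

Definition is_orthonormal_basis_fun n k (C : R -> 'M[R]_(n, k))
    (U : R -> {vspace 'cV[R]_n}) : Prop :=
  is_basis_fun C U /\ forall t, t \in I -> (C t)^T *m C t = 1%:M.

Definition is_C1_subspace n (U : R -> {vspace 'cV[R]_n}) : Prop :=
  exists P : R -> 'M[R]_n, mxCn 1 P /\
    forall t, t \in I ->
      [/\ is_projector (P t), imcol (P t) = U t & kercol (P t) = orthcomp (U t)].

End Smoothness.

Section Regularity.
Context {R : realType}.
Variable I : interval R.

Definition pre_regular n (E F : R -> 'M[R]_n) (r theta : nat) : Prop :=
  forall t, t \in I ->
    [/\ imcol (row_mx (E t) (F t)) = fullv,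
        \rank (E t) = r
      & \dim (kercol (E t) :&: preimcol (F t) (imcol (E t))) = theta].

Definition reduction_step n r (E F : R -> 'M[R]_n) (E1 F1 : R -> 'M[R]_r) :
    Prop :=
  exists (Y : R -> 'M[R]_(n, r)) (Z : R -> 'M[R]_(n, n - r))
         (C : R -> 'M[R]_(n, r)),
    [/\ is_basis_fun I Y (fun t => imcol (E t)),
        is_basis_fun I Z (fun t => orthcomp (imcol (E t))),
        is_basis_fun I C (fun t => kercol ((Z t)^T *m F t))
      & forall t, t \in I ->
          E1 t = (Y t)^T *m E t *m C t /\
          F1 t = (Y t)^T *m (F t *m C t + E t *m mxderive I C t)].

(* Sizes along a reduction: m_0 = m and m_(i+1) = r_i, definitionally. *)
Definition dims (m : nat) (r : nat -> nat) (i : nat) : nat :=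
  if i is j.+1 then r j else m.

Definition regular m (E F : R -> 'M[R]_m) (mu : nat) (r theta : nat -> nat) :
    Prop :=
  [/\ (0 < mu)%N, (r 0%N < m)%N, r mu = r mu.-1,
      (forall i, (i.+1 < mu)%N -> (r i.+1 < r i)%N)
    & exists E_ F_ : forall i, R -> 'M[R]_(dims m r i),
      [/\ E_ 0%N = E /\ F_ 0%N = F,
          (forall i, (i < mu)%N -> pre_regular (E_ i) (F_ i) (r i) (theta i)),
          (forall i, (i.+1 < mu)%N ->
             reduction_step (E_ i) (F_ i) (E_ i.+1) (F_ i.+1))
        & [/\ (0 < r mu.-1)%N,
              reduction_step (E_ mu.-1) (F_ mu.-1)
                             (E_ mu.-1.+1) (F_ mu.-1.+1)
            & forall t, t \in I -> E_ mu.-1.+1 t \in unitmx]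
          \/ r mu.-1 = 0%N]].

End Regularity.

Section Strangeness.
Context {R : realType}.
Variable I : interval R.

Definition strangeness_values m (E F : R -> 'M[R]_m) (r a s d u : nat) : Prop :=
  [/\ d = (r - s)%N, u = (m - r - a - s)%N
    & exists (T : R -> 'M[R]_(m, m - r)) (Tc : R -> 'M[R]_(m, r))
             (Z : R -> 'M[R]_(m, m - r)) (V : R -> 'M[R]_(m - r, m - r - a)),
      [/\ is_orthonormal_basis_fun I T (fun t => kercol (E t)),
          is_orthonormal_basis_fun I Tc (fun t => orthcomp (kercol (E t))),
          is_orthonormal_basis_fun I Z (fun t => orthcomp (imcol (E t))),
          is_orthonormal_basis_fun I V
            (fun t => orthcomp (imcol ((Z t)^T *m F t *m T t)))
        & forall t, t \in I ->
            [/\ \rank (E t) = r,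
                \rank ((Z t)^T *m F t *m T t) = a
              & \rank ((V t)^T *m ((Z t)^T *m F t *m Tc t)) = s]]].

(* Canonical form.  Rows s, d, a, s, u and columns s, d, a, s + u: the last   *)
(* two row blocks are grouped, so that all matrices are square of size        *)
(* s + (d + (a + (s + u))).  In canonE the block X is I_s for the form itself *)
(* and 0 for the successor pair.                                              *)
Definition canonE (s d a u : nat) (X : 'M[R]_s) :
    'M[R]_(s + (d + (a + (s + u)))) :=
  block_mx X 0 0 (block_mx 1%:M 0 0 0).

Definition canonF (s d a u : nat) (F12 : 'M[R]_(s, d)) (F14 : 'M[R]_(s, s + u))
    (F24 : 'M[R]_(d, s + u)) : 'M[R]_(s + (d + (a + (s + u)))) :=
  block_mx
    (0 : 'M[R]_s)                                    (row_mx F12 (row_mx 0 F14))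
    (col_mx 0 (col_mx 0 (col_mx (1%:M : 'M[R]_s) 0)))
    (block_mx 0                                   (row_mx 0 F24)
              0                                   (block_mx (1%:M : 'M[R]_a) 0
                                                            0             0)).

Definition strangeness_step m (E F : R -> 'M[R]_m) (a s d u : nat)
    (E1 F1 : R -> 'M[R]_m) : Prop :=
  exists (L K : R -> 'M[R]_m) (e : (s + (d + (a + (s + u))) = m)%N)
         (F12 : R -> 'M[R]_(s, d)) (F14 : R -> 'M[R]_(s, s + u))
         (F24 : R -> 'M[R]_(d, s + u)),
    [/\ mxCn I 0 L, mxCn I 1 K
      & forall t, t \in I ->
          [/\ L t \in unitmx /\ K t \in unitmx,
              L t *m E t *m K t = castmx (e, e) (canonE d a u 1%:M),
              L t *m F t *m K t + L t *m E t *m mxderive I K t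
                = castmx (e, e) (canonF a (F12 t) (F14 t) (F24 t)),
              E1 t = castmx (e, e) (canonE d a u (0 : 'M[R]_s))
            & F1 t = castmx (e, e) (canonF a (F12 t) (F14 t) (F24 t))]].

(* The iteration is recorded for all i: once s_i = 0, the successor of the    *)
(* canonical form is the form itself, so constancy of the values beyond muS   *)
(* is automatic.                                                              *)
Definition strangeness_index m (E F : R -> 'M[R]_m) (muS : nat)
    (r a s d u : nat -> nat) : Prop :=
  (exists E_ F_ : nat -> R -> 'M[R]_m,
    [/\ E_ 0%N = E, F_ 0%N = F
      & forall i,
          strangeness_values (E_ i) (F_ i) (r i) (a i) (s i) (d i) (u i) /\
          strangeness_step (E_ i) (F_ i) (a i) (s i) (d i) (u i)
                           (E_ i.+1) (F_ i.+1)]) /\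
  s muS = 0%N /\ (forall i, (i < muS)%N -> s i <> 0%N).

End Strangeness.

Section Tractability.
Context {R : realType}.
Variable I : interval R.

Definition proper_factorization m k (E : R -> 'M[R]_m)
    (A : R -> 'M[R]_(m, k)) (D : R -> 'M[R]_(k, m)) : Prop :=
  [/\ mxCn I 0 A, mxCn I 1 D,
      is_C1_subspace I (fun t => kercol (A t)),
      is_C1_subspace I (fun t => imcol (D t))
    & forall t, t \in I ->
        E t = A t *m D t /\ is_dsum (kercol (A t)) (imcol (D t)) fullv].

Definition admissible m k (A : R -> 'M[R]_(m, k)) (D : R -> 'M[R]_(k, m))
    (F : R -> 'M[R]_m) (kappa : nat) (rT : nat -> nat) : Prop :=
  exists (Rp : R -> 'M[R]_k) (Dm : R -> 'M[R]_(m, k))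
         (Q G B Pi : nat -> R -> 'M[R]_m)
         (X : nat -> R -> {vspace 'cV[R]_m}),
  let P i t := 1%:M - Q i t in
  let N i t := kercol (G i t) in
  let Nsum i t := (\sum_(j < i) N j t)%VS in
  let Nhat i t := (Nsum i t :&: N i t)%VS in
  let DPiD i t := D t *m Pi i t *m Dm t in
  [/\ mxCn I 1 (Q 0%N),
      (forall t, t \in I ->
        [/\ [/\ is_projector (Rp t), imcol (Rp t) = imcol (D t)
              & kercol (Rp t) = kercol (A t)],
            is_projector (Q 0%N t) /\ imcol (Q 0%N t) = kercol (D t),
            [/\ Dm t *m D t *m Dm t = Dm t, D t *m Dm t *m D t = D t,
                D t *m Dm t = Rp t & Dm t *m D t = P 0%N t]
          & [/\ G 0%N t = A t *m D t, B 0%N t = F t - A t *m mxderive I D t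
              & Pi 0%N t = P 0%N t]]),
      (forall i t, (i < kappa)%N -> t \in I ->
        [/\ G i.+1 t = G i t + B i t *m Q i t,
            B i.+1 t = B i t *m P i t
              - G i.+1 t *m Dm t *m mxderive I (DPiD i.+1) t
                *m (D t *m Pi i t),
            Pi i.+1 t = Pi i t *m P i.+1 t,
            is_projector (Q i.+1 t) /\ imcol (Q i.+1 t) = N i.+1 t
          & is_dsum (Nhat i.+1 t) (X i.+1 t) (Nsum i.+1 t) /\
            (X i.+1 t <= kercol (Q i.+1 t))%VS]),
      (forall i, (0 < i <= kappa)%N ->
        exists n, forall t, t \in I -> \dim (Nhat i t) = n)
    & forall i, (i <= kappa)%N ->
        [/\ (forall t, t \in I -> \rank (G i t) = rT i),
            mxCn I 0 (Pi i) & mxCn I 1 (DPiD i)]].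

(* The index is a property of the pair, not of the factorization E = AD: it   *)
(* is required for every proper factorization, and one must exist.            *)
Definition tractability_index m (E F : R -> 'M[R]_m) (mu : nat)
    (rT : nat -> nat) : Prop :=
  (exists k (A : R -> 'M[R]_(m, k)) (D : R -> 'M[R]_(k, m)),
     proper_factorization E A D) /\
  forall k (A : R -> 'M[R]_(m, k)) (D : R -> 'M[R]_(k, m)),
    proper_factorization E A D ->
    [/\ admissible A D F mu rT,
        rT mu = m,
        (forall i, (i < mu)%N -> (rT i <= rT i.+1)%N), (rT mu.-1 < rT mu)%N
      & forall kappa rT', (kappa < mu)%N -> admissible A D F kappa rT' ->
          rT' kappa <> m].

End Tractability.

Section Dissection.
Context {R : realType}.
Variable I : interval R.

(* One level, with rho = rank E and a = rank Z^*FT; g and h are the           *)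
(* dimensions of the two kernels, and C has g + h = rho columns.              *)
Definition dissection_step n (E F : R -> 'M[R]_n) (rho a : nat)
    (E1 F1 : R -> 'M[R]_rho) : Prop :=
  exists (T : R -> 'M[R]_(n, n - rho)) (Tc : R -> 'M[R]_(n, rho))
         (Z : R -> 'M[R]_(n, n - rho)) (Y : R -> 'M[R]_(n, rho))
         (V : R -> 'M[R]_(n - rho, a)) (W : R -> 'M[R]_(n - rho, n - rho - a))
         (g h : nat) (e : (g + h = rho)%N)
         (G : R -> 'M[R]_(rho, g)) (Gc : R -> 'M[R]_(rho, rho - g))
         (H : R -> 'M[R]_(n - rho, h)) (Hc : R -> 'M[R]_(n - rho, a))
         (C : R -> 'M[R]_(n, rho)),
  let ZFT t := (Z t)^T *m F t *m T t in
  let ZFTc t := (Z t)^T *m F t *m Tc t in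
  let frakE t :=
    - (invmx ((V t)^T *m ZFT t *m Hc t) *m ((V t)^T *m ZFTc t *m G t)) in
  [/\ [/\ (forall t, t \in I -> \rank (E t) = rho),
          is_basis_fun I T (fun t => kercol (E t)),
          is_basis_fun I Tc (fun t => orthcomp (kercol (E t))),
          is_basis_fun I Z (fun t => orthcomp (imcol (E t)))
        & is_basis_fun I Y (fun t => imcol (E t))],
      [/\ (forall t, t \in I -> \rank (ZFT t) = a),
          is_basis_fun I V (fun t => imcol (ZFT t)),
          is_basis_fun I W (fun t => orthcomp (imcol (ZFT t)))
        & forall t, t \in I -> row_free ((W t)^T *m ZFTc t)],
      [/\ is_basis_fun I G (fun t => kercol ((W t)^T *m ZFTc t)),
          is_basis_fun I H (fun t => kercol ((V t)^T *m ZFT t)),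
          is_basis_fun I Gc (fun t => imcol (Gc t)) /\
            (forall t, t \in I -> is_dsum (imcol (G t)) (imcol (Gc t)) fullv)
        & is_basis_fun I Hc (fun t => imcol (Hc t)) /\
            (forall t, t \in I -> is_dsum (imcol (H t)) (imcol (Hc t)) fullv)],
      mxCn I 1 C
    & forall t, t \in I ->
        [/\ C t = castmx (erefl n, e)
              (row_mx (Tc t *m G t + T t *m Hc t *m frakE t) (T t *m H t)),
            E1 t = (Y t)^T *m E t *m C t
          & F1 t = (Y t)^T *m (F t *m C t + E t *m mxderive I C t)]].

Definition dissection_index m (E F : R -> 'M[R]_m) (mu : nat)
    (rD : nat -> nat) : Prop :=
  exists (rho a : nat -> nat) (E_ F_ : forall i, R -> 'M[R]_(dims m rho i)),
    [/\ E_ 0%N = E /\ F_ 0%N = F,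
        (forall i, (i < mu)%N ->
           dissection_step (E_ i) (F_ i) (a i) (E_ i.+1) (F_ i.+1)),
        (rD 0%N = rho 0%N /\
         forall i, (i < mu)%N -> rD i.+1 = (rD i + a i)%N)
      & (rD mu.-1 < rD mu)%N /\ rD mu = m].

End Dissection.

(* Main.v *)
(* All three indices are read off the reduction chain, which is determined up
   to equivalence of pairs: two bases of S_i differ by a nonsingular C^1 factor.

   Dissection: the matrix C_i of the dissection procedure is a basis of S_i, so
   its chain is one of the reduction chains.

   Strangeness: adapted frames of N cap S and of its complements in N and in S
   bring the pair into canonical form, the last block being killed by a linear
   differential equation.  The successor pair is the reduced pair bordered by 0
   in E and by an identity in F, hence regular with shifted characteristics.

   Tractability: put K_0 = ker E and let K_(i+1) consist of the x such that E x
   is a value of F y + E y' for a section y of K_i.  Induction along the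
   reduction chain gives dim K_(i+1) = dim K_i + theta_i.  For every admissible
   sequence N_0 + ... + N_i = K_i, whence rank G_(i+1) = m - theta_i; admissible
   sequences exist because, for widely orthogonal projectors, Pi_i is the
   orthogonal projector along the smooth subspace K_i. *)

Require Import Defs.
From mathcomp Require Import all_boot all_order all_algebra.
From mathcomp Require Import all_classical all_reals all_analysis.
From mathcomp Require Import zify ring lra.

Set Implicit Arguments.
Unset Strict Implicit.
Unset Printing Implicit Defensive.

Import Order.TTheory GRing.Theory Num.Theory.
Import numFieldNormedType.Exports.

Local Open Scope classical_set_scope.
Local Open Scope ring_scope.

(** * Calculus on an interval *)

Section Derivatives.
Context {R : realType}.
Implicit Types (I : interval R) (f g : R -> R) (t s l : R).

(** Bases must be smooth on all of [I], which may be unbounded or contain endpoints, so minors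
    cannot be selected locally. Orthoprojectors are written by one formula valid at constant rank
    ([orthoproj]), and frames are obtained by transporting a basis along a linear flow; hence the
    primitives and the global Picard iteration at the start.

    Each reduction, dissection or strangeness step costs one derivative (the term E C'). Each level
    of the spaces K_i costs two: one for the reduced pair, one because the values F y + E y' contain
    a derivative. As the index is at most m, a bound in terms of m alone suffices.

    In an admissible sequence only D Pi_i D^- is differentiable, not Q_i, so the columns of Q_i are
    no sections to which F y + E y' could be applied. The substitute is T = Pi_(i-1) Q_i D^-: D T is
    a difference of two of the differentiable projectors and T = D^- (D T). The identities obtained
    by differentiating phi_h (D T) = D T and phi_i (D T) = 0, for phi_h = D Pi_h D^- and h < i, then
    match the correction terms of B_i exactly. After that, rank G_(i+1) is squeezed by counting
    dimensions. *)

Definition has_deriv I f t l : Prop :=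
  diff_quotient f t @ within [set` I] t^' --> l.

Definition cts_at I f t : Prop := f @ within [set` I] (nbhs t) --> f t.

Lemma cts_atP I f t : cts_at I f t <->
  forall e, 0 < e -> exists2 d, 0 < d &
    forall s, s \in I -> `|s - t| < d -> `|f s - f t| < e.
Proof.
split=> [+ e e0|H].
  move/cvgrPdist_lt => /(_ _ e0) /nbhs_ballP [d /= d0 H].
  exists d => // s sI st; rewrite distrC; apply: H => //=.
  by rewrite /ball /= distrC.
apply/cvgrPdist_lt => e e0; have [d d0 {}H] := H _ e0.
apply/nbhs_ballP; exists d => //= s; rewrite /ball /= => st sI.
by rewrite distrC; apply: H; rewrite // distrC.
Qed.

(** Multiplying out by |s - t| and using a weak inequality covers s = t as well, so later estimates
    need no punctured neighbourhoods. *)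
Lemma has_derivP I f t l : has_deriv I f t l <->
  forall e, 0 < e -> exists2 d, 0 < d & forall s, s \in I -> `|s - t| < d ->
    `|f s - f t - l * (s - t)| <= e * `|s - t|.
Proof.
have E s : s != t -> l - diff_quotient f t s =
    - ((f s - f t - l * (s - t)) / (s - t)).
  by move=> st; rewrite /diff_quotient; field; rewrite subr_eq0.
split=> [+ e e0|H].
  move/cvgrPdist_le => /(_ _ e0) /nbhs_ballP [d /= d0 H].
  exists d => // s sI st; have [->|nst] := eqVneq s t.
    by rewrite !subrr mulr0 subr0 normr0 mulr0.
  have := H s; rewrite /ball /= distrC => /(_ st nst sI).
  by rewrite E // normrN normrM normfV ler_pdivrMr // normr_gt0 subr_eq0.
apply/cvgrPdist_le => e e0; have [d d0 {}H] := H _ e0.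
apply/nbhs_ballP; exists d => //= s; rewrite /ball /= => st nst sI.
rewrite E // normrN normrM normfV ler_pdivrMr ?normr_gt0 ?subr_eq0 //.
by apply: H; rewrite // distrC.
Qed.

Lemma has_deriv_cts I f t l : has_deriv I f t l -> cts_at I f t.
Proof.
move=> /has_derivP H; apply/cts_atP => e e0.
have [d d0 {}H] := H 1 ltr01.
have l0 : 0 < 1 + `|l| by rewrite ltr_pwDl.
exists (Num.min d (e / (1 + `|l|))) => [|s sI]; first by rewrite lt_min d0 divr_gt0.
rewrite lt_min => /andP[sd]; rewrite ltr_pdivlMr // => se.
have := H s sI sd; rewrite mul1r => {}H.
apply: le_lt_trans se.
have -> : f s - f t = (f s - f t - l * (s - t)) + l * (s - t) by ring.
apply: le_trans (ler_normD _ _) _.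
by rewrite [_ * (1 + _)]mulrDr mulr1 normrM lerD // mulrC.
Qed.

(** A derivative relative to an interval only sees points near [t]. This turns derivatives found on
    compact segments into derivatives on [I]. *)
Lemma has_deriv_local I J f t l : has_deriv J f t l ->
  (exists2 d, 0 < d & forall s, s \in I -> `|s - t| < d -> s \in J) ->
  has_deriv I f t l.
Proof.
move=> /has_derivP H [d0 d00 IJ]; apply/has_derivP => e e0.
have [d dp {}H] := H _ e0; exists (Num.min d d0); first by rewrite lt_min dp.
by move=> s sI; rewrite lt_min => /andP[s1 s2]; apply: H => //; apply: IJ.
Qed.

Lemma has_deriv_ext I f g t l : t \in I -> {in I, f =1 g} ->
  has_deriv I f t l -> has_deriv I g t l.
Proof.
move=> tI fg /has_derivP H; apply/has_derivP => e /H[d d0 {}H].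
by exists d => // s sI; rewrite -!fg //; apply: H.
Qed.

Lemma cts_at_ext I f g t : t \in I -> {in I, f =1 g} -> cts_at I f t -> cts_at I g t.
Proof.
move=> tI fg /cts_atP H; apply/cts_atP => e /H[d d0 {}H].
by exists d => // s sI; rewrite -!fg //; apply: H.
Qed.

Lemma has_deriv_subset I J f t l : {subset J <= I} -> has_deriv I f t l -> has_deriv J f t l.
Proof. by move=> JI H; apply: (has_deriv_local H); exists 1 => // s sJ _; exact: JI. Qed.

Lemma mem_interval I x y z : x \in I -> y \in I -> x <= z <= y -> z \in I.
Proof. by move=> xI yI; apply: (@interval_is_interval _ I x y xI yI). Qed.

(** Moving from [t] a small fraction [x] of the way towards another point [c] stays in [I], so [t]
    is an accumulation point. Uniqueness of one-sided derivatives, and with it every evaluation of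
    [derive_on], rests on this. *)
Lemma dnbhs_interval_proper I t : nondegenerate_interval I -> t \in I ->
  ProperFilter (within [set` I] t^').
Proof.
move=> [a [b [aI bI ab]]] tI.
have [c cI ct] : exists2 c, c \in I & c != t.
  by have [at_|] := eqVneq a t; [exists b; rewrite // -at_ gt_eqF | exists a].
apply: Build_ProperFilter_ex => P /nbhs_ballP[d /= d0 H].
pose x := Num.min 1 (d / 2 / `|c - t|).
have ct0 : 0 < `|c - t| by rewrite normr_gt0 subr_eq0.
have x0 : 0 < x by rewrite lt_min ltr01 !divr_gt0.
have x1 : x <= 1 by rewrite ge_min lexx.
have xd : x * `|c - t| < d.
  apply: (@le_lt_trans _ _ (d / 2)); last by lra.
  by rewrite -ler_pdivlMr // ge_min lexx orbT.
exists (t + x * (c - t)); apply: H.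
- by rewrite /ball /= opprD addNKr normrN normrM gtr0_norm.
- by rewrite -subr_eq0 addrAC subrr add0r mulf_eq0 negb_or gt_eqF //= subr_eq0.
- have [tc|tc] := leP t c.
    by apply: (mem_interval tI cI); apply/andP; split; nra.
  by apply: (mem_interval cI tI); apply/andP; split; nra.
Qed.

Lemma has_deriv_derive_on I f t l : nondegenerate_interval I -> t \in I ->
  has_deriv I f t l -> derive_on I f t = l.
Proof.
move=> nd tI; have := dnbhs_interval_proper nd tI => ? H.
exact: cvg_lim H.
Qed.

Lemma has_deriv_cst I c t : has_deriv I (fun=> c) t 0.
Proof.
apply/has_derivP => e e0; exists 1 => // s _ _.
by rewrite subrr mul0r subrr normr0 mulr_ge0 // ltW.
Qed.

Lemma has_derivD I f g t l l' : has_deriv I f t l -> has_deriv I g t l' ->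
  has_deriv I (f \+ g) t (l + l').
Proof.
move=> Hf Hg; rewrite /has_deriv.
have -> : diff_quotient (f \+ g) t = diff_quotient f t \+ diff_quotient g t.
  by apply/funext => s; rewrite /diff_quotient /=; ring.
exact: cvgD.
Qed.

Lemma cts_at_dnbhs I f t : cts_at I f t -> f @ within [set` I] t^' --> f t.
Proof. by move=> H P /H; exact: nbhs_dnbhs. Qed.

Lemma has_derivM I f g t l l' : has_deriv I f t l -> has_deriv I g t l' ->
  has_deriv I (f \* g) t (l * g t + f t * l').
Proof.
move=> Hf Hg; rewrite /has_deriv.
have -> : diff_quotient (f \* g) t =
  (diff_quotient f t \* g) \+ (cst (f t) \* diff_quotient g t).
  by apply/funext => s; rewrite /diff_quotient /=; ring.
apply: cvgD; apply: cvgM => //; last exact: cvg_cst.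
exact: cts_at_dnbhs (has_deriv_cts Hg).
Qed.

Lemma has_derivV I f t l : t \in I -> (forall s, s \in I -> f s != 0) ->
  has_deriv I f t l -> has_deriv I (fun s => (f s)^-1) t (- (f t)^-2 * l).
Proof.
move=> tI f0 Hf.
apply: (@cvg_trans _
  ((fun s => - ((f s)^-1 * (f t)^-1) * diff_quotient f t s) @ within [set` I] t^')).
  apply: near_eq_cvg; apply/nbhs_ballP; exists 1 => //= s _ st sI.
  by rewrite /diff_quotient; field; rewrite subr_eq0 st !f0.
have -> : (f t)^-2 = (f t)^-1 * (f t)^-1 by rewrite -exprVn expr2.
apply: cvgM => //; apply: cvgN; apply: cvgM; last exact: cvg_cst.
apply: cvgV; first exact: f0.
exact: cts_at_dnbhs (has_deriv_cts Hf).
Qed.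

End Derivatives.

(** * Mean value inequalities *)

Section Mvt.
Context {R : realType}.
Implicit Types (I : interval R) (f g : R -> R) (t s l : R).

Lemma has_derivZ I c f t l : has_deriv I f t l -> has_deriv I (fun s => c * f s) t (c * l).
Proof.
move=> H; have := has_derivM (has_deriv_cst I c t) H.
by rewrite mul0r add0r.
Qed.

Lemma has_derivN I f t l : has_deriv I f t l -> has_deriv I (fun s => - f s) t (- l).
Proof.
move=> /(@has_derivZ I (-1) f t l); rewrite mulN1r.
by under eq_fun do rewrite mulN1r.
Qed.

Lemma has_derivB I f g t l l' : has_deriv I f t l -> has_deriv I g t l' ->
  has_deriv I (fun s => f s - g s) t (l - l').
Proof. by move=> Hf /has_derivN; apply: has_derivD. Qed.

(** Bridge to the two-sided derivative of the library at interior points, as required by the mean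
    value theorem. *)
Lemma has_deriv_is_derive a b f t l : t \in `]a, b[ -> has_deriv `[a, b] f t l ->
  is_derive t 1 f l.
Proof.
move=> tab /has_derivP H.
have L : (fun h => h^-1 *: (f (h *: (1:R) + t) - f t)) @ 0^' --> l.
  apply/cvgrPdist_le => e e0; have [d d0 {}H] := H _ e0.
  move: tab; rewrite in_itv /= => /andP[at_ tb].
  exists (Num.min d (Num.min (t - a) (b - t))) => /=.
    by rewrite !lt_min d0 !subr_gt0 at_.
  move=> h; rewrite /ball /= sub0r normrN !lt_min => /and3P[hd ha hb] h0.
  have hh : h * 1 + t - t = h by ring.
  have := H (h * 1 + t); rewrite hh in_itv /= => /(_ _ hd).
  have [ha' hb'] : - (t - a) < h /\ h < b - t.
    by split; [have := ler_norm (- h); rewrite normrN | have := ler_norm h]; lra.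
  have -> : (a <= h * 1 + t <= b) by apply/andP; split; lra.
  move=> /(_ isT) {}H; rewrite /GRing.scale /=.
  have -> : l - h^-1 * (f (h * 1 + t) - f t) = - ((f (h * 1 + t) - f t - l * h) / h).
    by field.
  by rewrite normrN normrM normfV ler_pdivrMr // normr_gt0.
by apply: DeriveDef; [apply/cvg_ex; exists l | apply: cvg_lim].
Qed.

Lemma deriv_le I f g f' g' a b : a <= b -> a \in I -> b \in I ->
  (forall t, a <= t <= b -> [/\ has_deriv I f t (f' t), has_deriv I g t (g' t) & f' t <= g' t]) ->
  f b - f a <= g b - g a.
Proof.
move=> ab aI bI H; move: ab; rewrite le_eqVlt => /orP[/eqP->|ab].
  by rewrite !subrr.
have sub : {subset `[a, b] <= I}.
  by move=> t; rewrite in_itv /= => tab; apply: (mem_interval aI bI).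
pose h t := g t - f t.
have Hh t : t \in `[a, b] -> has_deriv `[a, b] h t (g' t - f' t).
  move=> tab; apply: has_deriv_subset sub _.
  by case: (H t); [move: tab; rewrite in_itv | move=> *; apply: has_derivB].
case: (@MVT R h (fun t => g' t - f' t) a b ab).
- move=> x xab; apply: (has_deriv_is_derive xab); apply: Hh.
  by move: xab; rewrite !in_itv /= => /andP[/ltW-> /ltW->].
- apply/subspace_continuousP => x xab.
  exact: (has_deriv_cts (Hh _ xab)).
move=> c cab; rewrite /h => E; rewrite -subr_ge0.
have -> : g b - g a - (f b - f a) = g b - f b - (g a - f a) by ring.
rewrite E; apply: mulr_ge0; last by rewrite subr_ge0 ltW.
have [|_ _] := H c; last by rewrite subr_ge0.
by move: cab; rewrite in_itv /= => /andP[/ltW-> /ltW->].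
Qed.

Lemma deriv_norm_le I f g f' g' a b : a <= b -> a \in I -> b \in I ->
  (forall t, a <= t <= b ->
     [/\ has_deriv I f t (f' t), has_deriv I g t (g' t) & `|f' t| <= g' t]) ->
  `|f b - f a| <= g b - g a.
Proof.
move=> ab aI bI H; rewrite ler_norml; apply/andP; split; last first.
  apply: (@deriv_le I _ _ f' g') => // t /H[]; rewrite ler_norml => ? ? /andP[_].
  by split.
have := @deriv_le I (fun t => - f t) g (fun t => - f' t) g' a b ab aI bI.
rewrite opprK addrC -opprB lerNl opprB => ->// t /H[h1 h2].
by rewrite ler_norml => /andP[h3 _]; split; [exact: has_derivN|done|rewrite lerNl].
Qed.

Lemma deriv0_const I f a b : a \in I -> b \in I ->
  (forall t, t \in I -> has_deriv I f t 0) -> f a = f b.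
Proof.
move=> aI bI H; wlog ab : a b aI bI / a <= b.
  by move=> W; case/orP: (le_total a b) => ab; [|symmetry]; apply: W.
have : `|f b - f a| <= 0 - 0.
  apply: (@deriv_norm_le I f (fun=> 0) (fun=> 0) (fun=> 0)) => // t tab.
  split; [|exact: has_deriv_cst|by rewrite normr0].
  by apply: H; apply: mem_interval tab.
by rewrite subrr normr_le0 subr_eq0 => /eqP ->.
Qed.

End Mvt.

(** * Primitives on an arbitrary interval *)

Section Primitive.
Context {R : realType}.
Implicit Types (I : interval R) (f g : R -> R) (t s l : R).

Let clamp (a b x : R) := Num.max a (Num.min x b).

(** Composing with [clamp] continues [f] by its end values to a continuous function on the line.
    Integrating from [a - 1] over a segment up to [b + 1] makes all of [a, b] interior, where the
    fundamental theorem of calculus gives a two-sided derivative. *)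
Lemma primitive_segment I f a b : a \in I -> b \in I -> a < b ->
  (forall t, t \in I -> cts_at I f t) ->
  exists g, forall t, t \in `[a, b] -> has_deriv `[a, b] g t (f t).
Proof.
move=> aI bI ab cf.
pose h x := f (clamp a b x).
have clab x : clamp a b x \in `[a, b].
  by rewrite in_itv /= /clamp le_max lexx /= ge_max ge_min lexx orbT andbT ltW.
have clI x : clamp a b x \in I by have := clab x; rewrite in_itv /=; apply: mem_interval.
have clid x : x \in `[a, b] -> clamp a b x = x.
  rewrite in_itv /= /clamp => /andP[ax xb].
  by rewrite (min_idPl xb) (max_idPr ax).
have cllip x y : `|clamp a b x - clamp a b y| <= `|x - y|.
  rewrite /clamp; case: (leP x b) => xb; case: (leP y b) => yb.
  - by case: (leP a x) => ax; case: (leP a y) => ay; rewrite ?subrr ?normr0 //;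
      rewrite !ler_norml; apply/andP; split; have := ler_norm (x - y);
      have := ler_norm (y - x); rewrite distrC; lra.
  - by case: (leP a x) => ax; case: (leP a b) => ay; rewrite ?subrr ?normr0 //;
      rewrite !ler_norml; apply/andP; split; have := ler_norm (x - y);
      have := ler_norm (y - x); rewrite distrC; lra.
  - by case: (leP a b) => ax; case: (leP a y) => ay; rewrite ?subrr ?normr0 //;
      rewrite !ler_norml; apply/andP; split; have := ler_norm (x - y);
      have := ler_norm (y - x); rewrite distrC; lra.
  - by rewrite subrr normr0.
have ch : continuous h.
  move=> x; apply/cvgrPdist_lt => e e0.
  have /cts_atP/(_ e e0)[d d0 H] := cf _ (clI x).
  exists d => //= y; rewrite /ball /= => xy; rewrite distrC; apply: H => //.
  by apply: le_lt_trans (cllip _ _) _; rewrite distrC.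
have ih : lebesgue_measure.-integrable `[a - 1, b + 1] (EFin \o h).
  apply: continuous_compact_integrable; first exact: segment_compact.
  exact: continuous_subspaceT.
exists (fun x => \int[lebesgue_measure]_(t in `[a - 1, x]) h t)%R.
move=> t tab; have := tab; rewrite in_itv /= => /andP[at_ tb].
have [||] := @continuous_FTC1_closed R h (a - 1) t (b + 1) _ ih _ (ch t); [lra|lra|].
set G := (fun x => _) => dG eG.
have : is_derive t 1 G (f t).
  by apply: DeriveDef => //; rewrite -derive1E eG /h clid.
case=> /cvg_ex /= [l Hl]; rewrite /derive (cvg_lim _ Hl) // => <-.
apply/has_derivP => e e0; move/cvgrPdist_le: Hl => /(_ _ e0) [d /= d0 H].
exists d => // s _ st; have [->|nst] := eqVneq s t.
  by rewrite !subrr mulr0 subr0 normr0 mulr0.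
have st0 : s - t != 0 by rewrite subr_eq0.
have := H (s - t); rewrite /ball /= sub0r normrN => /(_ st st0).
rewrite /GRing.scale /= mulr1 subrK.
have -> : l - (s - t)^-1 * (G s - G t) = - ((G s - G t - l * (s - t)) / (s - t)).
  by field.
by rewrite normrN normrM normfV ler_pdivrMr ?normr_gt0.
Qed.

(** For each s a primitive [G s] is chosen on the segment between s and [t0], vanishing at [t0].
    Primitives are unique, so the diagonal s -> [G s s] agrees with each of them on its segment and
    inherits the derivative. *)
Lemma primitive_exists I f t0 : nondegenerate_interval I -> t0 \in I ->
  (forall t, t \in I -> cts_at I f t) ->
  exists g, g t0 = 0 /\ forall t, t \in I -> has_deriv I g t (f t).
Proof.
move=> nd t0I cf.
have P a b : a \in I -> b \in I -> a <= t0 <= b -> exists g, g t0 = 0 /\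
    forall t, t \in `[a, b] -> has_deriv `[a, b] g t (f t).
  move=> aI bI /andP[at0]; rewrite le_eqVlt => /orP[/eqP t0b|t0b].
    move: at0; rewrite le_eqVlt => /orP[/eqP at0|at0].
      exists (fun=> 0); split=> // t; rewrite in_itv /= -t0b at0 => tE.
      have -> : t = t0 by apply/eqP; rewrite eq_le andbC.
      apply/has_derivP => e e0; exists 1 => // s; rewrite in_itv /= => sE _.
      have -> : s = t0 by apply/eqP; rewrite eq_le andbC.
      by rewrite !subrr mulr0 subr0 normr0 mulr0.
    have [|g Hg] := @primitive_segment I f a b aI bI _ cf; first by rewrite -t0b.
    exists (fun t => g t - g t0); split; first by rewrite subrr.
    by move=> t /Hg/has_derivB/(_ (has_deriv_cst _ (g t0) t)); rewrite subr0.
  have [|g Hg] := @primitive_segment I f a b aI bI _ cf; first exact: le_lt_trans t0b.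
  exists (fun t => g t - g t0); split; first by rewrite subrr.
  by move=> t /Hg/has_derivB/(_ (has_deriv_cst _ (g t0) t)); rewrite subr0.
have lo s : s \in I -> Num.min s t0 \in I by case: (leP s t0).
have hi s : s \in I -> Num.max s t0 \in I by case: (leP s t0).
have mid s : Num.min s t0 <= t0 <= Num.max s t0.
  by rewrite ge_min le_max !lexx !orbT.
have Q s : exists g, s \in I -> g t0 = 0 /\ forall t,
    t \in `[Num.min s t0, Num.max s t0] ->
    has_deriv `[Num.min s t0, Num.max s t0] g t (f t).
  have [sI|] := boolP (s \in I); last by exists f.
  by have [g Hg] := P _ _ (lo _ sI) (hi _ sI) (mid s); exists g.
have [G HG] := choice Q.
exists (fun s => G s s).
have key a b g : a \in I -> b \in I -> a <= t0 <= b -> g t0 = 0 ->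
    (forall t, t \in `[a, b] -> has_deriv `[a, b] g t (f t)) ->
    forall s, s \in `[a, b] -> G s s = g s.
  move=> aI bI /andP[at0 t0b] g0 Hg s sab.
  have sI : s \in I by move: sab; rewrite in_itv /=; apply: mem_interval.
  have [Gs0 HGs] := HG s sI.
  set J := `[Num.min s t0, Num.max s t0] in HGs.
  have JI : {subset J <= `[a, b]}.
    move=> x; move: sab; rewrite !in_itv /= ge_min le_max => /andP[as_ sb].
    by move=> /andP[/orP[h1|h1] /orP[h2|h2]]; apply/andP; split; lra.
  have sJ : s \in J by rewrite in_itv /= ge_min le_max lexx.
  have tJ : t0 \in J by rewrite in_itv /= ge_min le_max !lexx !orbT.
  have H t : t \in J -> has_deriv J (fun x => G s x - g x) t 0.
    move=> tIJ; rewrite -(subrr (f t)); apply: has_derivB; first exact: HGs.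
    by apply: (has_deriv_subset JI); apply: Hg; exact: JI.
  have /eqP := @deriv0_const R J (fun x => G s x - g x) s t0 sJ tJ H.
  by rewrite Gs0 g0 subrr subr_eq0 => /eqP.
split; first by have [] := HG t0 t0I.
move=> t tI.
(* The segment [a, b] is to contain [t0], [t] and all points of [I] close to [t]. If [I] has no
   point below [t], then [a] is the smaller of [t] and [t0]; [b] is found symmetrically. *)
have [a [aI at0 at_ Ha]] : exists a, [/\ a \in I, a <= t0, a <= t &
    exists2 d, 0 < d & forall s, s \in I -> `|s - t| < d -> a <= s].
  have [[c cI ct]|nc] := pselect (exists2 c, c \in I & c < t).
    exists (Num.min c t0); split; rewrite ?lo // ?ge_min ?lexx ?orbT // ?(ltW ct) //.
    exists (t - c); rewrite ?subr_gt0 // => s sI st; rewrite ge_min; apply/orP; left.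
    by have := ler_norm (t - s); rewrite distrC; lra.
  exists (Num.min t t0); split; rewrite ?lo // ?ge_min ?lexx ?orbT //.
  exists 1 => // s sI _; rewrite ge_min; apply/orP; left; rewrite leNgt; apply/negP => st.
  by apply: nc; exists s.
have [b [bI bt0 tb Hb]] : exists b, [/\ b \in I, t0 <= b, t <= b &
    exists2 d, 0 < d & forall s, s \in I -> `|s - t| < d -> s <= b].
  have [[c cI ct]|nc] := pselect (exists2 c, c \in I & t < c).
    exists (Num.max c t0); split; rewrite ?hi // ?le_max ?lexx ?orbT // ?(ltW ct) //.
    exists (c - t); rewrite ?subr_gt0 // => s sI st; rewrite le_max; apply/orP; left.
    by have := ler_norm (s - t); lra.
  exists (Num.max t t0); split; rewrite ?hi // ?le_max ?lexx ?orbT //.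
  exists 1 => // s sI _; rewrite le_max; apply/orP; left; rewrite leNgt; apply/negP => st.
  by apply: nc; exists s.
have at0b : a <= t0 <= b by rewrite at0.
have tab : t \in `[a, b] by rewrite in_itv /= at_.
have [g [g0 Hg]] := P a b aI bI at0b.
have {}key := key a b g aI bI at0b g0 Hg.
have : has_deriv `[a, b] (fun s => G s s) t (f t).
  by apply: has_deriv_ext tab _ (Hg _ tab) => s sab; rewrite key.
move/has_deriv_local; apply.
case: Ha => d1 d10 H1; case: Hb => d2 d20 H2.
exists (Num.min d1 d2); first by rewrite lt_min d10.
by move=> s sI; rewrite lt_min in_itv /= => /andP[/(H1 _ sI)-> /(H2 _ sI)->].
Qed.

End Primitive.

(** * Closure properties of C^n functions *)

Section CnAlgebra.
Context {R : realType}.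
Variable I : interval R.
Hypothesis nd : nondegenerate_interval I.
Implicit Types (f g : R -> R) (t s l : R).

Lemma Cn0P f : Cn I 0 f <-> forall t, t \in I -> cts_at I f t.
Proof.
by split=> [[/subspace_continuousP H _] t /H //|H]; split=> //; apply/subspace_continuousP.
Qed.

Lemma CnS_cts n f : Cn I n f -> Cn I 0 f.
Proof. by case: n => [|n] [h _]. Qed.

Lemma derivable_has_deriv f t : derivable_on I f -> t \in I ->
  has_deriv I f t (derive_on I f t).
Proof. by move=> df tI; apply: df. Qed.

Lemma Cn_ext n f g : {in I, f =1 g} -> Cn I n f -> Cn I n g.
Proof.
elim: n f g => [|n IHn] f g fg.
  by move=> /Cn0P H; apply/Cn0P => t tI; apply: cts_at_ext (H t tI).
move=> Hf; have c0 := CnS_cts Hf; case: Hf => _ [df Hf].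
have Hg t : t \in I -> has_deriv I g t (derive_on I f t).
  by move=> tI; apply: has_deriv_ext fg _ => //; apply: derivable_has_deriv.
split; last split.
- by apply/subspace_continuousP => t tI; apply: cts_at_ext fg _ => //; move/Cn0P: c0; apply.
- by move=> t tI; apply/cvg_ex; eexists; exact: Hg.
- by apply: IHn Hf => t tI; rewrite (has_deriv_derive_on nd tI (Hg _ tI)).
Qed.

(** Any explicitly given derivative may replace the limit [derive_on]; smoothness is proved below by
    exhibiting derivatives. *)
Lemma CnSP n f : Cn I n.+1 f <->
  exists2 g, (forall t, t \in I -> has_deriv I f t (g t)) & Cn I n g.
Proof.
split=> [[_ [df Hf]]|[g Hg Cg]].
  by exists (derive_on I f) => // t tI; exact: derivable_has_deriv.
split; last split.
- by apply/subspace_continuousP => t tI; apply: has_deriv_cts (Hg _ tI).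
- by move=> t tI; apply/cvg_ex; eexists; exact: Hg.
- by apply: Cn_ext Cg => t tI; rewrite (has_deriv_derive_on nd tI (Hg _ tI)).
Qed.

Lemma Cn_leS n f : Cn I n.+1 f -> Cn I n f.
Proof.
elim: n f => [|n IHn] f; first exact: CnS_cts.
by move=> /CnSP[g Hg Cg]; apply/CnSP; exists g => //; exact: IHn.
Qed.

Lemma Cn_le m n f : (m <= n)%N -> Cn I n f -> Cn I m f.
Proof.
by move=> /subnKC <-; elim: (n - m)%N => [|k IH]; rewrite ?addn0 ?addnS // => /Cn_leS.
Qed.

Lemma Cn1_deriv n f t : Cn I n.+1 f -> t \in I -> has_deriv I f t (derive_on I f t).
Proof. by move=> [_ [df _]] tI; exact: derivable_has_deriv. Qed.

Lemma Cn_cst n c : Cn I n (fun=> c).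
Proof.
elim: n c => [|n IHn] c; last first.
  by apply/CnSP; exists (fun=> 0) => // t _; exact: has_deriv_cst.
by apply/Cn0P => t _; apply: cvg_cst.
Qed.

Lemma CnD n f g : Cn I n f -> Cn I n g -> Cn I n (fun t => f t + g t).
Proof.
elim: n f g => [|n IHn] f g.
  by move=> /Cn0P Hf /Cn0P Hg; apply/Cn0P => t tI; apply: cvgD; [exact: Hf | exact: Hg].
move=> /CnSP[f' df Cf] /CnSP[g' dg Cg]; apply/CnSP.
exists (fun t => f' t + g' t); last exact: IHn.
by move=> t tI; apply: has_derivD; [exact: df | exact: dg].
Qed.

Lemma CnM n f g : Cn I n f -> Cn I n g -> Cn I n (fun t => f t * g t).
Proof.
elim: n f g => [|n IHn] f g.
  by move=> /Cn0P Hf /Cn0P Hg; apply/Cn0P => t tI; apply: cvgM; [exact: Hf | exact: Hg].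
move=> Cf Cg; move: (Cn_leS Cf) (Cn_leS Cg).
move: Cf Cg => /CnSP[f' df Cf] /CnSP[g' dg Cg] Cf0 Cg0; apply/CnSP.
exists (fun t => f' t * g t + f t * g' t); last by apply: CnD; apply: IHn.
by move=> t tI; apply: has_derivM; [exact: df | exact: dg].
Qed.

Lemma CnN n f : Cn I n f -> Cn I n (fun t => - f t).
Proof.
move=> Cf; apply: Cn_ext (CnM (Cn_cst n (-1)) Cf).
by move=> t _; rewrite mulN1r.
Qed.

Lemma CnV n f : (forall t, t \in I -> f t != 0) -> Cn I n f -> Cn I n (fun t => (f t)^-1).
Proof.
move=> f0; elim: n => [|n IHn].
  by move=> /Cn0P Hf; apply/Cn0P => t tI; apply: cvgV; [exact: f0 | exact: Hf].
move=> Cf; have {}IHn := IHn (Cn_leS Cf); move: Cf => /CnSP[f' df Cf]; apply/CnSP.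
exists (fun t => - ((f t)^-1 * (f t)^-1) * f' t).
  move=> t tI; have := has_derivV tI f0 (df t tI).
  by rewrite -exprVn expr2.
by apply: CnM => //; apply: CnN; apply: CnM.
Qed.

Lemma Cn_sum n (T : Type) (s : seq T) (P : pred T) (F : T -> R -> R) :
  (forall i, P i -> Cn I n (F i)) -> Cn I n (fun t => \sum_(i <- s | P i) F i t).
Proof.
move=> H; elim: s => [|x s IHs].
  by under eq_fun do rewrite big_nil; exact: Cn_cst.
have [Px|Px] := boolP (P x).
  by under eq_fun do rewrite big_cons Px; apply: CnD => //; exact: H.
by under eq_fun do rewrite big_cons (negPf Px).
Qed.

Lemma Cn_prod n (T : Type) (s : seq T) (P : pred T) (F : T -> R -> R) :
  (forall i, P i -> Cn I n (F i)) -> Cn I n (fun t => \prod_(i <- s | P i) F i t).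
Proof.
move=> H; elim: s => [|x s IHs].
  by under eq_fun do rewrite big_nil; exact: Cn_cst.
have [Px|Px] := boolP (P x).
  by under eq_fun do rewrite big_cons Px; apply: CnM => //; exact: H.
by under eq_fun do rewrite big_cons (negPf Px).
Qed.

End CnAlgebra.

(** * Smooth matrix functions and their derivatives *)

Section MatrixFunctions.
Context {R : realType}.
Variable I : interval R.
Hypothesis nd : nondegenerate_interval I.

Lemma mxCn_ext k p q (A B : R -> 'M[R]_(p, q)) : {in I, A =1 B} -> mxCn I k A -> mxCn I k B.
Proof. by move=> AB H i j; apply: Cn_ext (H i j) => // t tI; rewrite AB. Qed.

Lemma mxCn_le j k p q (A : R -> 'M[R]_(p, q)) : (j <= k)%N -> mxCn I k A -> mxCn I j A.
Proof. by move=> jk H i l; apply: Cn_le jk _. Qed.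

Lemma mxCn_cst k p q (A : 'M[R]_(p, q)) : mxCn I k (fun=> A).
Proof. by move=> i j; exact: Cn_cst. Qed.

Lemma mxCnD k p q (A B : R -> 'M[R]_(p, q)) :
  mxCn I k A -> mxCn I k B -> mxCn I k (fun t => A t + B t).
Proof. by move=> HA HB i j; under eq_fun do rewrite mxE; apply: CnD. Qed.

Lemma mxCnN k p q (A : R -> 'M[R]_(p, q)) : mxCn I k A -> mxCn I k (fun t => - A t).
Proof. by move=> HA i j; under eq_fun do rewrite mxE; apply: CnN. Qed.

Lemma mxCnB k p q (A B : R -> 'M[R]_(p, q)) :
  mxCn I k A -> mxCn I k B -> mxCn I k (fun t => A t - B t).
Proof. by move=> HA HB; apply: mxCnD => //; exact: mxCnN. Qed.

Lemma mxCnM k p q r (A : R -> 'M[R]_(p, q)) (B : R -> 'M[R]_(q, r)) :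
  mxCn I k A -> mxCn I k B -> mxCn I k (fun t => A t *m B t).
Proof.
move=> HA HB i j; under eq_fun do rewrite mxE.
by apply: Cn_sum => // l _; apply: CnM.
Qed.

Lemma mxCnZ k p q (c : R -> R) (A : R -> 'M[R]_(p, q)) :
  Cn I k c -> mxCn I k A -> mxCn I k (fun t => c t *: A t).
Proof. by move=> Hc HA i j; under eq_fun do rewrite mxE; apply: CnM. Qed.

Lemma mxCnT k p q (A : R -> 'M[R]_(p, q)) : mxCn I k A -> mxCn I k (fun t => (A t)^T).
Proof. by move=> HA i j; under eq_fun do rewrite mxE. Qed.

Lemma mxCn_sum k p q (T : Type) (s : seq T) (P : pred T) (F : T -> R -> 'M[R]_(p, q)) :
  (forall i, P i -> mxCn I k (F i)) -> mxCn I k (fun t => \sum_(i <- s | P i) F i t).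
Proof.
move=> H i j; under eq_fun do rewrite summxE.
by apply: Cn_sum => // l Pl; apply: H.
Qed.

Lemma mxCn_row_mx k p q r (A : R -> 'M[R]_(p, q)) (B : R -> 'M[R]_(p, r)) :
  mxCn I k A -> mxCn I k B -> mxCn I k (fun t => row_mx (A t) (B t)).
Proof.
by move=> HA HB i j; under eq_fun do rewrite mxE; case: (fintype.split j) => l; [exact: HA|exact: HB].
Qed.

Lemma mxCn_col_mx k p q r (A : R -> 'M[R]_(p, r)) (B : R -> 'M[R]_(q, r)) :
  mxCn I k A -> mxCn I k B -> mxCn I k (fun t => col_mx (A t) (B t)).
Proof.
by move=> HA HB i j; under eq_fun do rewrite mxE; case: (fintype.split i) => l; [exact: HA|exact: HB].
Qed.

Lemma mxCn_castmx k p q p' q' (e : (p = p') * (q = q')) (A : R -> 'M[R]_(p, q)) :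
  mxCn I k A -> mxCn I k (fun t => castmx e (A t)).
Proof. by move=> HA i j; under eq_fun do rewrite castmxE. Qed.

Lemma mxCn_colsub k p q r (f : 'I_r -> 'I_q) (A : R -> 'M[R]_(p, q)) :
  mxCn I k A -> mxCn I k (fun t => colsub f (A t)).
Proof. by move=> HA i j; under eq_fun do rewrite mxE. Qed.

Lemma Cn_det k p (A : R -> 'M[R]_p) : mxCn I k A -> Cn I k (fun t => \det (A t)).
Proof.
move=> HA; apply: Cn_sum => // s _; apply: CnM => //; first exact: Cn_cst.
by apply: Cn_prod.
Qed.

Lemma mxCn_adj k p (A : R -> 'M[R]_p) : mxCn I k A -> mxCn I k (fun t => \adj (A t)).
Proof.
move=> HA i j; under eq_fun do rewrite mxE.
apply: CnM => //; first exact: Cn_cst.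
by apply: Cn_det => a b; under eq_fun do rewrite !mxE.
Qed.

(** Cramer's rule leaves polynomials in the entries and one reciprocal. *)
Lemma mxCnV k p (A : R -> 'M[R]_p) : (forall t, t \in I -> A t \in unitmx) ->
  mxCn I k A -> mxCn I k (fun t => invmx (A t)).
Proof.
move=> uA HA; apply: (@mxCn_ext _ _ _ (fun t => (\det (A t))^-1 *: \adj (A t))).
  by move=> t tI; rewrite /invmx uA.
apply: mxCnZ; last exact: mxCn_adj.
by apply: CnV => //; [move=> t /uA; rewrite unitmxE unitfE | exact: Cn_det].
Qed.

Lemma has_deriv_sum (T : Type) (s : seq T) (F : T -> R -> R) F' t :
  (forall i, has_deriv I (F i) t (F' i)) ->
  has_deriv I (fun x => \sum_(i <- s) F i x) t (\sum_(i <- s) F' i).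
Proof.
move=> H; elim: s => [|y s IHs].
  by rewrite big_nil; under eq_fun do rewrite big_nil; exact: has_deriv_cst.
rewrite big_cons (_ : (fun x => _) = F y \+ (fun x => \sum_(i <- s) F i x)).
  exact: has_derivD.
by apply/funext => x; rewrite big_cons.
Qed.

Definition has_mxderiv p q (A : R -> 'M[R]_(p, q)) t (A' : 'M[R]_(p, q)) :=
  forall i j, has_deriv I (fun s => A s i j) t (A' i j).

Lemma mxderiveP k p q (A : R -> 'M[R]_(p, q)) t : mxCn I k.+1 A -> t \in I ->
  has_mxderiv A t (mxderive I A t).
Proof. by move=> HA tI i j; rewrite mxE; apply: Cn1_deriv (HA i j) tI. Qed.

Lemma has_mxderivE p q (A : R -> 'M[R]_(p, q)) t A' : t \in I -> has_mxderiv A t A' ->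
  mxderive I A t = A'.
Proof.
by move=> tI H; apply/matrixP => i j; rewrite mxE; apply: has_deriv_derive_on (H i j).
Qed.

Lemma mxCn_mxderive k p q (A : R -> 'M[R]_(p, q)) : mxCn I k.+1 A -> mxCn I k (mxderive I A).
Proof. by move=> HA i j; under eq_fun do rewrite mxE; case: (HA i j) => _ []. Qed.

Lemma mxCnSP k p q (A A' : R -> 'M[R]_(p, q)) :
  (forall t, t \in I -> has_mxderiv A t (A' t)) -> mxCn I k A' -> mxCn I k.+1 A.
Proof.
by move=> H HA' i j; apply/CnSP => //; exists (fun t => A' t i j) => // t tI; exact: H.
Qed.

Lemma has_mxderivM p q r (A : R -> 'M[R]_(p, q)) (B : R -> 'M[R]_(q, r)) t A' B' :
  has_mxderiv A t A' -> has_mxderiv B t B' ->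
  has_mxderiv (fun s => A s *m B s) t (A' *m B t + A t *m B').
Proof.
move=> HA HB i j; rewrite !mxE -big_split /=; under eq_fun do rewrite mxE.
by apply: has_deriv_sum => l; apply: has_derivM.
Qed.

Lemma has_mxderiv_cst p q (A : 'M[R]_(p, q)) t : has_mxderiv (fun=> A) t 0.
Proof. by move=> i j; rewrite mxE; exact: has_deriv_cst. Qed.

Lemma has_mxderivT p q (A : R -> 'M[R]_(p, q)) t A' :
  has_mxderiv A t A' -> has_mxderiv (fun s => (A s)^T) t A'^T.
Proof.
move=> HA i j; rewrite mxE (_ : (fun s => _) = (fun s => A s j i)); first exact: HA.
by apply/funext => s; rewrite mxE.
Qed.

Lemma has_mxderiv_row_mx p q r (A : R -> 'M[R]_(p, q)) (B : R -> 'M[R]_(p, r)) t A' B' :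
  has_mxderiv A t A' -> has_mxderiv B t B' ->
  has_mxderiv (fun s => row_mx (A s) (B s)) t (row_mx A' B').
Proof.
move=> HA HB i j; rewrite mxE; under eq_fun do rewrite mxE.
by case: (fintype.split j) => l; [exact: HA|exact: HB].
Qed.

Lemma has_mxderiv_ext p q (A B : R -> 'M[R]_(p, q)) t A' : t \in I -> {in I, A =1 B} ->
  has_mxderiv A t A' -> has_mxderiv B t A'.
Proof. by move=> tI AB H i j; apply: has_deriv_ext (H i j) => // s sI; rewrite AB. Qed.

Lemma mxderive_ext p q (A B : R -> 'M[R]_(p, q)) t : t \in I -> {in I, A =1 B} ->
  mxCn I 1 A -> mxderive I A t = mxderive I B t.
Proof.
move=> tI AB /mxderiveP/(_ tI) H; symmetry; apply: has_mxderivE => //.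
exact: has_mxderiv_ext H.
Qed.

Lemma mxderiveM p q r (A : R -> 'M[R]_(p, q)) (B : R -> 'M[R]_(q, r)) t : t \in I ->
  mxCn I 1 A -> mxCn I 1 B ->
  mxderive I (fun s => A s *m B s) t = mxderive I A t *m B t + A t *m mxderive I B t.
Proof.
by move=> tI HA HB; apply: has_mxderivE => //; apply: has_mxderivM; exact: mxderiveP.
Qed.

Lemma mxderiveT p q (A : R -> 'M[R]_(p, q)) t : t \in I -> mxCn I 1 A ->
  mxderive I (fun s => (A s)^T) t = (mxderive I A t)^T.
Proof. by move=> tI HA; apply: has_mxderivE => //; apply: has_mxderivT; exact: mxderiveP. Qed.

Lemma mxderive_cst p q (A : 'M[R]_(p, q)) t : t \in I -> mxderive I (fun=> A) t = 0.
Proof. by move=> tI; apply: has_mxderivE => //; exact: has_mxderiv_cst. Qed.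

Lemma mxderive_row_mx p q r (A : R -> 'M[R]_(p, q)) (B : R -> 'M[R]_(p, r)) t : t \in I ->
  mxCn I 1 A -> mxCn I 1 B ->
  mxderive I (fun s => row_mx (A s) (B s)) t = row_mx (mxderive I A t) (mxderive I B t).
Proof.
by move=> tI HA HB; apply: has_mxderivE => //; apply: has_mxderiv_row_mx; exact: mxderiveP.
Qed.

End MatrixFunctions.

(** * Linear differential equations *)

Section LinearODE.
Context {R : realType}.

Lemma is_derive_has_deriv (I : interval R) (f : R -> R) (t l : R) :
  is_derive t 1 f l -> has_deriv I f t l.
Proof.
case=> /cvg_ex /= [l' Hl]; rewrite /derive (cvg_lim _ Hl) // => <-.
apply/has_derivP => e e0; move/cvgrPdist_le: Hl => /(_ _ e0) [d /= d0 H].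
exists d => // s _ st; have [->|nst] := eqVneq s t.
  by rewrite !subrr mulr0 subr0 normr0 mulr0.
have st0 : s - t != 0 by rewrite subr_eq0.
have := H (s - t); rewrite /ball /= sub0r normrN => /(_ st st0).
rewrite /GRing.scale /= mulr1 subrK.
have -> : l' - (s - t)^-1 * (f s - f t) = - ((f s - f t - l' * (s - t)) / (s - t)).
  by field.
by rewrite normrN normrM normfV ler_pdivrMr ?normr_gt0.
Qed.

Lemma has_deriv_comp (I : interval R) (F h : R -> R) (t l L : R) : has_deriv I h t l ->
  is_derive (h t) 1 F L -> has_deriv I (F \o h) t (L * l).
Proof.
move=> Hh /(is_derive_has_deriv `]-oo, +oo[) /has_derivP HF; apply/has_derivP => e e0.
have M0 : 0 < `|L| + (`|l| + 1) by rewrite !ltr_wpDl ?ltr01.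
(* With |a| <= (|l| + 1) |s - t|, the error is at most e1 |a| + |L| e1 |s - t|, which this choice
   keeps below e |s - t|. *)
pose e1 := Num.min 1 (e / (`|L| + (`|l| + 1))).
have e10 : 0 < e1 by rewrite lt_min ltr01 divr_gt0.
have e11 : e1 <= 1 by rewrite ge_min lexx.
have e1e : e1 * (`|L| + (`|l| + 1)) <= e by rewrite -ler_pdivlMr // ge_min lexx orbT.
have [d1 d10 {}HF] := HF _ e10.
have /cts_atP/(_ _ d10)[d2 d20 H2] := has_deriv_cts Hh.
have /has_derivP/(_ _ e10)[d3 d30 H3] := Hh.
exists (Num.min d2 d3) => [|s sI]; first by rewrite lt_min d20.
rewrite lt_min => /andP[s2 s3].
have {H2} := H2 s sI s2; have {H3} := H3 s sI s3.
move: (HF (h s)); rewrite in_itv => /(_ isT).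
set a := h s - h t => HF1 H3 H2; have {HF1 H2} H1 := HF1 H2.
rewrite /= (_ : _ - _ - _ = (F (h s) - F (h t) - L * a) + L * (a - l * (s - t))); last first.
  by ring.
have aB : `|a| <= (`|l| + 1) * `|s - t|.
  rewrite (_ : a = (a - l * (s - t)) + l * (s - t)); last by ring.
  rewrite [(_ + 1) * _]mulrDl mul1r addrC (le_trans (ler_normD _ _)) // normrM lerD //.
  by apply: le_trans H3 _; rewrite ler_piMl.
apply: (@le_trans _ _ (e1 * (`|L| + (`|l| + 1)) * `|s - t|)); last by rewrite ler_wpM2r.
rewrite (_ : e1 * _ * _ = e1 * ((`|l| + 1) * `|s - t|) + `|L| * (e1 * `|s - t|)); last by ring.
apply: le_trans (ler_normD _ _) _; apply: lerD.
  by apply: le_trans H1 _; apply: ler_wpM2l => //; exact: ltW.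
by rewrite normrM; exact: ler_wpM2l.
Qed.

(** The intervals of radius b / 2^k around u_k meet pairwise, so the supremum of their left ends
    lies in all of them. This yields the limit together with its rate. *)
Lemma geometric_limit (u : nat -> R) b :
  (forall k, `|u k.+1 - u k| <= b * 2^-1 ^+ k.+1) ->
  exists l, forall k, `|l - u k| <= b * 2^-1 ^+ k.
Proof.
move=> H.
have b0 : 0 <= b.
  have := le_trans (normr_ge0 _) (H 0%N); rewrite expr1; lra.
have st j k : `|u (j + k)%N - u j| <= b * 2^-1 ^+ j - b * 2^-1 ^+ (j + k).
  elim: k => [|k IHk]; first by rewrite addn0 !subrr normr0.
  rewrite addnS (_ : u _ - u j = (u (j + k).+1 - u (j + k)%N) + (u (j + k)%N - u j)); last by ring.
  apply: le_trans (ler_normD _ _) _.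
  have := H (j + k)%N; move: IHk; rewrite exprS; lra.
have ub k j : u k - b * 2^-1 ^+ k <= u j + b * 2^-1 ^+ j.
  have p i : 0 <= b * 2^-1 ^+ i by rewrite mulr_ge0 // exprn_ge0 // invr_ge0.
  case: (leqP k j) => [/subnKC|/ltnW/subnKC] <-.
    by have := st k (j - k)%N; have := p (k + (j - k))%N; rewrite ler_norml => ? /andP[]; lra.
  by have := st j (k - j)%N; have := p (j + (k - j))%N; rewrite ler_norml => ? /andP[]; lra.
pose E := range (fun k => u k - b * 2^-1 ^+ k).
have Ene : E !=set0 by exists (u 0%N - b * 2^-1 ^+ 0); exists 0%N.
have Eub : has_ubound E by exists (u 0%N + b * 2^-1 ^+ 0) => _ [k _ <-]; exact: ub.
exists (sup E) => k; rewrite ler_distl; apply/andP; split.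
  by apply: ub_le_sup => //; exists k.
by apply: ge_sup => // _ [j _ <-]; exact: ub.
Qed.

Lemma geometric_small (b e : R) : 0 < e -> exists k : nat, b * 2^-1 ^+ k < e.
Proof.
move=> e0; have [b0|b0] := leP b 0.
  exists 0%N; rewrite expr0 mulr1; exact: le_lt_trans e0.
have be : 0 <= b / e by rewrite ltW // divr_gt0.
pose k := Num.bound (b / e); exists k.
rewrite exprVn ltr_pdivrMr ?exprn_gt0 // mulrC -ltr_pdivrMr //.
apply: lt_le_trans (_ : k%:R <= _).
  by have := archi_boundP be.
by rewrite -natrX ler_nat ltnW // ltn_expl.
Qed.

Variable I : interval R.
Hypothesis nd : nondegenerate_interval I.
Variables (t0 : R) (t0I : t0 \in I).

Lemma mx_primitive n p (A : R -> 'M[R]_(n, p)) (A0 : 'M[R]_(n, p)) : mxCn I 0 A ->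
  exists G, G t0 = A0 /\ forall t, t \in I -> has_mxderiv I G t (A t).
Proof.
move=> HA.
have H i : exists g : 'I_p -> R -> R, forall j, g j t0 = 0 /\
     forall t, t \in I -> has_deriv I (g j) t (A t i j).
  have [|g Hg] := @choice _ _ (fun (j : 'I_p) g => g t0 = 0 /\
     forall t, t \in I -> has_deriv I g t (A t i j)); last by exists g.
  by move=> j; apply: primitive_exists => //; apply/Cn0P; exact: HA.
have [g Hg] := choice H.
exists (fun t => A0 + \matrix_(i, j) g i j t); split.
  by apply/matrixP => i j; rewrite !mxE (Hg i j).1 addr0.
move=> t tI i j; rewrite (_ : (fun s => _) = (fun s => A0 i j + g i j s)); last first.
  by apply/funext => s; rewrite !mxE.
rewrite -[X in has_deriv _ _ _ X]add0r; apply: has_derivD; first exact: has_deriv_cst.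
by apply: (Hg i j).2.
Qed.

Section Picard.
Variables (n : nat) (A : R -> 'M[R]_n).
Hypothesis HA : mxCn I 0 A.

Let alpha t := \sum_i \sum_j `|A t i j|.

Let alpha_cts t : t \in I -> cts_at I alpha t.
Proof.
move: t; apply/Cn0P; apply: Cn_sum => // i _; apply: Cn_sum => // j _.
apply/Cn0P => t tI; apply: cvg_norm.
by have /Cn0P := HA i j; apply.
Qed.

Let alpha_ge0 t : 0 <= alpha t.
Proof. by apply: sumr_ge0 => i _; apply: sumr_ge0. Qed.

Let mulmx_bound p t (M : 'M[R]_(n, p)) b : 0 <= b -> (forall i j, `|M i j| <= b) ->
  forall i j, `|(A t *m M) i j| <= alpha t * b.
Proof.
move=> b0 H i j; rewrite mxE (le_trans (ler_norm_sum _ _ _)) //.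
apply: (@le_trans _ _ ((\sum_k `|A t i k|) * b)).
  by rewrite mulr_suml; apply: ler_sum => k _; rewrite normrM; apply: ler_wpM2l.
apply: ler_wpM2r => //; rewrite /alpha [X in _ <= X](bigD1 i) //= lerDl.
by apply: sumr_ge0 => k _; apply: sumr_ge0.
Qed.

Let exp_deriv h c t : t \in I -> (forall t, t \in I -> has_deriv I h t (alpha t)) ->
  has_deriv I (fun s => expR (c * h s)) t (expR (c * h t) * (c * alpha t)).
Proof.
move=> tI Hh; apply: (@has_deriv_comp I expR (fun s => c * h s)).
by apply: has_derivZ; exact: Hh.
Qed.

(* Integrating [alpha * w] gains a factor 1/2: this is what makes the Picard
   iteration converge on the whole interval at once. *)
Let weight : exists w : R -> R, [/\ forall t, t \in I -> 1 <= w t,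
  forall t, t \in I -> cts_at I w t &
  forall D D' b, 0 <= b -> D t0 = 0 -> (forall t, t \in I -> has_deriv I D t (D' t)) ->
     (forall t, t \in I -> `|D' t| <= alpha t * (b * w t)) ->
     forall t, t \in I -> `|D t| <= b / 2 * w t].
Proof.
have [h [h0 Hh]] := primitive_exists nd t0I alpha_cts.
have hge t : t \in I -> t0 <= t -> 0 <= h t.
  move=> tI t0t; have := @deriv_le R I (fun=> 0) h (fun=> 0) alpha t0 t t0t t0I tI.
  rewrite subrr h0 subr0; apply => s /(mem_interval t0I tI) sI.
  by split=> //; [exact: has_deriv_cst|exact: Hh].
have hle t : t \in I -> t <= t0 -> h t <= 0.
  move=> tI t0t; have := @deriv_le R I (fun=> 0) h (fun=> 0) alpha t t0 t0t tI t0I.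
  rewrite subrr h0 sub0r oppr_ge0; apply => s /(mem_interval tI t0I) sI.
  by split=> //; [exact: has_deriv_cst|exact: Hh].
(* Since h vanishes at [t0] and is nondecreasing, |h| grows at rate alpha away from [t0] on both
   sides. Thus 2 alpha w is the rate of growth of w, which is where the factor 1/2 comes from. *)
pose w t := expR (2 * `|h t|).
have w1 t : 1 <= w t by rewrite -expR0 ler_expR mulr_ge0.
exists w; split => //.
  move=> t tI; apply: (@continuous_cvg _ _ _ _ _ _ expR); first exact: continuous_expR.
  by apply: cvgM; [exact: cvg_cst|apply: cvg_norm; exact: has_deriv_cts (Hh _ tI)].
move=> D D' b b0 D0 HD HD' t tI.
have b20 : 0 <= b / 2 by rewrite divr_ge0.
suff : `|D t| <= b / 2 * w t - b / 2 by lra.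
case/orP: (le_total t0 t) => t0t.
  have E : `|D t - D t0| <= b / 2 * expR (2 * h t) - b / 2 * expR (2 * h t0).
    apply: (@deriv_norm_le R I D (fun s => b / 2 * expR (2 * h s)) D'
      (fun s => b / 2 * (expR (2 * h s) * (2 * alpha s))) t0 t t0t t0I tI).
    move=> s st; have sI := mem_interval t0I tI st; case/andP: st => t0s _; split.
    - exact: HD.
    - by apply: has_derivZ; exact: exp_deriv.
    - apply: le_trans (HD' _ sI) _; rewrite /w ger0_norm ?hge //.
      by rewrite le_eqVlt; apply/orP; left; apply/eqP; field.
  by move: E; rewrite D0 subr0 h0 mulr0 expR0 mulr1 /w [`|h t|]ger0_norm ?hge.
have E : `|D t0 - D t| <= - (b / 2) * expR (- 2 * h t0) - - (b / 2) * expR (- 2 * h t).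
  apply: (@deriv_norm_le R I D (fun s => - (b / 2) * expR (- 2 * h s)) D'
    (fun s => - (b / 2) * (expR (- 2 * h s) * (- 2 * alpha s))) t t0 t0t tI t0I).
  move=> s st; have sI := mem_interval tI t0I st; case/andP: st => _ t0s; split.
  - exact: HD.
  - by apply: has_derivZ; exact: exp_deriv.
  - apply: le_trans (HD' _ sI) _; rewrite /w ler0_norm ?hle // mulrN -mulNr.
    by rewrite le_eqVlt; apply/orP; left; apply/eqP; field.
move: E; rewrite D0 sub0r h0 mulr0 expR0 normrN /w [`|h t|]ler0_norm ?hle // mulrN -mulNr.
by lra.
Qed.

(** Successive Picard iterates differ by at most w / 2^(k+1), so they converge on all of [I]. Since
    w is locally bounded, the limit is continuous, and the Picard map sends it to itself. *)
Lemma linear_ode : exists U : R -> 'M[R]_n,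
  U t0 = 1%:M /\ forall t, t \in I -> has_mxderiv I U t (A t *m U t).
Proof.
have [w [w1 wc wD]] := weight.
have cts_of G G' : (forall t, t \in I -> has_mxderiv I G t (G' t)) -> mxCn I 0 (G : R -> 'M[R]_n).
  by move=> H i j; apply/Cn0P => t tI; apply: has_deriv_cts (H t tI i j).
(* The choice of a Picard map needs a total function; for a discontinuous argument the value [U] is
   a mere default. *)
have P (U : R -> 'M[R]_n) : exists G, mxCn I 0 U -> G t0 = 1%:M /\
    forall t, t \in I -> has_mxderiv I G t (A t *m U t).
  have [CU|] := pselect (mxCn I 0 U); last by exists U.
  have [|G HG] := @mx_primitive _ _ (fun t => A t *m U t) 1%:M; first exact: mxCnM.
  by exists G.
have [Phi HPhi] := choice P.
pose U := fix U k := if k is k'.+1 then Phi (U k') else (fun=> 1%:M : 'M[R]_n).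
have CU k : mxCn I 0 (U k).
  elim: k => [|k IHk]; first exact: mxCn_cst.
  by have [_ H] := HPhi _ IHk; exact: cts_of H.
have U0 k : U k t0 = 1%:M by case: k => // k; have [] := HPhi _ (CU k).
have UD k t : t \in I -> has_mxderiv I (U k.+1) t (A t *m U k t).
  by have [_] := HPhi _ (CU k); apply.
(* Contraction in the weighted norm: right-hand sides that are alpha b w apart have primitives at
   most b w / 2 apart. *)
have cmp V W W' b : 0 <= b -> V t0 = 1%:M -> W t0 = 1%:M ->
    (forall t, t \in I -> has_mxderiv I V t (W' t)) ->
    forall k, (forall t, t \in I -> has_mxderiv I W t (A t *m U k t)) ->
    (forall t, t \in I -> forall i j, `|(W' t - A t *m U k t) i j| <= alpha t * (b * w t)) ->
    forall t, t \in I -> forall i j, `|V t i j - W t i j| <= b / 2 * w t.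
  move=> b0 V0 W0 HV k HW HB t tI i j.
  apply: (wD (fun t => V t i j - W t i j) (fun t => (W' t - A t *m U k t) i j)) => //.
  - by rewrite V0 W0 subrr.
  - by move=> s sI; rewrite !mxE; have := HW s sI i j; rewrite !mxE; apply: has_derivB; exact: HV.
  - by move=> s sI; exact: HB.
have step k t : t \in I -> forall i j, `|U k.+1 t i j - U k t i j| <= w t * 2^-1 ^+ k.+1.
  elim: k t => [|k IHk] t tI i j.
    rewrite expr1 -[_ * _]mulrC -[2^-1]mul1r.
    apply: (wD (fun t => U 1%N t i j - U 0%N t i j) (fun t => (A t *m U 0%N t) i j)) => //.
    - by rewrite !U0 subrr.
    - move=> s sI; rewrite -[X in has_deriv _ _ _ X]subr0; apply: has_derivB; first exact: UD.
      exact: has_deriv_cst.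
    move=> s sI; apply: mulmx_bound => [|a c]; first by rewrite mul1r; exact: le_trans (w1 _ sI).
    rewrite mul1r mxE; case: eqP => _; rewrite ?normr1 ?normr0 ?w1 //.
    exact: le_trans (w1 _ sI).
  rewrite mulrC exprS [2^-1 * _]mulrC.
  have p0 : 0 <= 2^-1 ^+ k.+1 :> R by rewrite exprn_ge0 // invr_ge0.
  apply: (cmp (U k.+2) (U k.+1) (fun t => A t *m U k.+1 t) _ p0 _ _ _ k) => //.
  - by move=> s sI; apply: UD.
  - by move=> s sI; apply: UD.
  - move=> s sI a c; rewrite -mulmxBr; apply: mulmx_bound => [|x y].
      by rewrite mulr_ge0 //; exact: le_trans (w1 _ sI).
    by rewrite !mxE mulrC; exact: IHk.
have Lex t : exists L : 'M[R]_n, t \in I -> forall k i j, `|L i j - U k t i j| <= w t * 2^-1 ^+ k.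
  have [tI|] := boolP (t \in I); last by exists 0.
  have H i : exists g : 'I_n -> R, forall j k, `|g j - U k t i j| <= w t * 2^-1 ^+ k.
    have [|g Hg] := @choice _ _ (fun (j : 'I_n) g =>
       forall k, `|g - U k t i j| <= w t * 2^-1 ^+ k); last by exists g.
    by move=> j; apply: geometric_limit => k; exact: step.
  have [g Hg] := choice H.
  by exists (\matrix_(i, j) g i j) => _ k i j; rewrite mxE.
have [L HL] := choice Lex.
have CL : mxCn I 0 L.
  move=> i j; apply/Cn0P => t tI; apply/cts_atP => e e0.
  have e40 : 0 < e / 4 by rewrite divr_gt0.
  (* The summand 1 absorbs the variation of [w] near [t], so that one k serves all nearby points. *)
  have [k Hk] := @geometric_small (w t + 1) _ e40.
  have /Cn0P/(_ t tI)/cts_atP/(_ _ e40)[d1 d10 H1] := CU k i j.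
  have /cts_atP/(_ _ ltr01)[d2 d20 H2] := wc t tI.
  exists (Num.min d1 d2) => [|s sI]; first by rewrite lt_min d10.
  rewrite lt_min => /andP[/(H1 _ sI) {}H1 /(H2 _ sI) {}H2].
  have := HL t tI k i j; have := HL s sI k i j => a1 a2.
  have p0 : 0 < 2^-1 ^+ k :> R by rewrite exprn_gt0 // invr_gt0.
  have b1 : `|L s i j - U k s i j| < e / 4.
    apply: le_lt_trans a1 (le_lt_trans _ Hk); rewrite ler_pM2r //.
    by have := ler_norm (w s - w t); lra.
  have b2 : `|L t i j - U k t i j| < e / 4.
    by apply: le_lt_trans a2 (le_lt_trans _ Hk); rewrite ler_pM2r //; lra.
  move: b1 b2 H1; rewrite !ltr_norml => /andP[? ?] /andP[? ?] /andP[? ?].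
  by apply/andP; split; lra.
have [V0 HV] := HPhi _ CL.
exists (Phi L); split => // t tI.
suff -> : Phi L t = L t by exact: HV.
apply/matrixP => i j; apply/eqP; rewrite -subr_eq0 -normr_le0; apply/ler_addgt0Pl => e e0.
rewrite addr0.
have [k Hk] := @geometric_small (w t) _ e0.
apply: le_trans (ltW Hk).
have p0 : 0 <= 2^-1 ^+ k :> R by rewrite exprn_ge0 // invr_ge0.
have h1 : `|Phi L t i j - U k.+1 t i j| <= 2^-1 ^+ k / 2 * w t.
  apply: (cmp (Phi L) (U k.+1) (fun t => A t *m L t) _ p0 _ _ _ k) => //.
    by move=> s sI; apply: UD.
  move=> s sI a c; rewrite -mulmxBr; apply: mulmx_bound => [|x y].
    by rewrite mulr_ge0 //; exact: le_trans (w1 _ sI).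
  by rewrite !mxE mulrC; exact: HL.
have := HL t tI k.+1 i j; move: h1; rewrite exprS !ler_norml => /andP[? ?] /andP[? ?].
by apply/andP; split; lra.
Qed.

End Picard.

(** Invertibility comes from the adjoint equation W' = - A^T W: the product W^T U has derivative 0,
    so it stays the identity. Smoothness is bootstrapped from U' = A U. *)
Lemma linear_ode_unit n (A : R -> 'M[R]_n) k : mxCn I k A ->
  exists U : R -> 'M[R]_n, [/\ U t0 = 1%:M, mxCn I k.+1 U,
    (forall t, t \in I -> U t \in unitmx) &
    forall t, t \in I -> mxderive I U t = A t *m U t].
Proof.
move=> CA; have CA0 := mxCn_le nd (leq0n k) CA.
have [U [U0 HU]] := linear_ode CA0.
have [|W [W0 HW]] := @linear_ode n (fun t => - (A t)^T); first exact/mxCnN/mxCnT.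
exists U; split=> //.
- elim: k CA => [|k IHk] CA; apply: (mxCnSP nd HU).
    apply: mxCnM => // i j; apply/Cn0P => t tI; exact: has_deriv_cts (HU t tI i j).
  by apply: mxCnM => //; apply: IHk; apply: mxCn_le CA.
- move=> t tI.
  suff WU : (W t)^T *m U t = 1%:M by have [] := mulmx1_unit WU.
  apply/matrixP => i j.
  have -> : (1%:M : 'M[R]_n) i j = ((W t0)^T *m U t0) i j by rewrite W0 U0 trmx1 mulmx1.
  apply: (@deriv0_const R I (fun t => ((W t)^T *m U t) i j)) => // s sI.
  have := has_mxderivM (has_mxderivT (HW s sI)) (HU s sI) => /(_ i j).
  suff -> : (- (A s)^T *m W s)^T *m U s + (W s)^T *m (A s *m U s) = 0 by rewrite mxE.
  by rewrite trmx_mul linearN /= trmxK mulmxN mulNmx mulmxA addNr.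
- by move=> t tI; apply: has_mxderivE => //; exact: HU.
Qed.

End LinearODE.

(** * Smooth frames of moving subspaces *)

Section ColumnSpaces.
Context {R : realType}.

Lemma imcolP n p q (A : 'M[R]_(n, p)) (B : 'M[R]_(n, q)) :
  reflect (exists X, A = B *m X) (imcol A <= imcol B)%VS.
Proof.
apply: (iffP subvP) => [H|[X ->] y /mem_imcol[z ->]]; last first.
  by apply/mem_imcol; exists (X *m z); rewrite mulmxA.
have Hj j : exists x, col j A = B *m x.
  by apply/mem_imcol/H/mem_imcol; exists (delta_mx j 0); rewrite colE.
have [f Hf] := choice Hj.
exists (\matrix_(i, j) f j i 0); apply/matrixP => i j.
have /matrixP/(_ i 0) := Hf j; rewrite !mxE => ->.
by apply: eq_bigr => k _; rewrite !mxE.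
Qed.

Lemma eq_mulmx_col n p (A B : 'M[R]_(n, p)) : (forall x : 'cV_p, A *m x = B *m x) -> A = B.
Proof.
move=> H; apply/matrixP => i j; have /matrixP/(_ i 0) := H (delta_mx j 0).
by rewrite -!colE !mxE.
Qed.

Lemma imcol_trmx n p (A : 'M[R]_(n, p)) (z : 'cV_n) : (z \in imcol A) = (z^T <= A^T)%MS.
Proof.
apply/mem_imcol/submxP => [[x ->]|[D /(congr1 trmx)]].
  by exists x^T; rewrite trmx_mul.
by rewrite trmxK trmx_mul trmxK => ->; exists D^T.
Qed.

Lemma dim_kercol n p (A : 'M[R]_(n, p)) : \dim (kercol A) = (p - \rank A)%N.
Proof.
have -> : kercol A = imcol (row_base (kermx A^T))^T.
  apply/vspaceP => z; rewrite mem_kercol imcol_trmx trmxK eq_row_base.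
  rewrite -[A *m z]trmxK trmx_mul; apply/eqP/sub_kermxP => [/(congr1 trmx)|->].
    by rewrite !trmxK trmx0.
  by rewrite trmx0.
set B := row_base _.
have freeB : row_free B by exact: row_base_free.
rewrite /imcol limg_dim_eq.
  by rewrite dimvf /dim /= muln1 mxrank_ker mxrank_tr.
apply/eqP; rewrite -subv0; apply/subvP => x; rewrite memv_cap memv0 => /andP[_].
rewrite memv_ker lfunE /= => /eqP /(congr1 trmx); rewrite trmx_mul trmxK trmx0 => H.
have /row_freeP[D BD] := freeB.
apply/eqP/trmx_inj; rewrite trmx0.
by rewrite -[x^T]mulmx1 -BD mulmxA H mul0mx.
Qed.

Lemma dim_imcol n p (A : 'M[R]_(n, p)) : \dim (imcol A) = \rank A.
Proof.
have := limg_ker_dim (linfun (mulmx A : 'cV_p -> 'cV_n)) fullv.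
rewrite capfv dimvf /dim /= muln1 -[lker _]/(kercol A) -[limg _]/(imcol A) dim_kercol => E.
have rp := rank_leq_col A; apply/eqP.
by rewrite -(eqn_add2l (p - \rank A)) E subnK.
Qed.

Lemma full_col_inj n k (A : 'M[R]_(n, k)) :
  \rank A = k <-> (forall x : 'cV_k, A *m x = 0 -> x = 0).
Proof.
split=> [rA x Ax|H].
  have /row_fullP[B BA] : row_full A by rewrite /row_full rA.
  by rewrite -[x]mul1mx -BA -mulmxA Ax mulmx0.
have : \dim (kercol A) = 0%N.
  apply/eqP; rewrite dimv_eq0 -subv0; apply/subvP => x.
  by rewrite mem_kercol memv0 => /eqP/H ->.
have rp := rank_leq_col A; rewrite dim_kercol => /eqP; rewrite subn_eq0 => pr.
by apply/eqP; rewrite eqn_leq rp.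
Qed.

Lemma col_inj n k (A : 'M[R]_(n, k)) : \rank A = k -> forall x : 'cV_k, A *m x = 0 -> x = 0.
Proof. by move/full_col_inj. Qed.

Lemma is_basisP n k (C : 'M[R]_(n, k)) U : is_basis C U <-> imcol C = U /\ \rank C = k.
Proof.
have spanE : <<[tuple col j C | j < k]>>%VS = imcol C.
  apply/eqP; rewrite eqEsubv; apply/andP; split.
    apply/span_subvP => _ /mapP[j _ ->].
    by apply/mem_imcol; exists (delta_mx j 0); rewrite colE.
  apply/subvP => _ /mem_imcol[z ->].
  have -> : C *m z = \sum_j z j 0 *: col j C.
    apply/matrixP => i l; rewrite !mxE summxE; apply: eq_bigr => j _.
    by rewrite !mxE mulrC (ord1 l).
  apply: memv_suml => j _; apply: memvZ; apply: memv_span.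
  by apply/mapP; exists j => //; rewrite mem_enum.
rewrite /is_basis /basis_of spanE /free spanE size_tuple dim_imcol; split.
  by move=> /andP[/eqP-> /eqP->].
by move=> [-> ->]; rewrite !eqxx.
Qed.

Lemma mem_imcol_mul n p (A : 'M[R]_(n, p)) x : A *m x \in imcol A.
Proof. by apply/mem_imcol; exists x. Qed.

Lemma kercol_mul0 n p q (A : 'M[R]_(n, p)) (T : 'M[R]_(p, q)) :
  (imcol T <= kercol A)%VS -> A *m T = 0.
Proof.
move=> /subvP H; apply: eq_mulmx_col => x; rewrite mul0mx -mulmxA.
by apply/eqP; rewrite -mem_kercol; apply: H; exact: mem_imcol_mul.
Qed.

Lemma kercol_orth n p (A : 'M[R]_(n, p)) : kercol A = orthcomp (imcol A^T).
Proof.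
apply/vspaceP => z; rewrite mem_kercol; apply/eqP/idP => [Az|/mem_orthcomp H].
  apply/mem_orthcomp => _ /mem_imcol[x ->].
  by rewrite trmx_mul trmxK -mulmxA Az mulmx0.
by apply: trmx_inj; apply: eq_mulmx_col => x; rewrite trmx_mul -mulmxA trmx0 mul0mx -[LHS]trmxK trmx_mul trmxK H ?trmx0 // mem_imcol_mul.
Qed.

Lemma orth_kercol n p (A : 'M[R]_(n, p)) : orthcomp (imcol A) = kercol A^T.
Proof. by rewrite kercol_orth trmxK. Qed.

Lemma gram_ge0 n (v : 'cV[R]_n) : 0 <= (v^T *m v) 0 0.
Proof. by rewrite mxE; apply: sumr_ge0 => i _; rewrite mxE -expr2 sqr_ge0. Qed.

Lemma gram_eq0 n (v : 'cV[R]_n) : v^T *m v = 0 -> v = 0.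
Proof.
move=> /matrixP/(_ 0 0); rewrite !mxE => /eqP; rewrite psumr_eq0 => [/allP H|i _]; last first.
  by rewrite mxE -expr2 sqr_ge0.
apply/matrixP => i j; rewrite (ord1 j) [RHS]mxE; apply/eqP.
by have := H i (mem_index_enum i); rewrite mxE mulf_eq0 orbb.
Qed.

(** Over the reals v^T A^T A v is the squared length of A v. *)
Lemma gram_ker n p q (A : 'M[R]_(n, p)) (X : 'M[R]_(p, q)) : A^T *m A *m X = 0 -> A *m X = 0.
Proof.
move=> H; suff Hv (v : 'cV_p) : A^T *m A *m v = 0 -> A *m v = 0.
  apply: eq_mulmx_col => x; rewrite mul0mx -mulmxA; apply: Hv.
  by rewrite mulmxA H mul0mx.
by move=> {}H; apply: gram_eq0; rewrite trmx_mul -mulmxA [A^T *m _]mulmxA H mulmx0.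
Qed.

Lemma square_unit k (A : 'M[R]_k) : (forall x : 'cV_k, A *m x = 0 -> x = 0) -> A \in unitmx.
Proof. by move=> /full_col_inj; rewrite -row_full_unit /row_full => ->. Qed.

Lemma gram_unit n k (A : 'M[R]_(n, k)) : \rank A = k -> A^T *m A \in unitmx.
Proof. by move=> /full_col_inj H; apply: square_unit => x /gram_ker/H. Qed.

(** The pseudoinverse for full column rank, which inherits the smoothness of [A]. It is locked so
    that associativity rewrites treat it as an atom. *)
Definition linv n k (A : 'M[R]_(n, k)) : 'M[R]_(k, n) :=
  locked (invmx (A^T *m A) *m A^T).

Lemma linvE n k (A : 'M[R]_(n, k)) : linv A = invmx (A^T *m A) *m A^T.
Proof. by rewrite /linv -lock. Qed.

Lemma linvK n k (A : 'M[R]_(n, k)) : \rank A = k -> linv A *m A = 1%:M.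
Proof. by move=> rA; rewrite linvE -mulmxA mulVmx // gram_unit. Qed.

Lemma invmx_eq k (A B : 'M[R]_k) : A *m B = 1%:M -> invmx A = B.
Proof.
by move=> AB; have [uA _] := mulmx1_unit AB; rewrite -[LHS]mulmx1 -AB mulmxA mulVmx // mul1mx.
Qed.

(** The orthoprojector P onto im M when M has rank rho. For a selection J of rho columns with Gram
    matrix G_J, the summand equals det(G_J)^2 P, and it is 0 when the columns are dependent. The
    quotient is therefore a weighted mean of copies of P, rational in the entries of M and free of
    any choice of a minor. *)
Definition orthoproj (rho n p : nat) (M : 'M[R]_(n, p)) : 'M[R]_n :=
  let G (J : {ffun 'I_rho -> 'I_p}) := (colsub J M)^T *m colsub J M in
  (\sum_J \det (G J) ^+ 2)^-1 *:
    \sum_J \det (G J) *: (colsub J M *m \adj (G J) *m (colsub J M)^T).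

Let max_colsub (rho n p : nat) (M : 'M[R]_(n, p)) : \rank M = rho ->
  exists J : {ffun 'I_rho -> 'I_p}, \rank (colsub J M) = rho /\ exists Y, M = colsub J M *m Y.
Proof.
rewrite -mxrank_tr => <-.
pose J := [ffun i => maxrankfun M^T i]; exists J.
have E : colsub J M = (rowsub (maxrankfun M^T) M^T)^T.
  by apply/matrixP => i j; rewrite !mxE /J ffunE.
rewrite E; split.
  by apply: etrans (mxrank_tr _) _; apply/eqmx_rank/eqmxP; exact: eq_maxrowsub.
have /submxP[D HD] : (M^T <= rowsub (maxrankfun M^T) M^T)%MS by rewrite eq_maxrowsub.
by exists D^T; rewrite -trmx_mul -HD trmxK.
Qed.

Lemma orthoprojE (rho n p : nat) (M : 'M[R]_(n, p)) : \rank M = rho ->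
  [/\ \sum_(J : {ffun 'I_rho -> 'I_p}) \det ((colsub J M)^T *m colsub J M) ^+ 2 != 0,
      (orthoproj rho M)^T = orthoproj rho M,
      orthoproj rho M *m orthoproj rho M = orthoproj rho M
    & imcol (orthoproj rho M) = imcol M].
Proof.
move=> rM; have [J0 [r0 [Y MY]]] := max_colsub rM.
set M0 := colsub J0 M in r0 MY.
pose G0 := M0^T *m M0.
have uG0 : G0 \in unitmx by exact: gram_unit.
have EG0 : G0 = M0^T *m M0 by [].
clearbody G0.
pose P0 := M0 *m invmx G0 *m M0^T.
pose G (J : {ffun 'I_rho -> 'I_p}) := (colsub J M)^T *m colsub J M.
(* If det(G_J) = 0, then M_J adj(G_J) vanishes by [gram_ker]. Otherwise M_J = M_0 X with X
   nonsingular, and X cancels from the projector formula. *)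
have key (J : {ffun 'I_rho -> 'I_p}) : colsub J M *m \adj (G J) *m (colsub J M)^T = \det (G J) *: P0.
  have [d0|d0] := eqVneq (\det (G J)) 0.
    rewrite d0 scale0r (_ : colsub J M *m \adj (G J) = 0) ?mul0mx //.
    apply: gram_ker; by rewrite -/(G J) mul_mx_adj d0 -scalemx1 scale0r.
  pose X := colsub J Y.
  have MX : colsub J M = M0 *m X.
    apply/matrixP => i j; rewrite /X {1}MY !mxE; apply: eq_bigr => k _; by rewrite !mxE.
  have GX : G J = X^T *m G0 *m X by rewrite /G MX trmx_mul EG0 !mulmxA.
  clearbody X.
  have uG : G J \in unitmx by rewrite unitmxE unitfE.
  have uX : X \in unitmx by move: uG; rewrite GX unitmx_mul => /andP[].
  have -> : \adj (G J) = \det (G J) *: invmx (G J).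
    by rewrite /invmx uG scalerA divff // scale1r.
  rewrite -scalemxAr -scalemxAl; congr (_ *: _).
  rewrite MX trmx_mul /P0.
  have -> : invmx (G J) = invmx X *m invmx G0 *m invmx X^T.
    apply: invmx_eq; rewrite GX -!mulmxA [X *m _]mulmxA mulmxV // mul1mx.
    by rewrite [G0 *m _]mulmxA mulmxV // mul1mx mulmxV // unitmx_tr.
  rewrite !mulmxA -[M0 *m X *m _]mulmxA mulmxV // mulmx1.
  by rewrite -[_ *m invmx X^T *m _]mulmxA mulVmx ?unitmx_tr // mulmx1.
have s0 : \sum_(J : {ffun 'I_rho -> 'I_p}) \det (G J) ^+ 2 != 0.
  rewrite psumr_neq0 => [|J _]; last exact: sqr_ge0.
  apply/hasP; exists J0; rewrite ?mem_index_enum //= lt_def sqr_ge0 andbT.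
  by apply: expf_neq0; rewrite -unitfE -unitmxE /G -EG0.
have EP : orthoproj rho M = P0.
  rewrite /orthoproj -/(G _).
  rewrite (eq_bigr (fun J => \det (G J) ^+ 2 *: P0)); last first.
    by move=> J _; rewrite key scalerA expr2.
  by rewrite -scaler_suml scalerA mulVf // scale1r.
have PM0 : P0 *m M0 = M0 by rewrite /P0 -!mulmxA -EG0 mulVmx // mulmx1.
split => //; rewrite EP.
- by rewrite /P0 !trmx_mul trmxK mulmxA trmx_inv EG0 trmx_mul trmxK.
- by rewrite {2}/P0 !mulmxA PM0.
- apply/eqP; rewrite eqEsubv; apply/andP; split; apply/imcolP.
    exists (colsub J0 1%:M *m invmx G0 *m M0^T); rewrite /P0 !mulmxA.
    congr (_ *m _ *m _); apply/matrixP => i j; rewrite !mxE (bigD1 (J0 j)) //= big1.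
      by rewrite !mxE eqxx mulr1 addr0.
    by move=> k kj; rewrite !mxE (negPf kj) mulr0.
  by exists M; rewrite {2}MY mulmxA PM0.
Qed.

End ColumnSpaces.

(** * Orthonormal frames of the same smoothness as the subspace *)

Section Frames.
Context {R : realType}.

(** Induction on the rank: a nonzero column of P, normalised to u, is fixed by P, and P - u u^T is
    again an orthoprojector, of smaller rank. *)
Lemma orthonormal_basis_exists n (P : 'M[R]_n) : P^T = P -> P *m P = P ->
  exists k (B : 'M[R]_(n, k)), B^T *m B = 1%:M /\ B *m B^T = P.
Proof.
have [r] := ubnP (\rank P); elim: r P => // r IHr P rP PT PP.
have [->|P0] := eqVneq P 0.
  exists 0%N, 0; split; last by rewrite mul0mx.
  by apply/matrixP => -[].
have [j vj] : exists j, col j P != 0.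
  apply/existsP; apply: contraNT P0; rewrite negb_exists => /forallP H.
  apply/eqP/matrixP => i j; have := H j; rewrite negbK => /eqP/matrixP/(_ i 0).
  by rewrite !mxE.
set v := col j P in vj.
have Pv : P *m v = v by rewrite /v colE mulmxA PP.
pose c := (v^T *m v) 0 0.
have c0 : 0 < c.
  rewrite lt_def gram_ge0 andbT; apply: contraNneq vj => c0.
  apply/eqP/gram_eq0/matrixP => a b; by rewrite !ord1 -/c c0 mxE.
pose u := (Num.sqrt c)^-1 *: v.
have Pu : P *m u = u by rewrite /u -scalemxAr Pv.
have uu : u^T *m u = 1%:M.
  have -> : u^T = (Num.sqrt c)^-1 *: v^T by rewrite /u linearZ.
  apply/matrixP => a b; rewrite !ord1 -scalemxAl /u -scalemxAr scalerA.
  rewrite mxE -/c [RHS]mxE -invfM -expr2 sqr_sqrtr ?ltW // mulVf //; exact: lt0r_neq0.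
have u0 : u != 0.
  by apply/eqP => E; move: uu; rewrite E mulmx0 => /matrixP/(_ 0 0)/eqP;
    rewrite !mxE eq_sym oner_eq0.
clearbody u.
have uP : u^T *m P = u^T by rewrite -{1}PT -trmx_mul Pu.
pose P1 := P - u *m u^T.
have P1u : P1 *m u = 0 by rewrite /P1 mulmxBl Pu -mulmxA uu mulmx1 subrr.
have P1T : P1^T = P1 by rewrite /P1 linearB /= PT trmx_mul trmxK.
have PP1 : P *m P1 = P1 by rewrite /P1 mulmxBr PP mulmxA Pu.
have P1P : P1 *m P = P1 by rewrite /P1 mulmxBl PP -mulmxA uP.
have P1P1 : P1 *m P1 = P1 by rewrite {2}/P1 mulmxBr P1P mulmxA P1u mul0mx subr0.
have rP1 : (\rank P1 < \rank P)%N.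
  have /mxrank_leqif_sup[rle req] : (P1 <= P)%MS by apply/submxP; exists P1.
  rewrite ltn_neqAle rle andbT req; apply/negP => /submxP[D PD].
  have : P1 *m u = u.
    have PD' : P = P1 *m D^T by rewrite -{1}PT {1}PD trmx_mul P1T.
    by rewrite -[in LHS]Pu {1}PD' !mulmxA P1P1 -PD' Pu.
  by rewrite P1u => /esym/eqP; rewrite (negPf u0).
have [|k [B [BB BP]]] := IHr P1 _ P1T P1P1; first exact: leq_trans rP1 _.
have Bu : B^T *m u = 0.
  apply: gram_eq0; rewrite trmx_mul trmxK -mulmxA [B *m _]mulmxA BP P1u mulmx0 //.
exists (1 + k)%N, (row_mx u B); split.
  rewrite tr_row_mx mul_col_row uu BB Bu -[u^T *m B]trmxK trmx_mul trmxK Bu trmx0.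
  by rewrite -scalar_mx_block.
by rewrite tr_row_mx mul_row_col BP /P1 addrC subrK.
Qed.

Lemma orthonormal_rank n k (B : 'M[R]_(n, k)) : B^T *m B = 1%:M -> \rank B = k.
Proof.
by move=> BB; apply/full_col_inj => x Bx; rewrite -[x]mul1mx -BB -mulmxA Bx mulmx0.
Qed.

Lemma imcol_orthonormal n k (B : 'M[R]_(n, k)) : B^T *m B = 1%:M -> imcol (B *m B^T) = imcol B.
Proof.
move=> BB; apply/eqP; rewrite eqEsubv; apply/andP; split; apply/imcolP.
  by exists B^T.
by exists B; rewrite -mulmxA BB mulmx1.
Qed.

Variable I : interval R.
Hypothesis nd : nondegenerate_interval I.

(* Kato's transport: the flow of [P'P - PP'] conjugates the projectors [P t]. *)
Lemma projector_frame k n rho (P : R -> 'M[R]_n) : mxCn I k.+1 P ->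
  (forall t, t \in I -> [/\ (P t)^T = P t, P t *m P t = P t & \rank (P t) = rho]) ->
  exists B : R -> 'M[R]_(n, rho), mxCn I k.+1 B /\
    forall t, t \in I -> (B t)^T *m B t = 1%:M /\ B t *m (B t)^T = P t.
Proof.
move=> CP HP; have [t0 [_ [t0I _ _]]] := nd.
have C1 : mxCn I 1 P by exact: mxCn_le CP.
set P' := mxderive I P.
have CP' : mxCn I k P' by exact: mxCn_mxderive.
pose A t := P' t *m P t - P t *m P' t.
have CA : mxCn I k A.
  have CPk : mxCn I k P by exact: mxCn_le CP.
  by apply: mxCnB => //; apply: mxCnM.
(* The generator is only C^k, but its flow regains the lost derivative, so the frame is as smooth as
   P. *)
have [U [U0 CU uU dU]] := linear_ode_unit nd t0I CA.
have C1U : mxCn I 1 U by exact: mxCn_le CU.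
have HU t : t \in I -> has_mxderiv I U t (A t *m U t).
  by move=> tI; rewrite -dU //; exact: mxderiveP.
have HPd t : t \in I -> has_mxderiv I P t (P' t) by move=> tI; exact: mxderiveP.
have P'T t : t \in I -> (P' t)^T = P' t.
  move=> tI; rewrite /P' -mxderiveT //; apply: mxderive_ext => //; last exact: mxCnT.
  by move=> s sI; have [] := HP s sI.
have PP' t : t \in I -> P' t = P' t *m P t + P t *m P' t.
  move=> tI; rewrite /P' -mxderiveM //; apply: mxderive_ext => //.
  by move=> s sI; have [] := HP s sI.
(* Multiply P' = P'P + PP' by P on both sides. This identity makes the derivative of U^T P U
   vanish. *)
have PP'P t : t \in I -> P t *m P' t *m P t = 0.
  move=> tI; have [_ PP _] := HP t tI.
  have := congr1 (fun M => P t *m M *m P t) (PP' t tI).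
  rewrite mulmxDr mulmxDl [P t *m (P' t *m P t)]mulmxA -[_ *m P t *m P t]mulmxA PP.
  rewrite [P t *m (P t *m _)]mulmxA PP => /eqP.
  by rewrite -subr_eq0 opprD addNKr oppr_eq0 => /eqP.
have AT t : t \in I -> (A t)^T = - A t.
  move=> tI; have [PT _ _] := HP t tI.
  by rewrite /A linearB /= !trmx_mul PT P'T // opprB.
have const p q (F : R -> 'M[R]_(p, q)) t : t \in I ->
    (forall s, s \in I -> has_mxderiv I F s 0) -> F t = F t0.
  move=> tI HF; apply/matrixP => i j.
  apply: (@deriv0_const R I (fun s => F s i j)) => // s sI.
  by have := HF s sI i j; rewrite mxE.
have UU t : t \in I -> (U t)^T *m U t = 1%:M.
  move=> tI; rewrite (const _ _ (fun t => (U t)^T *m U t) t tI) ?U0 ?trmx1 ?mulmx1 // => s sI.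
  suff -> : 0 = (A s *m U s)^T *m U s + (U s)^T *m (A s *m U s).
    by apply: has_mxderivM; [apply: has_mxderivT|]; exact: HU.
  by rewrite trmx_mul AT // mulmxN mulNmx !mulmxA addNr.
have UPU t : t \in I -> (U t)^T *m (P t *m U t) = P t0.
  move=> tI; rewrite (const _ _ (fun t => (U t)^T *m (P t *m U t)) t tI).
    by rewrite U0 trmx1 mulmx1 mul1mx.
  move=> s sI; have [PT PP _] := HP s sI.
  suff -> : 0 = (A s *m U s)^T *m (P s *m U s) +
                (U s)^T *m (P' s *m U s + P s *m (A s *m U s)).
    apply: has_mxderivM; first by apply: has_mxderivT; exact: HU.
    by apply: has_mxderivM; [exact: HPd|exact: HU].
  rewrite trmx_mul AT // mulmxN mulNmx.
  rewrite [P s *m (A s *m _)]mulmxA -[P' s *m U s + _]mulmxDl [_ *m (_ *m U s)]mulmxA.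
  rewrite [(U s)^T *m A s *m _]mulmxA -[(U s)^T *m A s *m _]mulmxA -mulNmx -mulmxDl.
  rewrite -mulmxN -mulmxDr (_ : - (A s *m P s) + _ = 0) ?mulmx0 ?mul0mx //.
  rewrite /A mulmxBl mulmxBr -mulmxA PP PP'P // subr0 mulmxA PP'P // mulmxA PP.
  by move: (PP' s sI); move: (_ *m P s) (P s *m _) => X Y ->; rewrite sub0r addrK addNr.
have [PT0 PP0 rP0] := HP t0 t0I.
have [k0 [B0 [BB BP]]] := orthonormal_basis_exists PT0 PP0.
have {}rho_k : k0 = rho.
  rewrite -rP0 -BP -dim_imcol imcol_orthonormal // dim_imcol.
  by rewrite orthonormal_rank.
subst k0.
exists (fun t => U t *m B0); split.
  by apply: mxCnM => //; exact: mxCn_cst.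
move=> t tI; rewrite trmx_mul; split.
  by rewrite mulmxA -[B0^T *m _ *m _]mulmxA UU // mulmx1.
rewrite mulmxA -[U t *m B0 *m _]mulmxA BP -(UPU t tI) !mulmxA.
have UUt : U t *m (U t)^T = 1%:M by exact/mulmx1C/UU.
by rewrite UUt mul1mx -mulmxA UUt mulmx1.
Qed.

Lemma mxCn_linv k n p (A : R -> 'M[R]_(n, p)) : mxCn I k A ->
  (forall t, t \in I -> \rank (A t) = p) -> mxCn I k (fun t => linv (A t)).
Proof.
move=> CA rA; have CAT : mxCn I k (fun t => (A t)^T) by exact: mxCnT.
apply: (@mxCn_ext _ _ nd _ _ _ (fun t => invmx ((A t)^T *m A t) *m (A t)^T)).
  by move=> t _; rewrite linvE.
apply: mxCnM => //; apply: mxCnV => //; last exact: mxCnM.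
by move=> t /rA; exact: gram_unit.
Qed.

Lemma Cn_orthoproj k (rho n p : nat) (M : R -> 'M[R]_(n, p)) : mxCn I k M ->
  (forall t, t \in I -> \rank (M t) = rho) -> mxCn I k (fun t => orthoproj rho (M t)).
Proof.
move=> CM rM; apply: mxCnZ => //.
  apply: CnV => // [t tI|]; first by case: (orthoprojE (rM t tI)).
  apply: Cn_sum => // J _; apply: CnM => //; apply: Cn_det => //; apply: mxCnM => //;
    do ?apply: mxCnT; exact: mxCn_colsub.
apply: mxCn_sum => // J _.
have CJ : mxCn I k (fun t => colsub J (M t)) by exact: mxCn_colsub.
have CG : mxCn I k (fun t => (colsub J (M t))^T *m colsub J (M t)).
  by apply: mxCnM => //; exact: mxCnT.
apply: mxCnZ => //; first exact: Cn_det.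
apply: mxCnM => //; last exact: mxCnT.
by apply: mxCnM => //; exact: mxCn_adj.
Qed.

Lemma im_frame k (rho n p : nat) (M : R -> 'M[R]_(n, p)) : mxCn I k.+1 M ->
  (forall t, t \in I -> \rank (M t) = rho) ->
  exists B : R -> 'M[R]_(n, rho), mxCn I k.+1 B /\
    forall t, t \in I -> (B t)^T *m B t = 1%:M /\ imcol (B t) = imcol (M t).
Proof.
move=> CM rM; have CP := Cn_orthoproj CM rM.
have [|B [CB HB]] := @projector_frame k n rho _ CP.
  move=> t tI; have [_ PT PP PM] := orthoprojE (rM t tI); split=> //.
  by rewrite -dim_imcol PM dim_imcol rM.
exists B; split=> // t tI; have [BB BP] := HB t tI; split=> //.
by have [_ _ _ <-] := orthoprojE (rM t tI); rewrite -BP imcol_orthonormal.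
Qed.

Lemma orth_frame k (rho n p q : nat) (M : R -> 'M[R]_(n, p)) : mxCn I k.+1 M ->
  (forall t, t \in I -> \rank (M t) = rho) -> (q + rho)%N = n ->
  exists B : R -> 'M[R]_(n, q), mxCn I k.+1 B /\
    forall t, t \in I -> (B t)^T *m B t = 1%:M /\ imcol (B t) = orthcomp (imcol (M t)).
Proof.
move=> CM rM qn; have CP := Cn_orthoproj CM rM.
have key t : t \in I -> let P := orthoproj rho (M t) in
   imcol (1%:M - P) = kercol P.
  move=> tI P; have [_ PT PP PM] := orthoprojE (rM t tI).
  apply/vspaceP => z; rewrite mem_kercol; apply/mem_imcol/eqP => [[x ->]|Pz].
    by rewrite mulmxA mulmxBr mulmx1 PP subrr mul0mx.
  by exists z; rewrite mulmxBl mul1mx Pz subr0.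
have [||B [CB HB]] := @projector_frame k n q (fun t => 1%:M - orthoproj rho (M t)).
- by apply: mxCnB => //; exact: mxCn_cst.
- move=> t tI; have [_ PT PP PM] := orthoprojE (rM t tI); split.
  + by rewrite linearB /= trmx1 PT.
  + by rewrite mulmxBl mul1mx mulmxBr mulmx1 PP subrr subr0.
  + rewrite -dim_imcol key // dim_kercol -dim_imcol PM dim_imcol (rM t tI).
    by rewrite -qn addnK.
exists B; split=> // t tI; have [BB BP] := HB t tI; split=> //.
have [_ PT PP PM] := orthoprojE (rM t tI).
by rewrite -PM orth_kercol PT -key // -BP imcol_orthonormal.
Qed.

Lemma ker_frame k (rho n p q : nat) (M : R -> 'M[R]_(n, p)) : mxCn I k.+1 M ->
  (forall t, t \in I -> \rank (M t) = rho) -> (q + rho)%N = p ->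
  exists B : R -> 'M[R]_(p, q), mxCn I k.+1 B /\
    forall t, t \in I -> (B t)^T *m B t = 1%:M /\ imcol (B t) = kercol (M t).
Proof.
move=> CM rM qn.
have [||B [CB HB]] := @orth_frame k rho p n q (fun t => (M t)^T) _ _ qn.
- exact: mxCnT.
- by move=> t tI; rewrite mxrank_tr rM.
by exists B; split=> // t /HB[BB ->]; split=> //; rewrite kercol_orth.
Qed.

End Frames.

(** * Reduction of a pair *)

Section PairLinearAlgebra.
Context {R : realType}.

Lemma mem_preim_im n p q (F : 'M[R]_(n, p)) (E : 'M[R]_(n, q)) z :
  reflect (exists x, F *m z = E *m x) (z \in preimcol F (imcol E)).
Proof. by rewrite mem_preimcol; exact: mem_imcol. Qed.

Lemma mem_imcol_row n p q (A : 'M[R]_(n, p)) (B : 'M[R]_(n, q)) y :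
  reflect (exists a b, y = A *m a + B *m b) (y \in imcol (row_mx A B)).
Proof.
apply: (iffP (mem_imcol _ _)) => [[z ->]|[a [b ->]]].
  by exists (usubmx z), (dsubmx z); rewrite -mul_row_col vsubmxK.
by exists (col_mx a b); rewrite mul_row_col.
Qed.

Lemma eq_fullv n (U : {vspace 'cV[R]_n}) : U = fullv <-> (forall y, y \in U).
Proof.
split=> [-> y|H]; first exact: memvf.
by apply/eqP; rewrite eqEsubv subvf; apply/subvP => y _; exact: H.
Qed.

Lemma vs_imcol n (U : {vspace 'cV[R]_n}) :
  exists B : 'M[R]_(n, \dim U), imcol B = U /\ \rank B = \dim U.
Proof.
pose B := \matrix_(i < n, j < \dim U) ((vbasis U)`_j) i 0.
suff E : imcol B = U by exists B; rewrite -dim_imcol E.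
have Bx x : B *m x = \sum_(j < \dim U) x j 0 *: (vbasis U)`_j.
  apply/matrixP => i l; rewrite !mxE summxE; apply: eq_bigr => j _.
  by rewrite !mxE (ord1 l) mulrC.
apply/vspaceP => y; apply/mem_imcol/idP => [[x ->]|yU].
  rewrite Bx; apply: memv_suml => j _; apply: memvZ; apply: vbasis_mem.
  by rewrite mem_nth // size_tuple.
exists (\col_j coord (vbasis U) j y).
by rewrite Bx {1}(coord_vbasis yU); apply: eq_bigr => j _; rewrite mxE.
Qed.

Lemma dim_inj_image n p (A : 'M[R]_(n, p)) (U : {vspace 'cV[R]_p}) (V : {vspace 'cV[R]_n}) :
  (forall x, x \in U -> A *m x = 0 -> x = 0) ->
  (forall y, y \in V <-> exists2 x, x \in U & y = A *m x) -> \dim V = \dim U.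
Proof.
move=> inj HV; have [B [BU rB]] := vs_imcol U.
have -> : V = imcol (A *m B).
  apply/vspaceP => y; apply/idP/mem_imcol => [/HV[x xU ->]|[z ->]].
    have /mem_imcol[z ->] : x \in imcol B by rewrite BU.
    by exists z; rewrite mulmxA.
  have BzU : B *m z \in U by have := mem_imcol_mul B z; rewrite BU.
  by apply/HV; exists (B *m z); rewrite ?mulmxA.
rewrite dim_imcol; apply/full_col_inj => x; rewrite -mulmxA => ABx.
apply: (col_inj rB); apply: inj ABx.
by have := mem_imcol_mul B x; rewrite BU.
Qed.

Lemma eq_dimv_sub n (U V : {vspace 'cV[R]_n}) : (U <= V)%VS -> (\dim V <= \dim U)%N -> U = V.
Proof. by move=> UV dUV; apply/eqP; rewrite eqEdim UV. Qed.

Lemma orthcompK n p q (E : 'M[R]_(n, p)) (Z : 'M[R]_(n, q)) :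
  imcol Z = orthcomp (imcol E) -> kercol Z^T = imcol E.
Proof.
rewrite orth_kercol => ZE; symmetry; apply: eq_dimv_sub.
  apply/subvP => _ /mem_imcol[x ->]; rewrite mem_kercol.
  have EZ : E^T *m Z = 0 by apply: kercol_mul0; rewrite ZE.
  have -> : Z^T *m (E *m x) = (E^T *m Z)^T *m x by rewrite trmx_mul trmxK mulmxA.
  by rewrite EZ trmx0 mul0mx.
rewrite dim_kercol dim_imcol mxrank_tr -(dim_imcol Z) ZE dim_kercol mxrank_tr.
by rewrite subKn // rank_leq_row.
Qed.

End PairLinearAlgebra.

(** * Reduction steps and their behaviour under equivalence *)

Section Pairs.
Context {R : realType}.
Variable I : interval R.

(** Unlike in [reduction_step], S is written as the preimage of im E under F, so that Z disappears
    and the bases Y, C become parameters that can be compared. *)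
Definition reduction n r (E F : R -> 'M[R]_n) (Y C : R -> 'M[R]_(n, r)) (E1 F1 : R -> 'M[R]_r) :=
  [/\ is_basis_fun I Y (fun t => imcol (E t)),
      is_basis_fun I C (fun t => preimcol (F t) (imcol (E t)))
    & forall t, t \in I -> E1 t = (Y t)^T *m E t *m C t /\
          F1 t = (Y t)^T *m (F t *m C t + E t *m mxderive I C t)].

(* Levels i, ..., i + k - 1 of the reduction of a regular pair; when the last
   rank is 0 the final 0 x 0 matrix is nonsingular as well. *)
Fixpoint reg (r theta : nat -> nat) (k i : nat) n (E F : R -> 'M[R]_n) : Prop :=
  if k is k'.+1 then
    pre_regular I E F (r i) (theta i) /\
    exists (Y C : R -> 'M[R]_(n, r i)) (E1 F1 : R -> 'M[R]_(r i)),
      reduction E F Y C E1 F1 /\ reg r theta k' i.+1 E1 F1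
  else forall t, t \in I -> E t \in unitmx.

(** The effect on E x' + F x of substituting x = K y and multiplying by L; the term L E K' comes
    from the product rule. *)
Definition equiv_pair n (E F E' F' : R -> 'M[R]_n) :=
  exists L K : R -> 'M[R]_n, mxCn I 1 K /\ forall t, t \in I ->
    [/\ L t \in unitmx, K t \in unitmx, E' t = L t *m E t *m K t
      & F' t = L t *m F t *m K t + L t *m E t *m mxderive I K t].

(** C carries ker(Y^T E C) bijectively onto the intersection of N and S, because Y^T is injective on
    im E = im Y. *)
Lemma dimNS_reduction n r (E F : 'M[R]_n) (Y C : 'M[R]_(n, r)) :
  imcol Y = imcol E -> imcol C = preimcol F (imcol E) -> \rank C = r ->
  (\rank (Y^T *m E *m C) + \dim (kercol E :&: preimcol F (imcol E)))%N = r.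
Proof.
move=> YE CS rC.
have -> : \dim (kercol E :&: preimcol F (imcol E)) = \dim (kercol (Y^T *m E *m C)).
  apply: (@dim_inj_image _ _ _ C) => [x _|y].
    by apply: (col_inj rC).
  rewrite memv_cap -CS mem_kercol; split=> [/andP[Ey /mem_imcol[x yx]]|[x xk ->]].
    by exists x => //; rewrite mem_kercol -!mulmxA -yx (eqP Ey) mulmx0.
  rewrite mem_imcol_mul andbT.
  have [z zE] : exists z, E *m (C *m x) = Y *m z.
    by apply/mem_imcol; rewrite YE mem_imcol_mul.
  move: xk; rewrite mem_kercol -!mulmxA zE => /eqP H; apply/eqP.
  by apply: (@gram_ker _ n r 1 Y z); rewrite -mulmxA.
have rr := rank_leq_col (Y^T *m E *m C).
by rewrite dim_kercol subnKC.
Qed.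

Lemma reduction_rank n r theta (E F : R -> 'M[R]_n) Y C (E1 F1 : R -> 'M[R]_r) :
  pre_regular I E F r theta -> reduction E F Y C E1 F1 ->
  forall t, t \in I -> (\rank (E1 t) + theta)%N = r.
Proof.
move=> pr [[_ HY] [_ HC] H1] t tI; have [-> _] := H1 t tI.
have [_ _ <-] := pr t tI.
have /is_basisP[YE _] := HY t tI.
have /is_basisP[CS rC] := HC t tI.
exact: dimNS_reduction.
Qed.

Lemma pre_regular_le n (E F : R -> 'M[R]_n) r theta t : t \in I -> pre_regular I E F r theta ->
  (theta + r <= n)%N.
Proof.
move=> tI /(_ t tI)[_ rE <-].
have : (\dim (kercol (E t) :&: preimcol (F t) (imcol (E t))) <= \dim (kercol (E t)))%N.
  by apply: dimvS; exact: capvSl.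
have := rank_leq_col (E t); rewrite dim_kercol rE => h1 h2.
by have := leq_add h2 (leqnn r); rewrite subnK.
Qed.

Hypothesis nd : nondegenerate_interval I.

(** The extra term L E K' takes its values in L im E. It therefore changes neither im [E F] nor the
    preimage of im E, and K maps the new N and S onto the old ones. *)
Lemma pre_regular_equiv n (E F E' F' : R -> 'M[R]_n) r theta :
  pre_regular I E F r theta -> equiv_pair E F E' F' -> pre_regular I E' F' r theta.
Proof.
move=> pr [L [K [_ H]]] t tI; have [uL uK -> ->] := H t tI; have [full rE dNS] := pr t tI.
move: (mxderive I K t) (L t) (K t) (E t) (F t) uL uK full rE dNS => K' {pr H}.
move=> {}L {}K {}E {}F uL uK full rE dNS.
split.
- apply/eq_fullv => y.
  have /eq_fullv/(_ (invmx L *m y)) := full => /mem_imcol_row[a [b E1]].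
  apply/mem_imcol_row; exists (invmx K *m (a - K' *m (invmx K *m b))), (invmx K *m b).
  rewrite -[LHS](mulKVmx uL) E1 mulmxDr mulmxDl -!mulmxA !(mulKVmx uK).
  by rewrite [E *m (a - _)]mulmxBr mulmxBr addrACA addNr addr0.
- by rewrite mxrankMfree ?row_free_unit // -mxrank_tr trmx_mul mxrankMfree ?mxrank_tr // row_free_unit unitmx_tr.
- rewrite -dNS; symmetry; apply: (@dim_inj_image _ _ _ K) => [x _ Kx|y].
    by rewrite -(mulKmx uK x) Kx mulmx0.
  rewrite memv_cap mem_kercol; split.
    move=> /andP[/eqP Ey /mem_preim_im[x Fy]]; exists (invmx K *m y); last by rewrite mulKVmx.
    rewrite memv_cap mem_kercol -!mulmxA mulKVmx // Ey mulmx0 eqxx /=.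
    apply/mem_preim_im; exists (invmx K *m (x + K' *m (invmx K *m y))).
    by rewrite mulmxDl -!mulmxA !mulKVmx // Fy !mulmxDr.
  move=> [x]; rewrite memv_cap mem_kercol => /andP[/eqP Ex /mem_preim_im[z Fx]] ->.
  have EKx : E *m (K *m x) = 0.
    by rewrite -[LHS](mulKmx uL) -(mulmx0 _ (invmx L)) -Ex !mulmxA.
  rewrite EKx eqxx; apply/mem_preim_im; exists (K *m z - K' *m x).
  move: Fx; rewrite mulmxDl -!mulmxA => /(congr1 (mulmx (invmx L))).
  by rewrite [invmx L *m (_ + _)]mulmxDr !(mulKmx uL) mulmxBr => <-; rewrite addrK.
Qed.

(** Both E C and F C + E C' take values in im E = im Y, so the reduced pair, corrected by the Gram
    matrix of Y, gives their coordinates in the basis Y and nothing is lost by applying Y^T. *)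
Lemma reduction_im n r (E F : R -> 'M[R]_n) Y C (E1 F1 : R -> 'M[R]_r) t :
  reduction E F Y C E1 F1 -> t \in I ->
  (forall q (X : 'M[R]_(r, q)), exists2 D, E t *m C t *m X = Y t *m D &
     D = invmx ((Y t)^T *m Y t) *m E1 t *m X) /\
  (forall q (X : 'M[R]_(r, q)), exists2 D,
     (F t *m C t + E t *m mxderive I C t) *m X = Y t *m D &
     D = invmx ((Y t)^T *m Y t) *m F1 t *m X).
Proof.
move=> [[_ HY] [_ HC] H1] tI; have [-> ->] := H1 t tI.
have /is_basisP[YE rY] := HY t tI.
have /is_basisP[CS rC] := HC t tI.
have uY := gram_unit rY.
have im p q (M : 'M[R]_(n, p)) (X : 'M[R]_(p, q)) : (imcol M <= imcol (E t))%VS ->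
    M *m X = Y t *m (invmx ((Y t)^T *m Y t) *m ((Y t)^T *m M) *m X).
  rewrite -YE => /imcolP[D ->]; rewrite -[LHS]mulmxA; congr (_ *m _).
  by rewrite [(Y t)^T *m (Y t *m D)]mulmxA [invmx _ *m (_ *m D)]mulmxA mulVmx // mul1mx.
split=> q X.
  exists (invmx ((Y t)^T *m Y t) *m ((Y t)^T *m E t *m C t) *m X) => //.
  by rewrite -[_^T *m E t *m _]mulmxA -im //; apply/imcolP; exists (C t).
exists (invmx ((Y t)^T *m Y t) *m ((Y t)^T *m (F t *m C t + E t *m mxderive I C t)) *m X) => //.
rewrite -im //; apply/subvP => y /mem_imcol[x ->].
have : C t *m x \in imcol (C t) by exact: mem_imcol_mul.
rewrite CS => /mem_preim_im[z Fz]; apply/mem_imcol; exists (z + mxderive I C t *m x).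
by rewrite mulmxDl -!mulmxA Fz mulmxDr.
Qed.

(** K maps the new S onto the old one, so K C' = C P with a nonsingular C^1 factor P, where C' is
    the second basis. This P plays the part of K one level down. *)
Lemma equiv_reduction n r (E F E' F' : R -> 'M[R]_n) Y C (E1 F1 : R -> 'M[R]_r)
    Y' C' (E1' F1' : R -> 'M[R]_r) :
  equiv_pair E F E' F' -> reduction E F Y C E1 F1 -> reduction E' F' Y' C' E1' F1' ->
  equiv_pair E1 F1 E1' F1'.
Proof.
move=> [L [K [CK HLK]]] red red'.
have im := reduction_im red.
move: (red) (red') => [[CY HY] [CC HC] H1] [[CY' HY'] [CC' HC'] H1'].
pose P t := linv (C t) *m (K t *m C' t).
have rCt t : t \in I -> \rank (C t) = r.
  by move=> tI; have /is_basisP[] := HC t tI.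
have KC' t : t \in I -> C t *m P t = K t *m C' t.
  move=> tI; have [uL uK E't F't] := HLK t tI.
  have /is_basisP[CS rC] := HC t tI.
  have [CS' rC'] := proj1 (is_basisP _ _) (HC' t tI).
  rewrite /P; have /imcolP[X ->] : (imcol (K t *m C' t) <= imcol (C t))%VS.
    rewrite CS; apply/subvP => _ /mem_imcol[x ->]; rewrite -mulmxA.
    have : C' t *m x \in imcol (C' t) by exact: mem_imcol_mul.
    rewrite CS' => /mem_preim_im[z]; rewrite F't E't mulmxDl -!mulmxA => Hz.
    apply/mem_preim_im; exists (K t *m z - mxderive I K t *m (C' t *m x)).
    move/(congr1 (mulmx (invmx (L t)))): Hz.
    by rewrite [invmx _ *m (_ + _)]mulmxDr !(mulKmx uL) mulmxBr => <-; rewrite addrK.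
  by rewrite [linv _ *m (_ *m X)]mulmxA linvK // mul1mx.
have CP : mxCn I 1 P.
  by apply: mxCnM => //; [exact: mxCn_linv|exact: mxCnM].
exists (fun t => (Y' t)^T *m L t *m Y t *m invmx ((Y t)^T *m Y t)), P; split=> // t tI.
have [uL uK E't F't] := HLK t tI.
have /is_basisP[YE rY] := HY t tI.
have [YE' rY'] := proj1 (is_basisP _ _) (HY' t tI).
have /is_basisP[CS rC] := HC t tI.
have [CS' rC'] := proj1 (is_basisP _ _) (HC' t tI).
(* The identity K C' = C P differentiated on both sides: it trades the derivatives of K and of the
   new basis for those of C and P. *)
have dKC : mxderive I K t *m C' t + K t *m mxderive I C' t =
           mxderive I C t *m P t + C t *m mxderive I P t.
  rewrite -!mxderiveM //; apply: mxderive_ext => //; last exact: mxCnM.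
  by move=> s sI; rewrite KC'.
have [imE imF] := im t tI.
have [E1't F1't] := H1' t tI.
split.
- rewrite unitmx_mul unitmx_inv gram_unit // andbT.
  apply: square_unit => x; rewrite -mulmxA => H.
  have [z Hz] : exists z, L t *m Y t *m x = Y' t *m z.
    apply/mem_imcol; rewrite YE'.
    have : Y t *m x \in imcol (Y t) by exact: mem_imcol_mul.
    rewrite YE => /mem_imcol[w Hw]; apply/mem_imcol; exists (invmx (K t) *m w).
    by rewrite E't -!mulmxA mulKVmx // Hw.
  have := H; rewrite -!mulmxA [L t *m _]mulmxA Hz mulmxA => /gram_ker.
  rewrite -Hz -mulmxA => /(congr1 (mulmx (invmx (L t)))); rewrite mulKmx // mulmx0.
  by apply: (col_inj rY).
- apply: square_unit => x Px; apply: (col_inj rC').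
  have : K t *m (C' t *m x) = 0 by rewrite mulmxA -KC' // -mulmxA Px mulmx0.
  by move=> /(congr1 (mulmx (invmx (K t)))); rewrite mulKmx // mulmx0.
- rewrite E1't E't -!mulmxA -KC' //; congr (_ *m (_ *m _)).
  by have [D] := imE _ (P t); rewrite -!mulmxA => -> ->.
- have -> : F1' t = (Y' t)^T *m (L t *m ((F t *m C t + E t *m mxderive I C t) *m P t
        + E t *m C t *m mxderive I P t)).
    rewrite F1't E't F't; congr (_ *m _).
    have -> : (F t *m C t + E t *m mxderive I C t) *m P t + E t *m C t *m mxderive I P t
       = F t *m (K t *m C' t) + E t *m (mxderive I K t *m C' t + K t *m mxderive I C' t).
      by rewrite dKC mulmxDl -KC' // [E t *m (_ + _)]mulmxDr !mulmxA addrA.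
    by rewrite !mulmxDr !mulmxDl !mulmxA addrA.
  have [D -> ->] := imF _ (P t); have [D' -> ->] := imE _ (mxderive I P t).
  by rewrite -mulmxDr mulmxDr !mulmxA !mulmxDr !mulmxA.
Qed.

Lemma equiv_pair_refl n (E F : R -> 'M[R]_n) : equiv_pair E F E F.
Proof.
exists (fun=> 1%:M), (fun=> 1%:M); split; first exact: mxCn_cst.
by move=> t tI; rewrite unitmx1 mul1mx mulmx1 mxderive_cst // mulmx0 addr0 !mul1mx mulmx1.
Qed.

Lemma reduction_exists n r (E F : R -> 'M[R]_n) (Y C : R -> 'M[R]_(n, r)) :
  is_basis_fun I Y (fun t => imcol (E t)) ->
  is_basis_fun I C (fun t => preimcol (F t) (imcol (E t))) ->
  exists E1 F1, reduction E F Y C E1 F1.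
Proof.
move=> HY HC; exists (fun t => (Y t)^T *m E t *m C t).
by exists (fun t => (Y t)^T *m (F t *m C t + E t *m mxderive I C t)).
Qed.

Lemma reduction_C1 n r (E F : R -> 'M[R]_n) Y C (E1 F1 : R -> 'M[R]_r) k :
  reduction E F Y C E1 F1 -> mxCn I k E -> mxCn I k Y -> mxCn I k C -> mxCn I k E1.
Proof.
move=> [_ _ H] CE CY CC; apply: (@mxCn_ext _ _ nd _ _ _ (fun t => (Y t)^T *m E t *m C t)).
  by move=> t /H[->].
by apply: mxCnM => //; apply: mxCnM => //; exact: mxCnT.
Qed.

(** The transformed pair is reduced with a frame of im E', whence the C^1 condition on [E'], and
    with K^(-1) C. [equiv_reduction] then supplies the equivalence for the next level. *)
Lemma reg_equiv r theta k i n (E F E' F' : R -> 'M[R]_n) :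
  reg r theta k i E F -> equiv_pair E F E' F' -> mxCn I 1 E' -> reg r theta k i E' F'.
Proof.
elim: k i n E F E' F' => [|k IHk] i n E F E' F' /=.
  move=> uE [L [K [_ H]]] _ t tI; have [uL uK -> _] := H t tI.
  by rewrite !unitmx_mul uL uK uE.
move=> [pr [Y [C [E1 [F1 [red regk]]]]]] eqv CE'.
have pr' := pre_regular_equiv pr eqv; split=> //.
have [|Y' [CY' HY']] := @im_frame R I nd 0 (r i) n n E' CE'.
  by move=> t /pr'[].
have basY' : is_basis_fun I Y' (fun t => imcol (E' t)).
  split=> // t tI; apply/is_basisP; have [YY ->] := HY' t tI; split=> //.
  exact: orthonormal_rank.
have [L [K [CK HLK]]] := eqv; have [[CY HY] [CC HC] H1] := red.
have basC' : is_basis_fun I (fun t => invmx (K t) *m C t)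
    (fun t => preimcol (F' t) (imcol (E' t))).
  split; first by apply: mxCnM => //; apply: mxCnV => // t /HLK[].
  move=> t tI; have [uL uK -> ->] := HLK t tI; apply/is_basisP.
  have /is_basisP[CS rC] := HC t tI; split; last first.
    by rewrite -mxrank_tr trmx_mul mxrankMfree ?mxrank_tr // row_free_unit unitmx_tr unitmx_inv.
  apply/vspaceP => y; apply/mem_imcol/mem_preim_im => [[x ->]|[x]].
    have : C t *m x \in imcol (C t) by exact: mem_imcol_mul.
    rewrite CS => /mem_preim_im[z Hz].
    exists (invmx (K t) *m (z + mxderive I K t *m (invmx (K t) *m (C t *m x)))).
    by rewrite mulmxDl -!mulmxA !mulKVmx // Hz !mulmxDr.
  rewrite mulmxDl -!mulmxA => /(congr1 (mulmx (invmx (L t)))).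
  rewrite [invmx _ *m (_ + _)]mulmxDr !(mulKmx uL) => Hx.
  have : K t *m y \in imcol (C t).
    rewrite CS; apply/mem_preim_im; exists (K t *m x - mxderive I K t *m y).
    by rewrite mulmxBr -Hx addrK.
  by move=> /mem_imcol[z Hz]; exists z; rewrite -mulmxA -Hz mulKmx.
have [E1' [F1' red']] := reduction_exists basY' basC'.
exists Y', (fun t => invmx (K t) *m C t), E1', F1'; split=> //.
apply: (IHk _ _ E1 F1) => //; first exact: equiv_reduction eqv red red'.
by apply: (reduction_C1 red') => //; case: basC'.
Qed.

(** Independence of the bases: two reductions of one pair are equivalent, by [equiv_reduction] with
    L and K the identity. *)
Lemma reg_reduction r theta k i n (E F : R -> 'M[R]_n) Y C (E1 F1 : R -> 'M[R]_(r i)) :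
  reg r theta k.+1 i E F -> reduction E F Y C E1 F1 -> mxCn I 1 E1 ->
  reg r theta k i.+1 E1 F1.
Proof.
move=> [_ [Y0 [C0 [E0 [F0 [red0 reg0]]]]]] red CE1.
by apply: reg_equiv reg0 _ CE1; apply: equiv_reduction red0 red; exact: equiv_pair_refl.
Qed.

End Pairs.

(** * The spaces N, S and im E at a single point *)

Section PointGeometry.
Context {R : realType}.

Lemma castmx_col_im n g r (e : g = r) (A : 'M[R]_(n, g)) :
  imcol (castmx (erefl n, e) A) = imcol A /\ \rank (castmx (erefl n, e) A) = \rank A.
Proof. by case: _ / e; rewrite castmx_id. Qed.

Lemma preim_imE n q (E F : 'M[R]_n) (Z : 'M[R]_(n, q)) :
  imcol Z = orthcomp (imcol E) -> preimcol F (imcol E) = kercol (Z^T *m F).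
Proof.
move=> ZE; apply/vspaceP => z.
by rewrite mem_preimcol -(orthcompK ZE) !mem_kercol mulmxA.
Qed.

Lemma trmx_orth n p q (E : 'M[R]_(n, p)) (Z : 'M[R]_(n, q)) :
  imcol Z = orthcomp (imcol E) -> Z^T *m E = 0.
Proof.
by move=> ZE; apply: kercol_mul0; rewrite (orthcompK ZE).
Qed.

Lemma orth_kercolT n p q (E : 'M[R]_(n, p)) (T : 'M[R]_(p, q)) :
  imcol T = kercol E -> orthcomp (kercol E) = imcol E^T.
Proof. by move=> TE; rewrite -TE orth_kercol; apply: orthcompK; rewrite -kercol_orth. Qed.

(** Z^T [E F] = [0, Z^T F], and [E F] is onto while Z^T has independent rows. *)
Lemma row_free_ZF n q (E F : 'M[R]_n) (Z : 'M[R]_(n, q)) :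
  imcol (row_mx E F) = fullv -> imcol Z = orthcomp (imcol E) -> \rank Z = q ->
  row_free (Z^T *m F).
Proof.
move=> full ZE rZ; apply: inj_row_free => u uZF.
suff H (y : 'cV_n) : u *m Z^T *m y = 0.
  have : u *m Z^T = 0.
    by apply: eq_mulmx_col => y; rewrite H mul0mx.
  move=> /(congr1 trmx); rewrite trmx_mul trmxK trmx0 => /(col_inj rZ).
  by move=> /(congr1 trmx); rewrite trmxK trmx0.
have /eq_fullv/(_ y)/mem_imcol_row[a [b ->]] := full.
rewrite mulmxDr [_ *m (E *m a)]mulmxA -[u *m Z^T *m E]mulmxA (trmx_orth ZE) mulmx0 mul0mx add0r.
by rewrite mulmxA -[u *m _ *m F]mulmxA uZF mul0mx.
Qed.

(** T carries ker(Z^T F T) onto the intersection of N and S. Hence a = n - r - theta at every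
    level. *)
Lemma rank_ZFT n p q (E F : 'M[R]_n) (Z : 'M[R]_(n, q)) (T : 'M[R]_(n, p)) :
  imcol Z = orthcomp (imcol E) -> imcol T = kercol E -> \rank T = p ->
  (\rank (Z^T *m F *m T) + \dim (kercol E :&: preimcol F (imcol E)))%N = p.
Proof.
move=> ZE TE rT.
have -> : \dim (kercol E :&: preimcol F (imcol E)) = \dim (kercol (Z^T *m F *m T)).
  apply: (@dim_inj_image _ _ _ T) => [x _|y].
    by apply: (col_inj rT).
  rewrite (preim_imE F ZE) memv_cap -TE; split=> [/andP[/mem_imcol[x ->]]|[x xk ->]].
    by rewrite mem_kercol mulmxA => H; exists x => //; rewrite mem_kercol.
  by rewrite mem_imcol_mul; move: xk; rewrite !mem_kercol mulmxA.
by rewrite dim_kercol subnKC // rank_leq_col.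
Qed.

Lemma dsum_orth n g h (G : 'M[R]_(n, g)) (Gc : 'M[R]_(n, h)) :
  imcol Gc = orthcomp (imcol G) -> is_dsum (imcol G) (imcol Gc) fullv.
Proof.
move=> E.
have cap0 : (imcol G :&: imcol Gc)%VS = 0%VS.
  apply/eqP; rewrite -subv0; apply/subvP => y; rewrite memv_cap E orth_kercol memv0.
  move=> /andP[/mem_imcol[x ->]]; rewrite mem_kercol mulmxA => /eqP/gram_ker ->.
  by [].
split=> //; apply: eq_dimv_sub; first exact: subvf.
have := dimv_sum_cap (imcol G) (imcol Gc); rewrite cap0 dimv0 addn0 => ->.
rewrite E orth_kercol dim_kercol dim_imcol mxrank_tr dimvf /dim /= muln1.
by rewrite subnKC // rank_leq_row.
Qed.

Lemma rank_basisT_mul n p a (M : 'M[R]_(n, p)) (V : 'M[R]_(n, a)) :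
  imcol V = imcol M -> \rank V = a -> \rank (V^T *m M) = a.
Proof.
move=> VM rV; have rM : \rank M = a by rewrite -dim_imcol -VM dim_imcol.
have /imcolP[X MX] : (imcol M <= imcol V)%VS by rewrite VM.
have /imcolP[X' VX] : (imcol V <= imcol M)%VS by rewrite VM.
apply/eqP; rewrite eqn_leq rank_leq_row /=.
have uG := gram_unit rV.
have rVV : \rank (V^T *m V) = a by rewrite mxrank_unit.
by have := mxrankM_maxl (V^T *m M) X'; rewrite -mulmxA -VX rVV.
Qed.

Lemma onb_basis n k (B : 'M[R]_(n, k)) U : B^T *m B = 1%:M -> imcol B = U -> is_basis B U.
Proof. by move=> BB BU; apply/is_basisP; split=> //; exact: orthonormal_rank. Qed.

End PointGeometry.

(** * Dissection index *)

Section Dissection.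
Context {R : realType}.
Variable I : interval R.
Hypothesis nd : nondegenerate_interval I.

Lemma onb_fun k n p (B : R -> 'M[R]_(n, p)) U : mxCn I k.+1 B ->
  (forall t, t \in I -> (B t)^T *m B t = 1%:M /\ imcol (B t) = U t) ->
  is_orthonormal_basis_fun I B U.
Proof.
move=> CB HB; split; last by move=> t /HB[].
split; first exact: (mxCn_le nd) CB.
by move=> t /HB[BB BU]; exact: onb_basis.
Qed.

(** Orthonormal bases of one level, shared by dissection and strangeness. A row vector u killing W^T
    Z^T F Tc also kills W^T Z^T F T = 0, hence u W^T Z^T F = 0, and the independent rows of Z^T F
    force u = 0. *)
Lemma pair_frames k n r theta (E F : R -> 'M[R]_n) :
  mxCn I k.+1 E -> mxCn I k.+1 F -> pre_regular I E F r theta ->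
  let a := (n - r - theta)%N in
  exists (T : R -> 'M[R]_(n, n - r)) (Tc : R -> 'M[R]_(n, r)) (Z : R -> 'M[R]_(n, n - r))
         (W : R -> 'M[R]_(n - r, n - r - a)),
  let M t := (Z t)^T *m F t *m T t in
  [/\ mxCn I k.+1 T /\ mxCn I k.+1 Tc, mxCn I k.+1 Z /\ mxCn I k.+1 W &
      forall t, t \in I ->
      [/\ (T t)^T *m T t = 1%:M /\ imcol (T t) = kercol (E t),
          (Tc t)^T *m Tc t = 1%:M /\ imcol (Tc t) = orthcomp (kercol (E t)),
          (Z t)^T *m Z t = 1%:M /\ imcol (Z t) = orthcomp (imcol (E t)),
          (W t)^T *m W t = 1%:M /\ imcol (W t) = orthcomp (imcol (M t))
        & \rank (M t) = a /\ row_free ((W t)^T *m ((Z t)^T *m F t *m Tc t))]].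
Proof.
move=> CE CF pr a; have [t0 [_ [t0I _ _]]] := nd.
have thr := pre_regular_le t0I pr.
have rE t : t \in I -> \rank (E t) = r by case/pr.
have nr : ((n - r) + r)%N = n by rewrite subnK // (leq_trans _ thr) // leq_addl.
have nra : (theta + a)%N = (n - r)%N by rewrite /a; lia.
have [T [CT HT]] := ker_frame nd CE rE nr.
have [Tc [CTc HTc]] : exists B : R -> 'M[R]_(n, r), mxCn I k.+1 B /\
    forall t, t \in I -> (B t)^T *m B t = 1%:M /\ imcol (B t) = orthcomp (kercol (E t)).
  have [||B [CB HB]] := @im_frame R I nd k r n n (fun t => (E t)^T).
  - exact: mxCnT.
  - by move=> t tI; rewrite mxrank_tr rE.
  exists B; split=> // t tI; have [BB ->] := HB t tI; split=> //.
  by have [_ TE] := HT t tI; rewrite (orth_kercolT TE).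
have [Z [CZ HZ]] := orth_frame nd CE rE nr.
pose M t := (Z t)^T *m F t *m T t.
have CZF : mxCn I k.+1 (fun t => (Z t)^T *m F t) by apply: mxCnM => //; exact: mxCnT.
have CM : mxCn I k.+1 M by exact: mxCnM.
have rM t : t \in I -> \rank (M t) = a.
  move=> tI; have [_ _ dNS] := pr t tI; have [TT TE] := HT t tI; have [ZZ ZE] := HZ t tI.
  have := rank_ZFT (F t) ZE TE (orthonormal_rank TT); rewrite dNS => H.
  by apply: (@addIn theta); rewrite [RHS]addnC nra.
have nraa : ((n - r - a) + a)%N = (n - r)%N by rewrite subnK // -nra leq_addl.
have [W [CW HW]] := orth_frame nd CM rM nraa.
pose B t := (W t)^T *m ((Z t)^T *m F t *m Tc t).
have freeB t : t \in I -> row_free (B t).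
  move=> tI; have [full _ dNS] := pr t tI; have [TT TE] := HT t tI; have [ZZ ZE] := HZ t tI.
  have [TcTc TcE] := HTc t tI; have [WW WM] := HW t tI.
  apply: inj_row_free => u uB.
  have freeZF := row_free_ZF full ZE (orthonormal_rank ZZ).
  have uWZF : u *m (W t)^T *m ((Z t)^T *m F t) = 0.
    have ds : is_dsum (imcol (T t)) (imcol (Tc t)) fullv.
      by apply: dsum_orth; rewrite TcE TE.
    suff H (y : 'cV_n) : u *m (W t)^T *m ((Z t)^T *m F t) *m y = 0.
      by apply: eq_mulmx_col => y; rewrite H mul0mx.
    have : y \in (imcol (T t) + imcol (Tc t))%VS by rewrite ds.1 memvf.
    move=> /memv_addP[_ /mem_imcol[x1 ->] [_ /mem_imcol[x2 ->] ->]].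
    rewrite mulmxDr; have WM0 := trmx_orth WM.
    have -> : u *m (W t)^T *m ((Z t)^T *m F t) *m (T t *m x1) = u *m ((W t)^T *m M t) *m x1.
      by rewrite /M !mulmxA.
    rewrite WM0 mulmx0 mul0mx add0r.
    have -> : u *m (W t)^T *m ((Z t)^T *m F t) *m (Tc t *m x2) = u *m B t *m x2.
      by rewrite /B !mulmxA.
    by rewrite uB mul0mx.
  have /row_freeP[D ZFD] := freeZF.
  have : u *m (W t)^T = 0 by rewrite -[LHS]mulmx1 -ZFD mulmxA uWZF mul0mx.
  by move=> uW; rewrite -[u]mulmx1 -WW mulmxA uW mul0mx.
exists T, Tc, Z, W; split=> // t tI; split; [exact: HT|exact: HTc|exact: HZ|exact: HW|].
by split; [exact: rM|exact: freeB].
Qed.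

(** That C is a basis of S = ker Z^T F follows from Z^T F C = 0, its full column rank r, and dim S =
    n - (n - r). *)
Lemma dissection_level k n r theta (E F : R -> 'M[R]_n) :
  mxCn I k.+2 E -> mxCn I k.+2 F -> pre_regular I E F r theta ->
  exists E1 F1 : R -> 'M[R]_r, dissection_step I E F (n - r - theta) E1 F1 /\
    exists Y C, [/\ reduction I E F Y C E1 F1, mxCn I k.+1 E1 & mxCn I k.+1 F1].
Proof.
move=> CE CF pr; have [t0 [_ [t0I _ _]]] := nd.
have thr := pre_regular_le t0I pr.
have [T [Tc [Z [W [[CT CTc] [CZ CW] Hfr]]]]] := pair_frames CE CF pr.
set a := (n - r - theta)%N in W CW Hfr *.
have rE t : t \in I -> \rank (E t) = r by case/pr.
have nr : ((n - r) + r)%N = n by rewrite subnK // (leq_trans _ thr) // leq_addl.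
have nra : (theta + a)%N = (n - r)%N by rewrite /a; lia.
have HT t (tI : t \in I) := let: And5 h _ _ _ _ := Hfr t tI in h.
have HTc t (tI : t \in I) := let: And5 _ h _ _ _ := Hfr t tI in h.
have HZ t (tI : t \in I) := let: And5 _ _ h _ _ := Hfr t tI in h.
have HW t (tI : t \in I) := let: And5 _ _ _ h _ := Hfr t tI in h.
have [Y [CY HY]] := im_frame nd CE rE.
pose M t := (Z t)^T *m F t *m T t.
have CZF : mxCn I k.+2 (fun t => (Z t)^T *m F t) by apply: mxCnM => //; exact: mxCnT.
have CM : mxCn I k.+2 M by exact: mxCnM.
have rM t : t \in I -> \rank (M t) = a by case/Hfr => _ _ _ _ [].
have [V [CV HV]] := im_frame nd CM rM.
have thE : (n - r - a)%N = theta by rewrite -nra addnK.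
pose B t := (W t)^T *m ((Z t)^T *m F t *m Tc t).
have CB : mxCn I k.+2 B by apply: mxCnM; [exact: nd|exact: mxCnT|exact: mxCnM].
have freeB t : t \in I -> row_free (B t) by case/Hfr => _ _ _ _ [].
have rB t : t \in I -> \rank (B t) = theta.
  by move=> /freeB /eqP rBt; exact: etrans rBt thE.
have thr' : (theta <= r)%N by rewrite -(rB _ t0I) rank_leq_col.
have ge : ((r - theta) + theta)%N = r by rewrite subnK.
have [G [CG HG]] := ker_frame nd CB rB ge.
pose VM t := (V t)^T *m M t.
have CVM : mxCn I k.+2 VM by apply: mxCnM => //; exact: mxCnT.
have rVM t : t \in I -> \rank (VM t) = a.
  by move=> /HV[VV VME]; apply: rank_basisT_mul VME (orthonormal_rank VV).
have [H [CH HH]] := ker_frame nd CVM rVM nra.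
have rG t : t \in I -> \rank (G t) = (r - theta)%N by move=> /HG[/orthonormal_rank].
have rH t : t \in I -> \rank (H t) = theta by move=> /HH[/orthonormal_rank].
have [Gc [CGc HGc]] := @orth_frame R I nd _ _ _ _ (r - (r - theta))%N _ CG rG (subnK (leq_subr _ _)).
have anr : (a + theta)%N = (n - r)%N by rewrite addnC.
have [Hc [CHc HHc]] := orth_frame nd CH rH anr.
pose VF t := (V t)^T *m ((Z t)^T *m F t *m Tc t) *m G t.
have uVH t : t \in I -> VM t *m Hc t \in unitmx.
  move=> tI; apply: square_unit => x; rewrite -mulmxA => VMH.
  have [HH' HE] := HH t tI; have [HcHc HcE] := HHc t tI.
  have [_ cap0] := dsum_orth HcE.
  have : Hc t *m x \in (imcol (H t) :&: imcol (Hc t))%VS.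
    by rewrite memv_cap mem_imcol_mul HE mem_kercol VMH eqxx.
  rewrite cap0 memv0 => /eqP.
  by apply: (col_inj (orthonormal_rank HcHc)).
pose frakE t := - (invmx (VM t *m Hc t) *m VF t).
have CVF : mxCn I k.+2 VF.
  by apply: mxCnM => //; apply: mxCnM => //; [exact: mxCnT|exact: mxCnM].
have CfrakE : mxCn I k.+2 frakE.
  by apply: mxCnN => //; apply: mxCnM => //; apply: mxCnV => //; exact: mxCnM.
pose C0 t := row_mx (Tc t *m G t + T t *m Hc t *m frakE t) (T t *m H t).
pose C t := castmx (erefl n, ge) (C0 t).
have CC : mxCn I k.+2 C.
  apply: mxCn_castmx => //; apply: mxCn_row_mx; last exact: mxCnM.
  by apply: mxCnD => //; apply: mxCnM => //; exact: mxCnM.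
have basC : is_basis_fun I C (fun t => preimcol (F t) (imcol (E t))).
  split; first by apply: (mxCn_le nd) CC.
  move=> t tI; apply/is_basisP; rewrite /C; have [-> ->] := castmx_col_im ge (C0 t).
  have [full _ dNS] := pr t tI; have [TT TE] := HT t tI; have [ZZ ZE] := HZ t tI.
  have [TcTc TcE] := HTc t tI; have [WW WM] := HW t tI; have [VV VME] := HV t tI.
  have [GG GE] := HG t tI; have [HH' HE] := HH t tI.
  have freeZF := row_free_ZF full ZE (orthonormal_rank ZZ).
  have rC0 : \rank (C0 t) = (r - theta + theta)%N.
    apply/full_col_inj => x; rewrite -[x]vsubmxK mul_row_col mulmxDl => Ex.
    have TTc0 : (Tc t)^T *m T t = 0 by apply: trmx_orth; rewrite TcE TE.
    have := congr1 (mulmx (Tc t)^T) Ex.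
    rewrite !mulmxDr -!mulmxA ![_^T *m (T t *m _)]mulmxA TTc0 !mul0mx !addr0.
    rewrite ![_^T *m (Tc t *m _)]mulmxA TcTc mul1mx mulmx0 => Gx.
    have x1 : usubmx x = 0.
      by apply: (col_inj (rG _ tI)).
    move: Ex; rewrite x1 !mulmx0 !add0r -mulmxA => THx.
    have x2 : dsubmx x = 0.
      apply: (col_inj (rH _ tI)).
      by apply: (col_inj (orthonormal_rank TT)).
    by rewrite x2 col_mx0.
  split; last by rewrite rC0.
  rewrite (preim_imE (F t) ZE); apply: eq_dimv_sub; last first.
    rewrite dim_kercol dim_imcol rC0 ge; move: freeZF; rewrite /row_free => /eqP ->.
    by rewrite -{1}nr addKn.
  apply/subvP => _ /mem_imcol[x ->]; rewrite mem_kercol -[x]vsubmxK mul_row_col.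
  (* V and W together span the whole space, so a vector killed by both V^T and W^T is zero. *)
  have key q (v : 'M[R]_(n, q)) : (W t)^T *m ((Z t)^T *m F t *m v) = 0 ->
      (V t)^T *m ((Z t)^T *m F t *m v) = 0 -> (Z t)^T *m F t *m v = 0.
    set z := _ *m v => Wz Vz.
    have [sum_ _] : is_dsum (imcol (V t)) (imcol (W t)) fullv.
      by apply: dsum_orth; rewrite VME WM.
    suff : z^T *m z = 0.
      by move=> zz; rewrite -[z]mulmx1; apply: gram_ker; rewrite mulmx1.
    apply/matrixP => i j; have : col j z \in fullv by exact: memvf.
    rewrite -sum_ => /memv_addP[_ /mem_imcol[y1 ->] [_ /mem_imcol[y2 ->] zE]].
    have : z^T *m col j z = 0.
      have zV : z^T *m V t = 0 by apply: trmx_inj; rewrite trmx_mul trmxK Vz trmx0.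
      have zW : z^T *m W t = 0 by apply: trmx_inj; rewrite trmx_mul trmxK Wz trmx0.
      by rewrite zE mulmxDr !mulmxA zV zW !mul0mx addr0.
    by rewrite colE mulmxA -colE => /matrixP/(_ i 0); rewrite !mxE.
  have WM0 := trmx_orth WM.
  (* The W-component vanishes by the choice of G, the V-component because [frakE] is made to cancel
     it. *)
  have k1 : (Z t)^T *m F t *m (Tc t *m G t + T t *m Hc t *m frakE t) = 0.
    apply: key.
      have -> : (W t)^T *m ((Z t)^T *m F t *m (Tc t *m G t + T t *m Hc t *m frakE t))
         = B t *m G t + (W t)^T *m M t *m (Hc t *m frakE t).
        by rewrite /B /M !mulmxDr !mulmxA.
      by rewrite WM0 mul0mx addr0; apply: kercol_mul0; rewrite GE.
    have -> : (V t)^T *m ((Z t)^T *m F t *m (Tc t *m G t + T t *m Hc t *m frakE t))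
         = VF t + VM t *m Hc t *m frakE t.
      by rewrite /VF /VM /M !mulmxDr !mulmxA.
    by rewrite /frakE mulmxN mulmxA mulmxV ?uVH // mul1mx subrr.
  have k2 : (Z t)^T *m F t *m (T t *m H t) = 0.
    apply: key; first by rewrite ![_ *m (T t *m H t)]mulmxA -/(M t) mulmxA WM0 mul0mx.
    rewrite ![_ *m (T t *m H t)]mulmxA -/(M t) mulmxA -/(VM t).
    by apply: kercol_mul0; rewrite HE.
  by rewrite mulmxDr !mulmxA -[_ *m F t *m (_ + _)]/(_ *m _) k1 -[_ *m T t *m H t]mulmxA k2 !mul0mx addr0.
have basY := (onb_fun CY HY).1.
exists (fun t => (Y t)^T *m E t *m C t), (fun t => (Y t)^T *m (F t *m C t + E t *m mxderive I C t)).
have CEk : mxCn I k.+1 E by exact: mxCn_le CE.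
have CFk : mxCn I k.+1 F by exact: mxCn_le CF.
have CCk : mxCn I k.+1 C by exact: mxCn_le CC.
have CYk : mxCn I k.+1 (fun t => (Y t)^T) by apply: mxCnT => //; exact: mxCn_le CY.
split; last first.
  exists Y, C; split=> //; first by apply: mxCnM => //; exact: mxCnM.
  apply: mxCnM => //; apply: mxCnD => //; apply: mxCnM => //.
  exact: mxCn_mxderive.
exists T, Tc, Z, Y, V, W, (r - theta)%N, theta, ge, G, Gc, H, Hc, C; split.
- split=> //; [exact: (onb_fun CT HT).1|exact: (onb_fun CTc HTc).1|exact: (onb_fun CZ HZ).1].
- by split=> //; [exact: (onb_fun CV HV).1|exact: (onb_fun CW HW).1].
- split.
  + exact: (onb_fun CG HG).1.
  + exact: (onb_fun CH HH).1.
  + split; last by move=> t /HGc[_ GcE]; exact: dsum_orth.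
    by apply: (onb_fun CGc _).1 => t /HGc[].
  + split; last by move=> t /HHc[_ HcE]; exact: dsum_orth.
    by apply: (onb_fun CHc _).1 => t /HHc[].
- exact: (mxCn_le nd) CC.
- by move=> t tI; split=> //; rewrite /C /C0 /frakE /VF /VM /M -!mulmxA.
Qed.

(** Reindexing, so that inductions along the chain always restart at level 0 with shifted
    sequences. *)
Lemma reg_shift r theta k i n (E F : R -> 'M[R]_n) :
  reg I r theta k i.+1 E F <-> reg I (fun j => r j.+1) (fun j => theta j.+1) k i E F.
Proof.
elim: k i n E F => //= k IHk i n E F.
by split=> -[pr [Y [C [E1 [F1 [red /IHk H]]]]]]; split=> //; exists Y, C, E1, F1.
Qed.

Lemma dissection_chain k n r theta (E F : R -> 'M[R]_n) :
  reg I r theta k 0 E F -> mxCn I k.+1 E -> mxCn I k.+1 F ->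
  exists E_ F_ : forall i, R -> 'M[R]_(dims n r i),
    [/\ E_ 0%N = E, F_ 0%N = F & forall i, (i < k)%N ->
      dissection_step I (E_ i) (F_ i) (dims n r i - r i - theta i) (E_ i.+1) (F_ i.+1)].
Proof.
elim: k n r theta E F => [|k IHk] n r theta E F.
  move=> _ _ _.
  exists (fun i => match i return R -> 'M[R]_(dims n r i) with 0%N => E | _ => fun=> 0 end).
  by exists (fun i => match i return R -> 'M[R]_(dims n r i) with 0%N => F | _ => fun=> 0 end).
move=> regE CE CF; have [pr _] := regE.
have [E1 [F1 [step [Y [C [red CE1 CF1]]]]]] := dissection_level CE CF pr.
have CE11 : mxCn I 1 E1 by exact: mxCn_le CE1.
have /reg_shift reg1 := reg_reduction nd regE red CE11.
have [E_ [F_ [E0 F0 st]]] := IHk _ _ _ _ _ reg1 CE1 CF1.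
(* The chain of the reduced pair is prefixed with (E, F). Two constructors are matched because
   [dims] reduces only on a constructor; at 1 and at j.+2 both index conventions then give the same
   type. *)
exists (fun i => match i return R -> 'M[R]_(dims n r i) with
  0%N => E | 1%N => E_ 0%N | j.+2 => E_ j.+1 end).
exists (fun i => match i return R -> 'M[R]_(dims n r i) with
  0%N => F | 1%N => F_ 0%N | j.+2 => F_ j.+1 end).
split=> //; case=> [_|[|i] ik]; first by rewrite E0 F0.
  exact: (st 0%N).
exact: (st i.+1).
Qed.

End Dissection.

(** * Strangeness index *)

Section CanonicalBlocks.
Context {R : realType}.
Variables (s d a : nat).
Notation N := (s + (d + (a + (s + 0))))%N.

Definition blockE := (@tr_col_mx R, @mul_row_col R, @trmx1 R, @trmx0 R, @mulmx1 R, @mul1mx R,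
  @mul0mx R, @mulmx0 R, @addr0, @add0r).

Definition rows4 n (L1 : 'M[R]_(s, n)) (L2 : 'M[R]_(d, n)) (L3 : 'M[R]_(a, n))
    (L4 : 'M[R]_(s, n)) : 'M[R]_(N, n) :=
  col_mx L1 (col_mx L2 (col_mx L3 (col_mx L4 0))).

Definition cols4 n (K1 : 'M[R]_(n, s)) (K2 : 'M[R]_(n, d)) (K3 : 'M[R]_(n, a))
    (K4 : 'M[R]_(n, s + 0)) : 'M[R]_(n, N) :=
  row_mx K1 (row_mx K2 (row_mx K3 K4)).

Lemma rows4_cols4 n L1 L2 L3 L4 K1 K2 K3 K4 :
  @rows4 n L1 L2 L3 L4 *m @cols4 n K1 K2 K3 K4 =
  block_mx (L1 *m K1) (row_mx (L1 *m K2) (row_mx (L1 *m K3) (L1 *m K4)))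
   (col_mx (L2 *m K1) (col_mx (L3 *m K1) (col_mx (L4 *m K1) 0)))
   (block_mx (L2 *m K2) (row_mx (L2 *m K3) (L2 *m K4))
     (col_mx (L3 *m K2) (col_mx (L4 *m K2) 0))
     (block_mx (L3 *m K3) (L3 *m K4) (col_mx (L4 *m K3) 0) (col_mx (L4 *m K4) 0))).
Proof. by rewrite /rows4 /cols4 !(mul_col_row, mul_mx_row, mul_col_mx, mul0mx). Qed.

(** Reduces the canonical form to a table of block products. Products not listed are the free
    entries F12, F14, F24. *)
Lemma canonF_rows4_cols4 n L1 L2 L3 L4 K1 K2 K3 K4 :
  [/\ L1 *m K1 = 0, L1 *m K3 = 0, L2 *m K1 = 0, L2 *m K2 = 0 & L2 *m K3 = 0] ->
  [/\ L3 *m K1 = 0, L3 *m K2 = 0, L3 *m K3 = 1%:M & L3 *m K4 = 0] ->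
  [/\ L4 *m K1 = 1%:M, L4 *m K2 = 0, L4 *m K3 = 0 & L4 *m K4 = 0] ->
  @rows4 n L1 L2 L3 L4 *m @cols4 n K1 K2 K3 K4 =
  @canonF R s d a 0 (L1 *m K2) (L1 *m K4) (L2 *m K4).
Proof.
move=> [H1 H2 H3 H4 H5] [H6 H7 H8 H9] [H10 H11 H12 H13].
by rewrite rows4_cols4 H1 H2 H3 H4 H5 H6 H7 H8 H9 H10 H11 H12 H13 !col_mx0.
Qed.

Lemma canonE_rows4_cols4 n L1 L2 L3 L4 K1 K2 :
  [/\ L1 *m K1 = 1%:M, L1 *m K2 = 0, L2 *m K1 = 0 & L2 *m K2 = 1%:M] ->
  [/\ L3 *m K1 = 0, L3 *m K2 = 0, L4 *m K1 = 0 & L4 *m K2 = 0] ->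
  @rows4 n L1 L2 L3 L4 *m @cols4 n K1 K2 0 0 = @canonE R s d a 0 1%:M.
Proof.
move=> [H1 H2 H3 H4] [H5 H6 H7 H8].
by rewrite rows4_cols4 H1 H2 H3 H4 H5 H6 H7 H8 !(mulmx0, col_mx0, row_mx0, block_mx0).
Qed.

(* The identity block, typed with the [s + u] rows prescribed by [canonF] at
   [u = 0]. *)
Definition dl : 'M[R]_(s + 0, s) := col_mx 1%:M 0.

Lemma dlTK : dl^T *m dl = 1%:M.
Proof. by rewrite /dl tr_col_mx mul_row_col trmx1 mulmx1 trmx0 mul0mx addr0. Qed.

Lemma dlKT : dl *m dl^T = 1%:M.
Proof.
rewrite /dl tr_col_mx mul_col_row trmx1 mulmx1 trmx0 mul0mx mulmx0 mul0mx.
by rewrite (@scalar_mx_block _ s 0 (1:R)); congr block_mx; apply/matrixP => -[].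
Qed.

(* [Jl], [Hl] select the rows and [Jr], [Hr] the columns of the canonical form
   that survive, respectively disappear, in one reduction step. *)
Lemma canon_selectors : exists (Jl Jr : 'M[R]_(N, s + d)) (Hl Hr : 'M[R]_(N, a + s)),
  [/\ Jl^T *m Jl = 1%:M, Jl *m Jl^T + Hl *m Hl^T = 1%:M, Hl^T *m Hl = 1%:M & Jl^T *m Hl = 0] /\
  [/\ Jr^T *m Jr = 1%:M, Jr *m Jr^T + Hr *m Hr^T = 1%:M, Hr^T *m Hr = 1%:M & Jr^T *m Hr = 0] /\
  forall F12 F14 F24, let F := @canonF R s d a 0 F12 F14 F24 in
  let E := @canonE R s d a 0 1%:M in let E1 := @canonE R s d a 0 0 in
  [/\ Hl^T *m F = Hr^T, Jl^T *m F *m Hr = 0, Hl^T *m E = 0, exists B, Jl = E *m B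
    & Hl^T *m E1 = 0 /\ Jl^T *m E1 = Jl^T *m E *m Jr *m Jr^T].
Proof.
pose J1 : 'M[R]_(N, s) := col_mx 1%:M (col_mx 0 (col_mx 0 0)).
pose J2 : 'M[R]_(N, d) := col_mx 0 (col_mx 1%:M (col_mx 0 0)).
pose J3 : 'M[R]_(N, a) := col_mx 0 (col_mx 0 (col_mx 1%:M 0)).
pose J4 : 'M[R]_(N, s) := col_mx 0 (col_mx 0 (col_mx 0 dl)).
have [J11 J22 J33 J44] : [/\ J1^T *m J1 = 1%:M, J2^T *m J2 = 1%:M, J3^T *m J3 = 1%:M & J4^T *m J4 = 1%:M].
  by rewrite /J1 /J2 /J3 /J4; split; rewrite !blockE ?dlTK.
have [J12 J13 J14] : [/\ J1^T *m J2 = 0, J1^T *m J3 = 0 & J1^T *m J4 = 0].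
  by rewrite /J1 /J2 /J3 /J4; split; rewrite !blockE.
have [J23 J24 J34] : [/\ J2^T *m J3 = 0, J2^T *m J4 = 0 & J3^T *m J4 = 0].
  by rewrite /J1 /J2 /J3 /J4; split; rewrite !blockE.
have tr0 p q n' (A : 'M[R]_(n', p)) (B : 'M[R]_(n', q)) : A^T *m B = 0 -> B^T *m A = 0.
  by move=> AB; apply: trmx_inj; rewrite trmx_mul trmxK AB trmx0.
have sumJ : J1 *m J1^T + (J2 *m J2^T + (J3 *m J3^T + J4 *m J4^T)) = 1%:M.
  rewrite /J1 /J2 /J3 /J4 !(blockE, mul_col_row, mul_mx_row, mul_col_mx).
  rewrite ?dlKT !(row_mx0, col_mx0, add_block_mx, addr0, add0r, add_row_mx, add_col_mx, block_mx0).
  have push p q1 q2 q3 (A : 'M[R]_(q1, q3)) (B : 'M[R]_(q2, q3)) :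
      col_mx (row_mx (0 : 'M[R]_(q1, p)) A) (row_mx 0 B) = row_mx 0 (col_mx A B).
    by rewrite -[LHS]/(block_mx 0 A 0 B) block_mxEh col_mx0.
  have one p q (M : 'M[R]_q) : M = 1%:M ->
      col_mx (row_mx (1%:M : 'M[R]_p) 0) (row_mx 0 M) = 1%:M.
    by move=> ->; rewrite -[LHS]/(block_mx 1%:M 0 0 1%:M) -scalar_mx_block.
  have z q (A B : 'M[R]_(0, q)) : A = B by apply/matrixP => -[].
  rewrite (z _ 0 (row_mx (0 : 'M[R]_(0, s)) (row_mx (0 : 'M[R]_(0, d)) (row_mx (0 : 'M[R]_(0, a))
    (row_mx (0 : 'M[R]_(0, s)) (0 : 'M[R]_(0, 0))))))).
  by rewrite !push; do 4!apply: (one); apply/matrixP => -[].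
(* E has zero row blocks 3 and 4, and there F reads off the column blocks 3 and 1: these variables
   vanish, and the column blocks 4 and 2 span S. Block 4 is listed before block 2 to match the sizes
   s, d of the row blocks 1, 2. *)
exists (row_mx J1 J2), (row_mx J4 J2), (row_mx J3 J4), (row_mx J3 J1); split; last split.
- split.
  + by rewrite tr_row_mx mul_col_row J11 J22 J12 (tr0 _ _ _ _ _ J12) -scalar_mx_block.
  + by rewrite !tr_row_mx !mul_row_col -addrA.
  + by rewrite tr_row_mx mul_col_row J33 J44 J34 (tr0 _ _ _ _ _ J34) -scalar_mx_block.
  + by rewrite tr_row_mx mul_col_row J13 J14 J23 J24 block_mx0.
- split.
  + by rewrite tr_row_mx mul_col_row J44 J22 J24 (tr0 _ _ _ _ _ J24) -scalar_mx_block.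
  + rewrite !tr_row_mx !mul_row_col -sumJ.
    move: (J1 *m _) (J2 *m _) (J3 *m _) (J4 *m _) => A B C D.
    by rewrite [D + B]addrC [C + A]addrC addrACA [B + A]addrC [D + C]addrC -addrA.
  + by rewrite tr_row_mx mul_col_row J33 J11 J13 (tr0 _ _ _ _ _ J13) -scalar_mx_block.
  + by rewrite tr_row_mx mul_col_row J23 (tr0 _ _ _ _ _ J12) (tr0 _ _ _ _ _ J34) (tr0 _ _ _ _ _ J14) block_mx0.
move=> F12 F14 F24 F E E1.
have mE X : [/\ J1^T *m @canonE R s d a 0 X = X *m J1^T, J2^T *m @canonE R s d a 0 X = J2^T,
    J3^T *m @canonE R s d a 0 X = 0 & J4^T *m @canonE R s d a 0 X = 0].
  rewrite /canonE /block_mx /J1 /J2 /J3 /J4; split;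
   by rewrite !(blockE, mul_mx_row, row_mx0, col_mx0, add_row_mx).
have mF : [/\ J1^T *m F *m J3 = 0, J1^T *m F *m J1 = 0, J2^T *m F *m J3 = 0, J2^T *m F *m J1 = 0
    & J3^T *m F = J3^T /\ J4^T *m F = J1^T].
  rewrite /F /canonF /block_mx /J1 /J2 /J3 /J4; split; last split;
   by rewrite !(blockE, mul_mx_row, row_mx0, col_mx0, add_row_mx, mul_col_row) /dl ?blockE.
have [E11 E12 E13 E14] := mE 1%:M; have [E21 E22 E23 E24] := mE 0.
have [F13 F11 F23 F21 [F3 F4]] := mF.
split.
- by rewrite !tr_row_mx mul_col_mx F3 F4.
- by rewrite tr_row_mx mul_col_mx mul_col_row F13 F11 F23 F21 block_mx0.
- by rewrite tr_row_mx mul_col_mx E13 E14 col_mx0.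
- exists (row_mx J1 J2); rewrite mul_mx_row /E /canonE /J1 /J2.
  by rewrite !(blockE, mul_block_col, col_mx0).
- rewrite !tr_row_mx !mul_col_mx E23 E24 col_mx0; split=> //.
  rewrite E21 E22 E11 E12 mul1mx mul0mx !mul_mx_row !mul_row_col J14 J12 J24 J22.
  by rewrite !mul0mx mul1mx !add0r.
Qed.

End CanonicalBlocks.

(** * The canonical form of a pre-regular pair *)

Section StrangenessLevel.
Context {R : realType}.
Variable I : interval R.
Hypothesis nd : nondegenerate_interval I.

Lemma mxCn_usubmx k n1 n2 p (A : R -> 'M[R]_(n1 + n2, p)) : mxCn I k A ->
  mxCn I k (fun t => usubmx (A t)).
Proof. by move=> CA i j; under eq_fun do rewrite mxE. Qed.

Lemma mxCn_dsubmx k n1 n2 p (A : R -> 'M[R]_(n1 + n2, p)) : mxCn I k A ->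
  mxCn I k (fun t => dsubmx (A t)).
Proof. by move=> CA i j; under eq_fun do rewrite mxE. Qed.

Lemma kercol_col_mx n1 n2 p (A : 'M[R]_(n1, p)) (B : 'M[R]_(n2, p)) :
  kercol (col_mx A B) = (kercol A :&: kercol B)%VS.
Proof.
apply/vspaceP => z; rewrite memv_cap !mem_kercol mul_col_mx.
apply/eqP/andP => [/eqP|[/eqP-> /eqP->]]; last by rewrite col_mx0.
by rewrite col_mx_eq0 => /andP[].
Qed.

(** The orthogonal complement is taken in the coordinates of the orthonormal frame T, where K
    becomes T^T K, still of rank q. *)
Lemma complement_frame k n p q q' (T : R -> 'M[R]_(n, p)) (K : R -> 'M[R]_(n, q)) :
  mxCn I k.+1 T -> mxCn I k.+1 K -> (q' + q)%N = p ->
  (forall t, t \in I -> [/\ (T t)^T *m T t = 1%:M, \rank (K t) = q &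
     (imcol (K t) <= imcol (T t))%VS]) ->
  exists K' : R -> 'M[R]_(n, q'), mxCn I k.+1 K' /\ forall t, t \in I ->
    [/\ (K' t)^T *m K' t = 1%:M, (imcol (K' t) <= imcol (T t))%VS & (K t)^T *m K' t = 0].
Proof.
move=> CT CK qq H.
have CM : mxCn I k.+1 (fun t => (T t)^T *m K t) by apply: mxCnM => //; exact: mxCnT.
have rM t : t \in I -> \rank ((T t)^T *m K t) = q.
  move=> tI; have [TT rK /imcolP[X KX]] := H t tI.
  apply/full_col_inj => x; rewrite KX mulmxA TT mul1mx => Xx.
  by apply: (col_inj rK); rewrite KX -mulmxA Xx mulmx0.
have [X [CX HX]] := orth_frame nd CM rM qq.
exists (fun t => T t *m X t); split; first exact: mxCnM.
move=> t tI; have [TT rK _] := H t tI; have [XX XE] := HX t tI; split.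
- by rewrite trmx_mul mulmxA -[(X t)^T *m _ *m _]mulmxA TT mulmx1.
- by apply/imcolP; exists (X t).
- apply: trmx_inj; rewrite trmx0 !trmx_mul trmxK -mulmxA.
  exact: trmx_orth XE.
Qed.

Variables (s d a : nat).
Notation N := (s + (d + (a + (s + 0))))%N.

Lemma mulmx_cols4 n p (E : 'M[R]_(p, n)) K1 K2 K3 K4 :
  E *m @cols4 R s d a n K1 K2 K3 K4 = cols4 (E *m K1) (E *m K2) (E *m K3) (E *m K4).
Proof. by rewrite /cols4 !mul_mx_row. Qed.

Lemma add_cols4 n K1 K2 K3 K4 K1' K2' K3' K4' :
  @cols4 R s d a n K1 K2 K3 K4 + cols4 K1' K2' K3' K4' =
  cols4 (K1 + K1') (K2 + K2') (K3 + K3') (K4 + K4').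
Proof. by rewrite /cols4 !add_row_mx. Qed.

(** Columns: K4 spans the intersection of N and S, K3 and K2 complete it to N and to S, and K1 is
    dual to the rows L4 F. Rows: L3 and L4 kill im E, while L1 and L2 give coordinates on im E with
    respect to E [K1 K2]. What remains is to clear columns 1 and 3 and the block (2,2) of F. *)
Lemma strangeness_block k (E F : R -> 'M[R]_N) :
  mxCn I k.+2 E -> mxCn I k.+2 F -> pre_regular I E F (s + d) s ->
  exists E1 F1 : R -> 'M[R]_N,
    [/\ strangeness_step I E F a s d 0 E1 F1, mxCn I k.+1 E1 & mxCn I k.+1 F1].
Proof.
move=> CE CF pr.
have rE t : t \in I -> \rank (E t) = (s + d)%N by case/pr.
have nr : ((s + a) + (s + d))%N = N by lia.
have [T [CT HT]] := ker_frame nd CE rE nr.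
have [Z [CZ HZ]] := orth_frame nd CE rE nr.
have CZF : mxCn I k.+2 (fun t => (Z t)^T *m F t) by apply: mxCnM => //; exact: mxCnT.
have rZF t : t \in I -> \rank ((Z t)^T *m F t) = (s + a)%N.
  move=> tI; have [full _ _] := pr t tI; have [ZZ ZE] := HZ t tI.
  by apply/eqP; exact: row_free_ZF full ZE (orthonormal_rank ZZ).
have rn : ((s + d) + (s + a))%N = N by lia.
have [S [CS HS]] := ker_frame nd CZF rZF rn.
have CEZ : mxCn I k.+2 (fun t => col_mx (E t) ((Z t)^T *m F t)) by exact: mxCn_col_mx.
have rEZ t : t \in I -> \rank (col_mx (E t) ((Z t)^T *m F t)) = (N - s)%N.
  move=> tI; have [_ _ dNS] := pr t tI; have [ZZ ZE] := HZ t tI.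
  have H : (N - \rank (col_mx (E t) ((Z t)^T *m F t)))%N = s.
    by rewrite -dim_kercol kercol_col_mx -(preim_imE (F t) ZE).
  by have := subKn (rank_leq_col (col_mx (E t) ((Z t)^T *m F t))); rewrite H => <-.
have n4 : ((s + 0) + (N - s))%N = N by lia.
have [K4 [CK4 HK4]] := ker_frame nd CEZ rEZ n4.
have K4sub t : t \in I -> (imcol (K4 t) <= imcol (T t))%VS /\ (imcol (K4 t) <= imcol (S t))%VS.
  move=> tI; have [_ ->] := HK4 t tI; have [_ ->] := HT t tI; have [_ ->] := HS t tI.
  by rewrite kercol_col_mx capvSl capvSr.
have a4 : (a + (s + 0))%N = (s + a)%N by lia.
have [|K3 [CK3 HK3]] := complement_frame CT CK4 a4.
  move=> t tI; have [TT _] := HT t tI; have [KK _] := HK4 t tI; split=> //.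
    exact: orthonormal_rank.
  by have [] := K4sub t tI.
have d4 : (d + (s + 0))%N = (s + d)%N by lia.
have [|K2 [CK2 HK2]] := complement_frame CS CK4 d4.
  move=> t tI; have [SS _] := HS t tI; have [KK _] := HK4 t tI; split=> //.
    exact: orthonormal_rank.
  by have [] := K4sub t tI.
have EK4 t : t \in I -> E t *m K4 t = 0.
  by move=> tI; apply: kercol_mul0; have [_ <-] := HT t tI; have [] := K4sub t tI.
have EK3 t : t \in I -> E t *m K3 t = 0.
  by move=> tI; apply: kercol_mul0; have [_ <-] := HT t tI; have [] := HK3 t tI.
have ZFK4 t : t \in I -> (Z t)^T *m F t *m K4 t = 0.
  by move=> tI; apply: kercol_mul0; have [_ <-] := HS t tI; have [] := K4sub t tI.
have ZFK2 t : t \in I -> (Z t)^T *m F t *m K2 t = 0.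
  by move=> tI; apply: kercol_mul0; have [_ <-] := HS t tI; have [] := HK2 t tI.
have ZE0 t : t \in I -> (Z t)^T *m E t = 0 by move=> /HZ[_ /trmx_orth].
pose M t := (Z t)^T *m F t *m K3 t.
have CM : mxCn I k.+2 M by exact: mxCnM.
have rM t : t \in I -> \rank (M t) = a.
  move=> tI; apply/full_col_inj => x; rewrite /M -mulmxA => Mx.
  have [K33 _ K43] := HK3 t tI; have [K44 K4E] := HK4 t tI.
  have : K3 t *m x \in imcol (K4 t).
    rewrite K4E mem_kercol mul_col_mx Mx mulmxA EK3 // mul0mx col_mx0 //.
  move=> /mem_imcol[y Hy].
  have y0 : y = 0 by rewrite -[y]mul1mx -K44 -mulmxA -Hy mulmxA K43 mul0mx.
  by rewrite -[x]mul1mx -K33 -mulmxA Hy y0 !mulmx0.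
have [V [CV HV]] := orth_frame nd CM rM (erefl (s + a)%N).
have VM0 t : t \in I -> (V t)^T *m M t = 0 by move=> /HV[_ /trmx_orth].
have CZT : mxCn I k.+2 (fun t => (Z t)^T) by exact: mxCnT.
pose L4 t := (V t)^T *m (Z t)^T.
pose L3 t := linv (M t) *m (Z t)^T.
have CL4 : mxCn I k.+2 L4 by apply: mxCnM => //; exact: mxCnT.
have CL3 : mxCn I k.+2 L3 by apply: mxCnM => //; exact: mxCn_linv.
have L4E t : t \in I -> L4 t *m E t = 0 by move=> tI; rewrite /L4 -mulmxA ZE0 // mulmx0.
have L3E t : t \in I -> L3 t *m E t = 0 by move=> tI; rewrite /L3 -mulmxA ZE0 // mulmx0.
have L3F q (X : 'M[R]_(N, q)) t : L3 t *m (F t *m X) = linv (M t) *m ((Z t)^T *m F t *m X).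
  by rewrite /L3 !mulmxA.
have L4F q (X : 'M[R]_(N, q)) t : L4 t *m (F t *m X) = (V t)^T *m ((Z t)^T *m F t *m X).
  by rewrite /L4 !mulmxA.
pose Q t := (col_mx (L3 t *m F t) (L4 t *m F t))^T.
have CQ : mxCn I k.+2 Q by apply: mxCnT => //; apply: mxCn_col_mx; exact: mxCnM.
have rQ t : t \in I -> \rank (Q t) = (a + s)%N.
  move=> tI; have [full _ _] := pr t tI; have [ZZ ZE] := HZ t tI; have [VV _] := HV t tI.
  have /row_freeP[D ZFD] := row_free_ZF full ZE (orthonormal_rank ZZ).
  apply/full_col_inj => x; rewrite -[x]vsubmxK; set x1 := usubmx x; set x2 := dsubmx x.
  move=> /(congr1 trmx); rewrite trmx_mul trmxK trmx0 tr_col_mx mul_row_col => H.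
  have : x1^T *m linv (M t) + x2^T *m (V t)^T = 0.
    rewrite -[LHS]mulmx1 -ZFD [LHS]mulmxA (_ : _ *m (_ *m F t) = 0) ?mul0mx //.
    by rewrite mulmxDl -[RHS]H /L3 /L4 !mulmxA.
  move=> H2.
  have x10 : x1 = 0.
    have := congr1 (mulmx^~ (M t)) H2.
    rewrite mulmxDl -!mulmxA linvK ?rM // VM0 // mulmx1 mulmx0 addr0 mul0mx.
    by move=> /(congr1 trmx); rewrite trmxK trmx0.
  move: H2; rewrite x10 trmx0 mul0mx add0r => /(congr1 (mulmx^~ (V t))).
  rewrite -mulmxA VV mulmx1 mul0mx => /(congr1 trmx); rewrite trmxK trmx0 => ->.
  by rewrite col_mx0.
(* A right inverse of the stacked rows L3 F, L4 F, restricted to its last s columns: L3 F K1 = 0 and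
   L4 F K1 = 1. *)
pose K1 t := (linv (Q t))^T *m col_mx (0 : 'M[R]_(a, s)) 1%:M.
have CK1 : mxCn I k.+2 K1.
  by apply: mxCnM => //; [apply: mxCnT => //; exact: mxCn_linv|exact: mxCn_cst].
have [L3FK1 L4FK1] : (forall t, t \in I -> L3 t *m (F t *m K1 t) = 0) /\
                     (forall t, t \in I -> L4 t *m (F t *m K1 t) = 1%:M).
  suff H t : t \in I -> L3 t *m (F t *m K1 t) = 0 /\ L4 t *m (F t *m K1 t) = 1%:M.
    by split=> t /H[].
  move=> tI.
  have : (Q t)^T *m K1 t = col_mx 0 1%:M.
    rewrite /K1 mulmxA -trmx_mul linvK ?trmx1 ?mul1mx //; exact: rQ.
  by rewrite /Q trmxK mul_col_mx !mulmxA => /eq_col_mx.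
clearbody K1.
have L3FK2 t : t \in I -> L3 t *m (F t *m K2 t) = 0 by move=> tI; rewrite L3F ZFK2 // mulmx0.
have L4FK2 t : t \in I -> L4 t *m (F t *m K2 t) = 0 by move=> tI; rewrite L4F ZFK2 // mulmx0.
have L3FK3 t : t \in I -> L3 t *m (F t *m K3 t) = 1%:M by move=> tI; rewrite L3F linvK // rM.
have L4FK3 t : t \in I -> L4 t *m (F t *m K3 t) = 0 by move=> tI; rewrite L4F VM0.
have L3FK4 t : t \in I -> L3 t *m (F t *m K4 t) = 0 by move=> tI; rewrite L3F ZFK4 // mulmx0.
have L4FK4 t : t \in I -> L4 t *m (F t *m K4 t) = 0 by move=> tI; rewrite L4F ZFK4 // mulmx0.
(* L4 F isolates the K1-part, L3 F the K3-part; K2 and K4 are separated by orthogonality. *)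
have Kinj t (x1 : 'cV_s) (x2 : 'cV_d) (x3 : 'cV_a) (x4 : 'cV_(s + 0)) : t \in I ->
    K1 t *m x1 + (K2 t *m x2 + (K3 t *m x3 + K4 t *m x4)) = 0 ->
    [/\ x1 = 0, x2 = 0, x3 = 0 & x4 = 0].
  move=> tI H.
  have dist n' (L : 'M[R]_(n', N)) : L *m (F t *m K1 t) *m x1 + (L *m (F t *m K2 t) *m x2 +
      (L *m (F t *m K3 t) *m x3 + L *m (F t *m K4 t) *m x4)) = 0.
    by rewrite -!(mulmxA L) -!(mulmxA (F t)) -!mulmxDr H !mulmx0.
  have x10 : x1 = 0.
    have := dist _ (L4 t); rewrite L4FK1 // L4FK2 // L4FK3 // L4FK4 //.
    by rewrite !mul0mx !addr0 mul1mx.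
  have x30 : x3 = 0.
    have := dist _ (L3 t); rewrite L3FK1 // L3FK2 // L3FK3 // L3FK4 //.
    by rewrite !mul0mx addr0 !add0r mul1mx.
  have [K22 _ K42] := HK2 t tI; have [K44 _] := HK4 t tI.
  move: H; rewrite x10 x30 !mulmx0 !add0r => H.
  have x40 : x4 = 0.
    have := congr1 (mulmx (K4 t)^T) H.
    by rewrite mulmxDr !mulmxA K42 K44 mul0mx mul1mx add0r mulmx0.
  move: H; rewrite x40 mulmx0 addr0 => H; split=> //.
  by rewrite -[x2]mul1mx -K22 -mulmxA H mulmx0.
pose J t := row_mx (E t *m K1 t) (E t *m K2 t).
have CJ : mxCn I k.+2 J by apply: mxCn_row_mx; exact: mxCnM.
have rJ t : t \in I -> \rank (J t) = (s + d)%N.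
  move=> tI; apply/full_col_inj => x; rewrite -[x]vsubmxK mul_row_col -!mulmxA -mulmxDr.
  set x1 := usubmx x; set x2 := dsubmx x => H.
  have [TT TE] := HT t tI; have [K33 K3T K43] := HK3 t tI; have [K44 _] := HK4 t tI.
  have [K4T _] := K4sub t tI.
  have TK : imcol (row_mx (K3 t) (K4 t)) = imcol (T t).
    apply: eq_dimv_sub.
      apply/subvP => y /mem_imcol_row[y1 [y2 ->]].
      by apply: memvD; [apply: (subvP K3T)|apply: (subvP K4T)]; exact: mem_imcol_mul.
    rewrite !dim_imcol (orthonormal_rank TT) -a4.
    have -> // : \rank (row_mx (K3 t) (K4 t)) = (a + (s + 0))%N.
    apply/full_col_inj => y; rewrite -[y]vsubmxK mul_row_col => Hy.
    have [|_ _ -> ->] := Kinj t 0 0 (usubmx y) (dsubmx y) tI.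
      by rewrite !mulmx0 !add0r.
    by rewrite col_mx0.
  have : K1 t *m x1 + K2 t *m x2 \in imcol (T t) by rewrite TE mem_kercol H.
  rewrite -TK => /mem_imcol_row[y1 [y2 Hy]].
  have [|-> -> _ _] := Kinj t x1 x2 (- y1) (- y2) tI; last by rewrite col_mx0.
  by rewrite addrA Hy !mulmxN -opprD subrr.
pose Lp t := linv (J t).
have CLp : mxCn I k.+2 Lp by exact: mxCn_linv.
pose DF q (X : R -> 'M[R]_(N, q)) t := F t *m X t + E t *m mxderive I X t.
have CE1 : mxCn I k.+1 E by exact: mxCn_le CE.
have CF1 : mxCn I k.+1 F by exact: mxCn_le CF.
have low p q (X : R -> 'M[R]_(p, q)) : mxCn I k.+2 X -> mxCn I k.+1 X.
  by move=> CX; exact: mxCn_le CX.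
have CDF q (X : R -> 'M[R]_(N, q)) : mxCn I k.+2 X -> mxCn I k.+1 (DF q X).
  move=> CX; apply: mxCnD => //; apply: mxCnM => //; first exact: low.
  exact: mxCn_mxderive.
have L3DF q (X : R -> 'M[R]_(N, q)) t : t \in I -> L3 t *m DF q X t = L3 t *m (F t *m X t).
  by move=> tI; rewrite /DF mulmxDr [L3 t *m (E t *m _)]mulmxA L3E // mul0mx addr0.
have L4DF q (X : R -> 'M[R]_(N, q)) t : t \in I -> L4 t *m DF q X t = L4 t *m (F t *m X t).
  by move=> tI; rewrite /DF mulmxDr [L4 t *m (E t *m _)]mulmxA L4E // mul0mx addr0.
(* Multiples of the rows L4 and L3 are subtracted to clear columns 1 and 3 of the upper rows of F.
   Since L3 E = L4 E = 0, the E-part is not disturbed. *)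
pose L12 t := Lp t - Lp t *m DF _ K1 t *m L4 t - Lp t *m DF _ K3 t *m L3 t.
have CL12 : mxCn I k.+1 L12.
  have CLDF q (X : R -> 'M[R]_(N, q)) : mxCn I k.+2 X -> mxCn I k.+1 (fun t => Lp t *m DF q X t).
    by move=> CX; apply: mxCnM => //; [exact: low|exact: CDF].
  apply: mxCnB => //; last by apply: mxCnM => //; [exact: CLDF|exact: low].
  apply: mxCnB => //; first exact: low.
  by apply: mxCnM => //; [exact: CLDF|exact: low].
have L12E t : t \in I -> L12 t *m E t = Lp t *m E t.
  by move=> tI; rewrite /L12 !mulmxBl -(mulmxA _ (L4 t)) -(mulmxA _ (L3 t)) L3E // L4E // !mulmx0 !subr0.
have L12J t : t \in I -> L12 t *m J t = 1%:M.
  move=> tI; rewrite /J -mul_mx_row mulmxA L12E // -mulmxA mul_mx_row -/(J t).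
  by rewrite linvK // rJ.
have L12K1 t : t \in I -> L12 t *m DF _ K1 t = 0.
  move=> tI; rewrite /L12 !mulmxBl -(mulmxA _ (L4 t)) -(mulmxA _ (L3 t)).
  by rewrite L3DF // L4DF // L3FK1 // L4FK1 // mulmx0 mulmx1 subr0 subrr.
have L12K3 t : t \in I -> L12 t *m DF _ K3 t = 0.
  move=> tI; rewrite /L12 !mulmxBl -(mulmxA _ (L4 t)) -(mulmxA _ (L3 t)).
  by rewrite L3DF // L4DF // L3FK3 // L4FK3 // mulmx0 mulmx1 subr0 subrr.
pose L1 t := usubmx (L12 t); pose L2 t := dsubmx (L12 t).
have CL1 : mxCn I k.+1 L1 by exact: mxCn_usubmx.
have CL2 : mxCn I k.+1 L2 by exact: mxCn_dsubmx.
have LK t : t \in I -> [/\ L1 t *m (E t *m K1 t) = 1%:M, L1 t *m (E t *m K2 t) = 0,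
    L2 t *m (E t *m K1 t) = 0 & L2 t *m (E t *m K2 t) = 1%:M].
  move=> /L12J; rewrite -[L12 t]vsubmxK mul_col_row scalar_mx_block => /eq_block_mx.
  by move=> [? ? ? ?].
have split0 q (X : 'M[R]_(N, q)) t : L12 t *m X = 0 -> L1 t *m X = 0 /\ L2 t *m X = 0.
  rewrite -[L12 t]vsubmxK mul_col_mx => /eqP; rewrite col_mx_eq0.
  by move=> /andP[/eqP ? /eqP ?].
have [t0 [_ [t0I _ _]]] := nd.
have CX : mxCn I k.+1 (fun t => - (L2 t *m DF _ K2 t)).
  by apply: mxCnN => //; apply: mxCnM => //; exact: CDF.
(* Scaling K2 by U and L2 by U^(-1) turns the (2,2) block X of F into U^(-1) (X U + U'), which is 0
   for U' = - X U. *)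
have [U [_ CU uU dU]] := linear_ode_unit nd t0I CX.
pose K2n t := K2 t *m U t.
have CK2n : mxCn I k.+2 K2n by exact: mxCnM.
have C1 p q (X : R -> 'M[R]_(p, q)) : mxCn I k.+2 X -> mxCn I 1 X.
  by move=> CX'; exact: mxCn_le CX'.
have DFK2n t : t \in I -> DF _ K2n t = DF _ K2 t *m U t + E t *m K2 t *m mxderive I U t.
  move=> tI; rewrite /DF /K2n mxderiveM //; do ?exact: C1.
  by rewrite mulmxDl mulmxDr !mulmxA addrA.
pose L2n t := invmx (U t) *m L2 t.
have CL2n : mxCn I k.+1 L2n by apply: mxCnM => //; apply: mxCnV => //; exact: low.
pose K t := cols4 (K1 t) (K2n t) (K3 t) (K4 t).
have CK : mxCn I k.+2 K by do ![apply: mxCn_row_mx => //].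
pose L t := rows4 (L1 t) (L2n t) (L3 t) (L4 t).
have CL : mxCn I k.+1 L.
  by do ![apply: mxCn_col_mx => //]; do ?[exact: low|exact: mxCn_cst].
pose F12 t := L1 t *m DF _ K2n t.
pose F14 t := L1 t *m DF _ K4 t.
pose F24 t := L2n t *m DF _ K4 t.
have dK t : t \in I -> F t *m K t + E t *m mxderive I K t =
    cols4 (DF _ K1 t) (DF _ K2n t) (DF _ K3 t) (DF _ K4 t).
  move=> tI; rewrite /K /cols4 !mxderive_row_mx //; do ?[apply: C1 => //];
    do ?[apply: mxCn_row_mx => //].
  by rewrite -!/(cols4 _ _ _ _) !mulmx_cols4 add_cols4.
have LFK t : t \in I -> L t *m F t *m K t + L t *m E t *m mxderive I K t =
    canonF a (F12 t) (F14 t) (F24 t).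
  move=> tI; rewrite -!mulmxA -mulmxDr dK //; apply: canonF_rows4_cols4.
  - have [l11 l21] := split0 _ _ _ (L12K1 t tI); have [l13 l23] := split0 _ _ _ (L12K3 t tI).
    split=> //; rewrite /L2n -mulmxA ?l21 ?l23 ?mulmx0 //.
    rewrite DFK2n // mulmxDr -[E t *m K2 t *m _]mulmxA dU //.
    have [_ _ _ l22] := LK t tI.
    rewrite mulNmx !mulmxN [E t *m _]mulmxA [L2 t *m (_ *m (_ *m U t))]mulmxA.
    rewrite [L2 t *m (DF d K2 t *m U t)]mulmxA.
    rewrite [L2 t *m (E t *m K2 t)]l22 mul1mx subrr mulmx0 //.
  - split; rewrite L3DF ?L3FK1 ?L3FK3 ?L3FK4 //.
    by rewrite /K2n [F t *m _]mulmxA mulmxA L3FK2 // mul0mx.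
  - split; rewrite L4DF ?L4FK1 ?L4FK3 ?L4FK4 //.
    by rewrite /K2n [F t *m _]mulmxA mulmxA L4FK2 // mul0mx.
have LEK t : t \in I -> L t *m E t *m K t = canonE d a 0 1%:M.
  move=> tI; rewrite -mulmxA /K mulmx_cols4 EK3 // EK4 //.
  have [l11 l12 l21 l22] := LK t tI; apply: canonE_rows4_cols4.
    rewrite /L2n /K2n; split=> //.
    - by rewrite [E t *m _]mulmxA mulmxA l12 mul0mx.
    - by rewrite -mulmxA l21 mulmx0.
    - by rewrite -mulmxA [E t *m _]mulmxA [L2 t *m _]mulmxA l22 mul1mx mulVmx // uU.
  by split; rewrite mulmxA ?L3E ?L4E ?mul0mx.
have uK t : t \in I -> K t \in unitmx.
  move=> tI; apply: square_unit => x.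
  rewrite -[x]vsubmxK -[dsubmx x]vsubmxK -[dsubmx (dsubmx x)]vsubmxK /K /cols4.
  rewrite !mul_row_col /K2n -[K2 t *m U t *m _]mulmxA => /Kinj -/(_ tI) [-> Ux -> ->].
  have -> : usubmx (dsubmx x) = 0.
    by rewrite -[LHS](mulKmx (uU t tI)) Ux mulmx0.
  by rewrite !col_mx0.
have uL t : t \in I -> L t \in unitmx.
  (* Rows 3 and 4 determine y modulo im E; on im E = im [E K1, E K2] rows 1 and 2 are coordinates up
     to the factor U^(-1). *)
  move=> tI; apply: square_unit => y; rewrite /L /rows4 !mul_col_mx mul0mx.
  move/eqP; rewrite !col_mx_eq0 => /and5P[/eqP y1 /eqP y2 /eqP y3 /eqP y4 _].
  have [VV VE] := HV t tI; have [ZZ ZE] := HZ t tI.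
  have Zy : (Z t)^T *m y = 0.
    have : (Z t)^T *m y \in kercol (V t)^T by rewrite mem_kercol mulmxA y4.
    rewrite (orthcompK VE) => /mem_imcol[v Hv].
    have v0 : v = 0 by rewrite -[v]mul1mx -(linvK (rM t tI)) -mulmxA -Hv mulmxA.
    by rewrite Hv v0 mulmx0.
  have : y \in kercol (Z t)^T by rewrite mem_kercol Zy.
  rewrite (orthcompK ZE).
  have <- : imcol (J t) = imcol (E t).
    apply: eq_dimv_sub; last by rewrite !dim_imcol rE // rJ.
    by apply/imcolP; exists (row_mx (K1 t) (K2 t)); rewrite mul_mx_row.
  move=> /mem_imcol[c Hc].
  have y12 : L12 t *m y = c by rewrite Hc mulmxA L12J // mul1mx.
  have y20 : L2 t *m y = 0.
    by rewrite -[LHS](mulKVmx (uU t tI)) [invmx _ *m _]mulmxA y2 mulmx0.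
  by rewrite Hc -y12 -[L12 t]vsubmxK mul_col_mx y1 y20 col_mx0 mulmx0.
exists (fun=> canonE d a 0 (0 : 'M[R]_s)), (fun t => canonF a (F12 t) (F14 t) (F24 t)).
split; last first.
- apply: (@mxCn_ext _ _ nd _ _ _ (fun t => L t *m (F t *m K t + E t *m mxderive I K t))).
    by move=> t tI; rewrite -LFK // mulmxDr !mulmxA.
  exact/mxCnM/CDF.
- exact: mxCn_cst.
exists L, K, (erefl N), F12, F14, F24; split.
- exact: (mxCn_le nd) CL.
- exact: C1.
- by move=> t tI; rewrite !castmx_id; split=> //; [split; [exact: uL|exact: uK]|exact: LEK|exact: LFK].
Qed.

End StrangenessLevel.

(** * Strangeness values, successor pairs and their chain *)

Section StrangenessChain.
Context {R : realType}.
Variable I : interval R.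
Hypothesis nd : nondegenerate_interval I.

(** theta is the number of rows of W^T Z^T F Tc, which are independent and have length r. *)
Lemma pre_regular_theta_le k n r theta (E F : R -> 'M[R]_n) :
  mxCn I k.+1 E -> mxCn I k.+1 F -> pre_regular I E F r theta -> (theta <= r)%N.
Proof.
move=> CE CF pr; have [t0 [_ [t0I _ _]]] := nd.
have thr := pre_regular_le t0I pr.
have [T [Tc [Z [W [_ _ H]]]]] := pair_frames nd CE CF pr.
have [_ _ _ _ [_ /eqP rW]] := H t0 t0I.
have le : (n - r - (n - r - theta) <= r)%N by rewrite -[X in (X <= _)%N]rW rank_leq_col.
lia.
Qed.

Lemma strangeness_valuesP k n r theta (E F : R -> 'M[R]_n) :
  mxCn I k.+1 E -> mxCn I k.+1 F -> pre_regular I E F r theta ->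
  strangeness_values I E F r (n - r - theta) theta (r - theta) 0.
Proof.
move=> CE CF pr; have [t0 [_ [t0I _ _]]] := nd.
have thr := pre_regular_le t0I pr.
split=> //; first by lia.
have [T [Tc [Z [W [[CT CTc] [CZ CW] H]]]]] := pair_frames nd CE CF pr.
have thE : (n - r - (n - r - theta))%N = theta by lia.
exists T, Tc, Z, W; split.
- by apply: onb_fun CT _ => // t /H[].
- by apply: onb_fun CTc _ => // t /H[].
- by apply: onb_fun CZ _ => // t /H[].
- by apply: onb_fun CW _ => // t /H[].
move=> t tI; have [_ _ _ _ [rM /eqP free]] := H t tI; have [_ rE _] := pr t tI; split=> //.
exact: etrans free thE.
Qed.

Lemma strangeness_level k n r theta (E F : R -> 'M[R]_n) :
  mxCn I k.+2 E -> mxCn I k.+2 F -> pre_regular I E F r theta ->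
  exists E1 F1 : R -> 'M[R]_n,
    [/\ strangeness_step I E F (n - r - theta) theta (r - theta) 0 E1 F1,
        mxCn I k.+1 E1 & mxCn I k.+1 F1].
Proof.
move=> CE CF pr; have [t0 [_ [t0I _ _]]] := nd.
have thr := pre_regular_le t0I pr.
have thr' := pre_regular_theta_le CE CF pr.
have e : (theta + ((r - theta) + ((n - r - theta) + (theta + 0))))%N = n by lia.
have e' : (theta + (r - theta))%N = r by lia.
move: (r - theta)%N (n - r - theta)%N e e' => d a e e'.
subst n r; exact: strangeness_block.
Qed.

(** An identity block of size 0 is also the zero block, so the successor is already canonical and L
    = K = 1 reproduces it. This continues the iteration beyond the last genuine level. *)
Lemma strangeness_step_fix n (E F : R -> 'M[R]_n) a s d E1 F1 : s = 0%N ->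
  strangeness_step I E F a s d 0 E1 F1 -> strangeness_step I E1 F1 a s d 0 E1 F1.
Proof.
move=> s0 [L [K [e [F12 [F14 [F24 [CL CK H]]]]]]].
exists (fun=> 1%:M), (fun=> 1%:M), e, F12, F14, F24; split; [exact: mxCn_cst|exact: mxCn_cst|].
move=> t tI; have [_ _ _ E1t F1t] := H t tI.
rewrite mxderive_cst // mulmx0 addr0 !mul1mx !mulmx1 unitmx1; split=> //.
rewrite E1t; congr castmx; congr canonE.
by subst s; apply/matrixP => -[].
Qed.

Lemma strangeness_step_equiv n (E F : R -> 'M[R]_n) a s d E1 F1 : s = 0%N ->
  strangeness_step I E F a s d 0 E1 F1 -> equiv_pair I E F E1 F1.
Proof.
move=> s0 [L [K [e [F12 [F14 [F24 [CL CK H]]]]]]].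
exists L, K; split=> // t tI; have [[uL uK] Et Ft E1t F1t] := H t tI; split=> //.
  rewrite E1t Et; congr castmx; congr canonE.
  by subst s; apply/matrixP => -[].
by rewrite F1t Ft.
Qed.

Section Extension.
Variables (n p q : nat) (Jl Jr : 'M[R]_(n, p)) (Hl Hr : 'M[R]_(n, q)).
Hypothesis Jl_props : [/\ Jl^T *m Jl = 1%:M, Jl *m Jl^T + Hl *m Hl^T = 1%:M,
  Hl^T *m Hl = 1%:M & Jl^T *m Hl = 0].
Hypothesis Jr_props : [/\ Jr^T *m Jr = 1%:M, Jr *m Jr^T + Hr *m Hr^T = 1%:M,
  Hr^T *m Hr = 1%:M & Jr^T *m Hr = 0].
Variables (E F : R -> 'M[R]_p) (E1 F1 : R -> 'M[R]_n).
Hypothesis EF1 : forall t, t \in I ->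
  E1 t = Jl *m E t *m Jr^T /\ F1 t = Jl *m F t *m Jr^T + Hl *m Hr^T.

(* Bordering a pair by 0 in E and by an identity in F changes neither its
   characteristics nor its reduction. *)
Lemma reg_extend r theta k i : reg I r theta k.+1 i E F -> reg I r theta k.+1 i E1 F1.
Proof.
case: Jl_props => JJl sl HHl JHl; case: Jr_props => JJr sr HHr JHr.
have HJl : Hl^T *m Jl = 0 by apply: trmx_inj; rewrite trmx_mul trmxK JHl trmx0.
have HJr : Hr^T *m Jr = 0 by apply: trmx_inj; rewrite trmx_mul trmxK JHr trmx0.
have E1J t x : t \in I -> E1 t *m (Jr *m x : 'cV_n) = Jl *m (E t *m x).
  by move=> tI; rewrite (EF1 tI).1 -!mulmxA [Jr^T *m _]mulmxA JJr mul1mx.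
have F1J t x : t \in I -> F1 t *m (Jr *m x : 'cV_n) = Jl *m (F t *m x).
  move=> tI; rewrite (EF1 tI).2 mulmxDl -!mulmxA [Jr^T *m _]mulmxA JJr mul1mx.
  by rewrite [Hr^T *m _]mulmxA HJr mul0mx mulmx0 addr0.
have F1H t x : t \in I -> F1 t *m (Hr *m x : 'cV_n) = Hl *m x.
  move=> tI; rewrite (EF1 tI).2 mulmxDl -!mulmxA [Jr^T *m _]mulmxA JHr mul0mx !mulmx0 add0r.
  by rewrite [Hr^T *m _]mulmxA HHr mul1mx.
have E1H t x : t \in I -> E1 t *m (Hr *m x : 'cV_n) = 0.
  by move=> tI; rewrite (EF1 tI).1 -!mulmxA [Jr^T *m _]mulmxA JHr mul0mx !mulmx0.
have decr (z : 'cV_n) : z = Jr *m (Jr^T *m z) + Hr *m (Hr^T *m z).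
  by rewrite !mulmxA -mulmxDl sr mul1mx.
have decl (z : 'cV_n) : z = Jl *m (Jl^T *m z) + Hl *m (Hl^T *m z).
  by rewrite !mulmxA -mulmxDl sl mul1mx.
have Jlinj (x y : 'cV_p) : Jl *m x = Jl *m y -> x = y.
  by move=> /(congr1 (mulmx Jl^T)); rewrite !mulmxA JJl !mul1mx.
have imE1 t y : t \in I -> y \in imcol (E1 t) <-> exists2 x, x \in imcol (E t) & y = Jl *m x.
  move=> tI; split=> [/mem_imcol[z ->]|[_ /mem_imcol[x ->] ->]].
    exists (E t *m (Jr^T *m z)); first exact: mem_imcol_mul.
    by rewrite {1}[z]decr mulmxDr E1J // E1H // addr0.
  by apply/mem_imcol; exists (Jr *m x); rewrite E1J.
have S1 t y : t \in I -> y \in preimcol (F1 t) (imcol (E1 t)) <->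
    exists2 x, x \in preimcol (F t) (imcol (E t)) & y = Jr *m x.
  move=> tI; rewrite mem_preimcol; split=> [/(imE1 _ _ tI)[x xE Fy]|[x Sx ->]].
    move: Fy; rewrite {1}[y]decr mulmxDr F1J // F1H // => Fy.
    have Hy : Hr^T *m y = 0.
      have := congr1 (mulmx Hl^T) Fy.
      by rewrite mulmxDr !mulmxA HJl HHl !mul0mx add0r mul1mx.
    exists (Jr^T *m y); last by rewrite {1}[y]decr Hy mulmx0 addr0.
    move: Fy; rewrite Hy mulmx0 addr0 => /Jlinj Fy.
    by rewrite mem_preimcol Fy.
  by apply/(imE1 _ _ tI); exists (F t *m x); [rewrite -mem_preimcol|rewrite F1J].
move=> [pr [Y [C [E2 [F2 [[[CY HY] [CC HC] H2] regk]]]]]]; split.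
  move=> t tI; have [full rE dNS] := pr t tI; split.
  - apply/eq_fullv => y.
    have /eq_fullv/(_ (Jl^T *m y))/mem_imcol_row[a [b ab]] := full.
    apply/mem_imcol_row; exists (Jr *m a), (Jr *m b + Hr *m (Hl^T *m y)).
    by rewrite mulmxDr E1J // F1J // F1H // addrA -mulmxDr -ab -decl.
  - rewrite -rE -!dim_imcol; apply: (@dim_inj_image _ _ _ Jl) => [x _ Jx|y].
      by rewrite -[x]mul1mx -JJl -mulmxA Jx mulmx0.
    exact: imE1.
  - rewrite -dNS; apply: (@dim_inj_image _ _ _ Jr) => [x _ Jx|y].
      by rewrite -[x]mul1mx -JJr -mulmxA Jx mulmx0.
    rewrite memv_cap mem_kercol; split.
      move=> /andP[Ey /(S1 _ _ tI)[x Sx yE]]; exists x => //; rewrite memv_cap Sx andbT.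
      move: Ey; rewrite yE E1J // mem_kercol => /eqP Ex; apply/eqP/Jlinj.
      by rewrite Ex mulmx0.
    move=> [x]; rewrite memv_cap mem_kercol => /andP[/eqP Ex Sx] ->.
    by rewrite E1J // Ex mulmx0 eqxx; apply/(S1 _ _ tI); exists x.
exists (fun t => Jl *m Y t), (fun t => Jr *m C t), E2, F2; split=> //; split.
- split; first by apply: mxCnM => //; exact: mxCn_cst.
  move=> t tI; have /is_basisP[YE rY] := HY t tI; apply/is_basisP; split.
    apply/vspaceP => y; apply/idP/idP => [/mem_imcol[x ->]|/(imE1 _ _ tI)[x]].
      by apply/(imE1 _ _ tI); exists (Y t *m x); rewrite ?mulmxA // -YE mem_imcol_mul.
    by rewrite -YE => /mem_imcol[z ->] ->; apply/mem_imcol; exists z; rewrite mulmxA.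
  apply/full_col_inj => x; rewrite -mulmxA -(mulmx0 _ Jl) => /Jlinj.
  by apply: (col_inj rY).
- split; first by apply: mxCnM => //; exact: mxCn_cst.
  move=> t tI; have /is_basisP[CS rC] := HC t tI; apply/is_basisP; split.
    apply/vspaceP => y; apply/idP/idP => [/mem_imcol[x ->]|/(S1 _ _ tI)[x]].
      by apply/(S1 _ _ tI); exists (C t *m x); rewrite ?mulmxA // -CS mem_imcol_mul.
    by rewrite -CS => /mem_imcol[z ->] ->; apply/mem_imcol; exists z; rewrite mulmxA.
  apply/full_col_inj => x; rewrite -mulmxA => Jx.
  apply: (col_inj rC).
  by rewrite -[C t *m x]mul1mx -JJr -mulmxA Jx mulmx0.
- move=> t tI; have [-> ->] := H2 t tI; rewrite mxderiveM //; last exact: mxCn_cst.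
  rewrite mxderive_cst // mul0mx add0r (EF1 tI).1 (EF1 tI).2 trmx_mul.
  have -> : Jl *m E t *m Jr^T *m (Jr *m mxderive I C t) = Jl *m (E t *m mxderive I C t).
    by rewrite -!mulmxA [Jr^T *m _]mulmxA JJr mul1mx.
  have -> : (Jl *m F t *m Jr^T + Hl *m Hr^T) *m (Jr *m C t) = Jl *m (F t *m C t).
    rewrite mulmxDl -!mulmxA [Jr^T *m _]mulmxA JJr mul1mx.
    by rewrite [Hr^T *m _]mulmxA HJr mul0mx mulmx0 addr0.
  have YJ q' (X : 'M[R]_(p, q')) : (Y t)^T *m Jl^T *m (Jl *m X) = (Y t)^T *m X.
    by rewrite -!mulmxA [Jl^T *m _]mulmxA JJl mul1mx.
  split; last by rewrite -mulmxDr YJ.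
  by rewrite -[Jl *m _ *m _]mulmxA YJ !mulmxA -[_ *m Jr^T *m Jr]mulmxA JJr mulmx1.
Qed.

End Extension.

(** For the canonical pair the selectors are constant bases of im E and of S. The term E C'
    vanishes, so the reduced pair is cut out of the canonical matrices, and [reg_extend] applies to
    the successor. *)
Lemma strangeness_reg r theta k i n (E F : R -> 'M[R]_n) a s d E1 F1 : (s + d)%N = r i ->
  reg I r theta k.+2 i E F -> strangeness_step I E F a s d 0 E1 F1 ->
  reg I r theta k.+1 i.+1 E1 F1.
Proof.
move=> sd regE [L [K [e [F12 [F14 [F24 [CL CK H]]]]]]]; subst n.
pose Et (t : R) := @canonE R s d a 0 1%:M; pose Ft t := canonF a (F12 t) (F14 t) (F24 t).
have eqv : equiv_pair I E F Et Ft.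
  exists L, K; split=> // t tI; have [[uL uK] EK FK _ _] := H t tI.
  by rewrite EK FK !castmx_id.
have regt : reg I r theta k.+2 i Et Ft by apply: reg_equiv regE eqv _ => //; rewrite /Et; exact: mxCn_cst.
have [Jl [Jr [Hl [Hr]]]] : exists (Jl Jr : 'M[R]_(_, r i)) (Hl Hr : 'M[R]_(_, a + s)),
  [/\ Jl^T *m Jl = 1%:M, Jl *m Jl^T + Hl *m Hl^T = 1%:M, Hl^T *m Hl = 1%:M & Jl^T *m Hl = 0] /\
  [/\ Jr^T *m Jr = 1%:M, Jr *m Jr^T + Hr *m Hr^T = 1%:M, Hr^T *m Hr = 1%:M & Jr^T *m Hr = 0] /\
  forall F12 F14 F24, let F := @canonF R s d a 0 F12 F14 F24 in
  let E := @canonE R s d a 0 1%:M in let E1 := @canonE R s d a 0 0 in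
  [/\ Hl^T *m F = Hr^T, Jl^T *m F *m Hr = 0, Hl^T *m E = 0, exists B, Jl = E *m B
    & Hl^T *m E1 = 0 /\ Jl^T *m E1 = Jl^T *m E *m Jr *m Jr^T].
  by case: _ / sd; exact: canon_selectors.
move=> [Jlp [Jrp sel]].
case: (Jlp) => JJl sl HHl JHl; case: (Jrp) => JJr sr HHr JHr.
have HJr : Hr^T *m Jr = 0 by apply: trmx_inj; rewrite trmx_mul trmxK JHr trmx0.
have HJl : Hl^T *m Jl = 0 by apply: trmx_inj; rewrite trmx_mul trmxK JHl trmx0.
pose E2 t := Jl^T *m Et t *m Jr; pose F2 t := Jl^T *m Ft t *m Jr.
have imJl t : imcol Jl = imcol (Et t).
  have [_ _ HE [B JB] _] := sel (F12 t) (F14 t) (F24 t).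
  apply/eqP; rewrite eqEsubv; apply/andP; split; apply/imcolP; first by exists B.
  exists (Jl^T *m Et t); rewrite -[LHS]mul1mx -sl mulmxDl -[Hl *m _ *m _]mulmxA HE mulmx0 addr0.
  by rewrite mulmxA.
have red : reduction I Et Ft (fun=> Jl) (fun=> Jr) E2 F2.
  split.
  - split; first exact: mxCn_cst.
    by move=> t tI; apply: onb_basis JJl (imJl t).
  - split; first exact: mxCn_cst.
    move=> t tI; apply: onb_basis JJr _; have [HF _ _ _ _] := sel (F12 t) (F14 t) (F24 t).
    apply/vspaceP => z; rewrite mem_preimcol -(imJl t).
    apply/mem_imcol/mem_imcol => [[x ->]|[x Fz]].
      exists (Jl^T *m (Ft t *m (Jr *m x))).
      rewrite -[LHS]mul1mx -sl mulmxDl -[Hl *m _ *m _]mulmxA [Hl^T *m _]mulmxA HF.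
      by rewrite [Hr^T *m _]mulmxA HJr mul0mx mulmx0 addr0 !mulmxA.
    exists (Jr^T *m z); rewrite -[LHS]mul1mx -sr mulmxDl -[Hr *m _ *m _]mulmxA -HF -[Hl^T *m _ *m z]mulmxA.
    by rewrite Fz [Hl^T *m _]mulmxA HJl mul0mx mulmx0 addr0 mulmxA.
  - by move=> t tI; rewrite mxderive_cst // mulmx0 addr0 mulmxA.
have reg2 : reg I r theta k.+1 i.+1 E2 F2.
  by apply: reg_reduction regt red _ => //; rewrite /E2 /Et; exact: mxCn_cst.
apply: (reg_extend Jlp Jrp _ reg2) => t tI.
have [_ _ _ -> ->] := H t tI; rewrite !castmx_id.
have [HF JF HE [B JB] [HE1 JE1]] := sel (F12 t) (F14 t) (F24 t); split.
  rewrite -[LHS]mul1mx -sl mulmxDl -[Hl *m _ *m _]mulmxA HE1 mulmx0 addr0.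
  by rewrite -mulmxA JE1 /E2 !mulmxA.
rewrite -[LHS]mul1mx -sl mulmxDl -[Hl *m _ *m _]mulmxA HF; congr (_ + _).
rewrite -mulmxA -[Jl^T *m _]mulmx1 -sr mulmxDr [Jl^T *m _ *m (Hr *m _)]mulmxA JF mul0mx addr0.
by rewrite /F2 !mulmxA.
Qed.

(** The rank of E_(j+1) is read off twice, from pre-regularity at level j + 1 and from the reduction
    at level j. *)
Lemma reg_rank r theta k n (E F : R -> 'M[R]_n) : reg I r theta k 0 E F ->
  forall j, (j.+1 < k)%N -> (r j.+1 + theta j)%N = r j.
Proof.
have [t0 [_ [t0I _ _]]] := nd.
elim: k n r theta E F => // k IHk n r theta E F [pr [Y [C [E1 [F1 [red /reg_shift reg1]]]]]] [|j] jk.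
  case: k IHk jk reg1 => // k _ _ [pr1 _].
  by have [_ <- _] := pr1 t0 t0I; exact: reduction_rank pr red _ t0I.
exact: IHk reg1 j jk.
Qed.

Lemma strangeness_chain k n r theta (E F : R -> 'M[R]_n) :
  reg I r theta k.+1 0 E F -> mxCn I k.+2 E -> mxCn I k.+2 F -> theta k = 0%N ->
  exists E_ F_ : nat -> R -> 'M[R]_n,
    [/\ E_ 0%N = E, F_ 0%N = F & forall i, let j := minn i k in
      strangeness_values I (E_ i) (F_ i) (r j) (n - r j - theta j) (theta j) (r j - theta j) 0 /\
      strangeness_step I (E_ i) (F_ i) (n - r j - theta j) (theta j) (r j - theta j) 0
                       (E_ i.+1) (F_ i.+1)].
Proof.
elim: k r theta E F => [|k IHk] r theta E F regE CE CF th0; have [pr _] := regE;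
  have [E1 [F1 [step CE1 CF1]]] := strangeness_level CE CF pr.
  (* At the last level the successor is equivalent to the pair and so has the same values; from
     there on the chain is constant, which is why indices are cut off by [minn i k]. *)
  have eqv := strangeness_step_equiv th0 step.
  have pr1 := pre_regular_equiv pr eqv.
  exists (fun i => if i is 0%N then E else E1), (fun i => if i is 0%N then F else F1).
  split=> // i; rewrite minn0; case: i => [|i] /=; split=> //.
  - exact: strangeness_valuesP CE CF pr.
  - exact: strangeness_valuesP CE1 CF1 pr1.
  - exact: strangeness_step_fix step.
have thr := pre_regular_theta_le CE CF pr.
have /reg_shift reg1 := strangeness_reg (subnKC thr) regE step.
have [E_ [F_ [E0 F0 st]]] := IHk _ _ _ _ reg1 CE1 CF1 th0.
exists (fun i => if i is j.+1 then E_ j else E), (fun i => if i is j.+1 then F_ j else F).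
split=> // -[|i] /=.
  by rewrite min0n E0 F0; split=> //; exact: strangeness_valuesP CE CF pr.
by rewrite minnSS; exact: st.
Qed.

End StrangenessChain.

(** * Wong sequence *)

Section Wong.
Context {R : realType}.
Variable I : interval R.
Hypothesis nd : nondegenerate_interval I.

Definition dae n q (E F : R -> 'M[R]_n) (X : R -> 'M[R]_(n, q)) t : 'M[R]_(n, q) :=
  F t *m X t + E t *m mxderive I X t.

(* The values at t of F x + E x', for x a C^1 section of the bundle im K. *)
Definition dae_im n q (E F : R -> 'M[R]_n) (K : R -> 'M[R]_(n, q)) t : 'M[R]_(n, q + q) :=
  row_mx (E t *m K t) (dae E F K t).

Lemma dae_mul n q p (E F : R -> 'M[R]_n) (K : R -> 'M[R]_(n, q)) (X : R -> 'M[R]_(q, p))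
    (Y : R -> 'M[R]_(n, p)) t : t \in I -> mxCn I 1 K -> mxCn I 1 X ->
  (forall t, t \in I -> Y t = K t *m X t) ->
  dae E F Y t = dae E F K t *m X t + E t *m K t *m mxderive I X t.
Proof.
move=> tI CK CX YE; rewrite /dae.
have -> : mxderive I Y t = mxderive I (fun t => K t *m X t) t.
  symmetry; apply: mxderive_ext => //; last exact: mxCnM.
  by move=> s sI; rewrite YE.
by rewrite mxderiveM // YE // mulmxDl mulmxDr !mulmxA addrA.
Qed.

Lemma factor_through n q p (K : R -> 'M[R]_(n, q)) (Y : R -> 'M[R]_(n, p)) k :
  mxCn I k K -> mxCn I k Y -> (forall t, t \in I -> \rank (K t) = q) ->
  (forall t, t \in I -> (imcol (Y t) <= imcol (K t))%VS) ->
  exists X : R -> 'M[R]_(q, p), mxCn I k X /\ forall t, t \in I -> Y t = K t *m X t.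
Proof.
move=> CK CY rK YK; exists (fun t => linv (K t) *m Y t); split.
  by apply: mxCnM => //; exact: mxCn_linv.
by move=> t tI; have /imcolP[Z ->] := YK t tI; rewrite [linv _ *m _]mulmxA linvK ?mul1mx // rK.
Qed.

(** For Y = K X the product rule gives (dae K) X + E K X', both terms lying in the larger image. In
    particular the image of [dae_im] depends on the bundle im K only, not on its frame. *)
Lemma dae_im_mono n q p (E F : R -> 'M[R]_n) (K : R -> 'M[R]_(n, q)) (Y : R -> 'M[R]_(n, p)) :
  mxCn I 1 K -> mxCn I 1 Y -> (forall t, t \in I -> \rank (K t) = q) ->
  (forall t, t \in I -> (imcol (Y t) <= imcol (K t))%VS) ->
  forall t, t \in I -> (imcol (dae_im E F Y t) <= imcol (dae_im E F K t))%VS.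
Proof.
move=> CK CY rK YK t tI; have [X [CX YE]] := factor_through CK CY rK YK.
apply/subvP => y /mem_imcol_row[c1 [c2 ->]]; apply/mem_imcol_row.
exists (X t *m c1 + mxderive I X t *m c2), (X t *m c2).
by rewrite (dae_mul E F tI CK CX YE) YE // mulmxDl mulmxDr !mulmxA addrA addrAC.
Qed.

(** [K i] is a frame of K_i. With L_i the image of [dae_im] for [K i], the last two fields say that
    dim L_i = dim K_i and that im E + L_i has codimension theta_i; these are the two counts that
    later fix the rank of G_(i+1). *)
Definition wong j n (E F : R -> 'M[R]_n) (theta k : nat -> nat)
    (K : forall i, R -> 'M[R]_(n, k i)) : Prop :=
  [/\ forall i, mxCn I j (K i), forall i, k i.+1 = (k i + theta i)%N
    & forall t, t \in I ->
      [/\ imcol (K 0%N t) = kercol (E t), forall i, \rank (K i t) = k i,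
          forall i, imcol (K i.+1 t) = preimcol (E t) (imcol (dae_im E F (K i) t)),
          forall i, \rank (dae_im E F (K i) t) = k i
        & forall i, (\dim (imcol (E t) + imcol (dae_im E F (K i) t)) + theta i)%N = n]].

Lemma wong_mono j n (E F : R -> 'M[R]_n) theta k K : wong j.+1 E F theta K ->
  forall i t, t \in I -> (imcol (K i t) <= imcol (K i.+1 t))%VS /\
    (imcol (dae_im E F (K i : R -> 'M[R]_(n, k i)) t) <= imcol (dae_im E F (K i.+1) t))%VS.
Proof.
move=> [CK _ H]; have CK1 i : mxCn I 1 (K i) by apply: (mxCn_le nd) (CK i).
have rK i t : t \in I -> \rank (K i t) = k i by move=> /H[].
have imp i : (forall t, t \in I -> (imcol (K i t) <= imcol (K i.+1 t))%VS) ->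
    forall t, t \in I -> (imcol (dae_im E F (K i) t) <= imcol (dae_im E F (K i.+1) t))%VS.
  by move=> Hi; apply: dae_im_mono => // t; exact: rK.
have sub i : forall t, t \in I -> (imcol (K i t) <= imcol (K i.+1 t))%VS.
  elim: i => [|i IHi] t tI; have [K0 _ KS _ _] := H t tI; rewrite KS.
    rewrite K0; apply/subvP => x; rewrite mem_kercol mem_preimcol => /eqP ->.
    exact: mem0v.
  rewrite KS; apply/subvP => x; rewrite !mem_preimcol.
  by apply: subvP; exact: imp.
by move=> i t tI; split; [exact: sub | exact: imp (sub i) _ _].
Qed.

(** Z^T has kernel im E, so rank(Z^T U) measures im U modulo im E. *)
Lemma dim_add_imE n q (E : 'M[R]_n) (U : 'M[R]_(n, q)) z (Z : 'M[R]_(n, z)) :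
  imcol Z = orthcomp (imcol E) ->
  \dim (imcol E + imcol U) = (\rank E + \rank (Z^T *m U))%N /\
  (\dim (imcol U :&: imcol E) + \rank (Z^T *m U))%N = \rank U.
Proof.
move=> ZE.
pose f := linfun (mulmx Z^T : 'cV[R]_n -> 'cV[R]_z).
have kf : lker f = imcol E by rewrite -(orthcompK ZE).
have fU : (f @: imcol U)%VS = imcol (Z^T *m U).
  apply/vspaceP => y; apply/memv_imgP/mem_imcol => [[_ /mem_imcol[x ->] ->]|[x ->]].
    by exists x; rewrite lfunE /= mulmxA.
  by exists (U *m x); rewrite ?mem_imcol_mul // lfunE /= mulmxA.
split; last by rewrite -dim_imcol -fU -kf limg_ker_dim dim_imcol.
rewrite -[LHS](limg_ker_dim f) limgD fU kf.
have -> : (f @: imcol E)%VS = 0%VS by apply/eqP; rewrite -lkerE kf.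
rewrite add0v dim_imcol; congr (_ + _)%N.
by rewrite (capv_idPr (addvSl _ _)) dim_imcol.
Qed.

(** Lifting the sequence of the reduced pair: K_(i+1) is taken to be all x with Y^T E x in L_i of
    the reduced pair. The frame involves derivatives of the frame below, hence the drop in
    smoothness. *)
Lemma wong_step j n r theta (E F : R -> 'M[R]_n) Y C (E1 F1 : R -> 'M[R]_r) k1
    (K1 : forall i, R -> 'M[R]_(r, k1 i)) :
  mxCn I j.+1 E -> mxCn I j.+1 E1 -> mxCn I j.+1 F1 -> mxCn I j.+1 Y -> mxCn I j.+1 C ->
  pre_regular I E F r (theta 0%N) -> reduction I E F Y C E1 F1 ->
  (forall t, t \in I -> (k1 0%N + \rank (E1 t))%N = r) ->
  wong j.+2 E1 F1 (fun i => theta i.+1) K1 ->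
  exists k (K : forall i, R -> 'M[R]_(n, k i)), wong j.+1 E F theta K /\
    forall t, t \in I -> (k 0%N + \rank (E t))%N = n.
Proof.
move=> CE CE1 CF1 CY CC pr red k10 W1; have [t0 [_ [t0I _ _]]] := nd.
have [CK1 k1S HW1] := W1.
have thr := pre_regular_le t0I pr.
have rE t : t \in I -> \rank (E t) = r by case/pr.
have nr : ((n - r) + r)%N = n by lia.
have [T [CT HT]] := ker_frame nd CE rE nr.
have [Z [CZ HZ]] := orth_frame nd CE rE nr.
have [[CY1 HY] [CC1 HC] H1] := red.
have YE t : t \in I -> imcol (Y t) = imcol (E t).
  by move=> tI; have /is_basisP[] := HY t tI.
have rY t : t \in I -> \rank (Y t) = r.
  by move=> tI; have /is_basisP[] := HY t tI.
have CS t : t \in I -> imcol (C t) = preimcol (F t) (imcol (E t)).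
  by move=> tI; have /is_basisP[] := HC t tI.
have rC t : t \in I -> \rank (C t) = r.
  by move=> tI; have /is_basisP[] := HC t tI.
have Yinj t (y : 'cV_n) : t \in I -> y \in imcol (E t) -> (Y t)^T *m y = 0 -> y = 0.
  move=> tI; rewrite -YE // => /mem_imcol[x ->]; rewrite mulmxA; exact: gram_ker.
pose X t := linv ((Y t)^T *m E t)^T.
have CYE : mxCn I j.+1 (fun t => ((Y t)^T *m E t)^T).
  by apply: mxCnT => //; apply: mxCnM => //; exact: mxCnT.
have rYE t : t \in I -> \rank ((Y t)^T *m E t)^T = r.
  by move=> tI; rewrite mxrank_tr; apply: rank_basisT_mul; [exact: YE|exact: rY].
have YEX t : t \in I -> (Y t)^T *m E t *m (X t)^T = 1%:M.
  by move=> tI; apply: trmx_inj; rewrite trmx_mul trmxK trmx1 linvK // rYE.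
have YEXm q t (b : 'M[R]_(r, q)) : t \in I -> (Y t)^T *m (E t *m ((X t)^T *m b)) = b.
  by move=> tI; rewrite !mulmxA YEX // mul1mx.
have CX : mxCn I j.+1 (fun t => (X t)^T) by apply: mxCnT => //; exact: mxCn_linv.
have rL1 i t : t \in I -> \rank (dae_im E1 F1 (K1 i) t) = k1 i by move=> /HW1[].
have CL1 i : mxCn I j.+1 (dae_im E1 F1 (K1 i)).
  have CK1' : mxCn I j.+1 (K1 i) by apply: (mxCn_le nd) (CK1 i).
  have CdK : mxCn I j.+1 (mxderive I (K1 i)) by exact: mxCn_mxderive.
  by apply: mxCn_row_mx; [|apply: mxCnD => //]; exact: mxCnM.
have Bex i := im_frame nd (CL1 i) (rL1 i).
pose B i := projT1 (cid (Bex i)).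
have CB i : mxCn I j.+1 (B i) by have [] := projT2 (cid (Bex i)).
have HB i t : t \in I -> (B i t)^T *m B i t = 1%:M /\ imcol (B i t) = imcol (dae_im E1 F1 (K1 i) t).
  by have [_] := projT2 (cid (Bex i)); apply.
pose k i := if i is i'.+1 then ((n - r) + k1 i')%N else (n - r)%N.
(* A basis T of ker E together with lifts of a frame of the reduced L_i; X^T is a right inverse of
   Y^T E. *)
pose K i := match i return R -> 'M[R]_(n, k i) with
  | 0%N => T | i'.+1 => fun t => row_mx (T t) ((X t)^T *m B i' t) end.
have CK i : mxCn I j.+1 (K i) by case: i => //= i; apply: mxCn_row_mx => //; exact: mxCnM.
have TE t : t \in I -> imcol (T t) = kercol (E t) by move=> /HT[].
have imK0 t : t \in I -> imcol (K 0%N t) = kercol (E t) by exact: TE.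
have memK i t (x : 'cV_n) : t \in I -> x \in imcol (K i.+1 t) <->
    (Y t)^T *m (E t *m x) \in imcol (dae_im E1 F1 (K1 i) t).
  move=> tI; have [_ <-] := HB i t tI; split.
    move=> /mem_imcol_row[a [b ->]].
    have -> : E t *m (T t *m a + (X t)^T *m B i t *m b) = E t *m ((X t)^T *m (B i t *m b)).
      by rewrite mulmxDr mulmxA (kercol_mul0 (_ : (imcol (T t) <= _)%VS)) ?TE // mul0mx add0r !mulmxA.
    rewrite YEXm //; exact: mem_imcol_mul.
  move=> /mem_imcol[b Hb]; apply/mem_imcol_row.
  have : x - (X t)^T *m (B i t *m b) \in imcol (T t).
    rewrite TE // mem_kercol; apply/eqP; apply: (Yinj t) => //; first exact: mem_imcol_mul.
    by rewrite mulmxBr mulmxBr Hb YEXm // subrr.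
  move=> /mem_imcol[a Ha]; exists a, b.
  by rewrite -Ha -mulmxA subrK.
have rK i t : t \in I -> \rank (K i t) = k i.
  move=> tI; have [TT _] := HT t tI; case: i => [|i]; first exact: orthonormal_rank.
  have [BB _] := HB i t tI.
  apply/full_col_inj => x; rewrite -[x]vsubmxK mul_row_col => Hx.
  have b0 : dsubmx x = 0.
    have := congr1 (fun v => (Y t)^T *m (E t *m v)) Hx.
    rewrite /= mulmxDr [E t *m (T t *m _)]mulmxA (kercol_mul0 (_ : (imcol (T t) <= _)%VS)) ?TE //.
    rewrite mul0mx add0r -mulmxA YEXm // !mulmx0 => Bx.
    by rewrite -[dsubmx x]mul1mx -BB -mulmxA Bx mulmx0.
  move: Hx; rewrite b0 mulmx0 addr0 => Tx.
  by rewrite -[usubmx x]mul1mx -TT -mulmxA Tx mulmx0 col_mx0.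
(* The intersection of K_i with S is the image under C of the i-th space of the reduced pair. *)
have CtoK i t (w : 'cV_r) : t \in I -> C t *m w \in imcol (K i t) <-> w \in imcol (K1 i t).
  move=> tI; have [K10 _ K1S _ _] := HW1 t tI; have [E1t _] := H1 t tI.
  case: i => [|i].
    rewrite imK0 // K10 !mem_kercol E1t -!mulmxA; split=> /eqP H.
      by rewrite H mulmx0.
    by apply/eqP; apply: (Yinj t) => //; exact: mem_imcol_mul.
  by rewrite memK // K1S mem_preimcol E1t !mulmxA.
have CK11 i : mxCn I 1 (K1 i) by apply: (mxCn_le nd) (CK1 i).
have Ki1 i : mxCn I 1 (K i) by apply: (mxCn_le nd) (CK i).
have CCK i : mxCn I 1 (fun t => C t *m K1 i t) by exact: mxCnM.
have CKsub i t : t \in I -> (imcol (C t *m K1 i t) <= imcol (K i t))%VS.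
  move=> tI; apply/subvP => _ /mem_imcol[x ->]; rewrite -mulmxA.
  by apply/CtoK => //; exact: mem_imcol_mul.
have daeCK i t : t \in I -> dae E F (fun t => C t *m K1 i t) t =
     (F t *m C t + E t *m mxderive I C t) *m K1 i t + E t *m C t *m mxderive I (K1 i) t.
  by move=> tI; apply: dae_mul.
have YdaeCK i t : t \in I -> (Y t)^T *m dae E F (fun t => C t *m K1 i t) t = dae E1 F1 (K1 i) t.
  move=> tI; rewrite daeCK // mulmxDr !mulmxA; have [E1t F1t] := H1 t tI.
  by rewrite /dae E1t F1t.
have Kmono i t : t \in I -> (imcol (K i t) <= imcol (K i.+1 t))%VS.
  move=> tI; apply/subvP => x; case: i => [|i].
    rewrite imK0 // mem_kercol => /eqP Ex.
    by apply/memK => //; rewrite Ex mulmx0 mem0v.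
  move=> /(memK _ _ _ tI) H; apply/memK => //; move: H; apply: subvP.
  by have [] := wong_mono W1 i tI.
(* Within im E, L_i corresponds under Y^T to the reduced L_i. If E x = E K c1 + (dae K) c2, then F K
   c2 lies in im E, so K c2 lies in S and comes from the reduced sequence; the product rule compares
   the two derivative terms. *)
have main i t (x : 'cV_n) : t \in I -> E t *m x \in imcol (dae_im E F (K i) t) <->
     (Y t)^T *m (E t *m x) \in imcol (dae_im E1 F1 (K1 i) t).
  move=> tI; have [E1t F1t] := H1 t tI; split.
    move=> /mem_imcol_row[c1 [c2 Ex]].
    have [X0 [CX0 KX0]] := factor_through (Ki1 i) (CCK i) (rK i) (CKsub i).
    have [e Ke] : exists e, K i t *m c2 = C t *m (K1 i t *m e).
      have : K i t *m c2 \in imcol (C t).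
        rewrite CS //; apply/mem_preim_im.
        exists (x - K i t *m c1 - mxderive I (K i) t *m c2).
        rewrite !mulmxBr Ex /dae mulmxDl !mulmxA; move: (E t *m K i t *m c1) => A.
        by rewrite [A + _]addrC !addrK.
      move=> /mem_imcol[w Kw].
      have : C t *m w \in imcol (K i t) by rewrite -Kw mem_imcol_mul.
      by move=> /(CtoK _ _ _ tI)/mem_imcol[e we]; exists e; rewrite Kw we.
    have c2E : c2 = X0 t *m e.
      apply/eqP; rewrite -subr_eq0; apply/eqP.
      apply: (col_inj (rK i t tI)).
      by rewrite mulmxBr Ke !mulmxA KX0 // subrr.
    have Ex2 : E t *m x = E t *m (K i t *m (c1 - mxderive I X0 t *m e)) +
        dae E F (fun t => C t *m K1 i t) t *m e.
      rewrite (dae_mul E F tI (Ki1 i) CX0 KX0) Ex c2E mulmxDl !mulmxBr !mulmxA.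
      by rewrite addrACA addNr addr0.
    rewrite Ex2 mulmxDr; apply: memvD.
      by apply/memK => //; apply: (subvP (Kmono i t tI)); exact: mem_imcol_mul.
    by rewrite mulmxA YdaeCK //; apply/mem_imcol_row; exists 0, e; rewrite mulmx0 add0r.
  move=> /mem_imcol_row[c1 [c2 Yx]].
  have [im1 im2] := reduction_im red tI.
  pose v := E t *m (C t *m K1 i t) *m c1 + dae E F (fun t => C t *m K1 i t) t *m c2.
  have vE : v \in imcol (E t).
    rewrite /v; apply: memvD; first by rewrite -!mulmxA mem_imcol_mul.
    rewrite daeCK // mulmxDl -!mulmxA; apply: memvD; last exact: mem_imcol_mul.
    by have [D -> _] := im2 _ (K1 i t *m c2); rewrite -YE // mem_imcol_mul.
  have vY : (Y t)^T *m v = (Y t)^T *m (E t *m x).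
    by rewrite Yx /v mulmxDr [_ *m (dae _ _ _ _ *m _)]mulmxA YdaeCK // E1t !mulmxA.
  have -> : E t *m x = v.
    apply/eqP; rewrite -subr_eq0; apply/eqP; apply: (Yinj t) => //.
      by apply: memvB => //; exact: mem_imcol_mul.
    by rewrite mulmxBr vY subrr.
  apply: (subvP (dae_im_mono E F (Ki1 i) (CCK i) (rK i) (CKsub i) tI)).
  by apply/mem_imcol_row; exists c1, c2.
have k10' : k1 0%N = theta 0%N.
  have := k10 t0 t0I; have := reduction_rank pr red t0I => h1 h2.
  by apply: (@addIn (\rank (E1 t0))); rewrite h2 addnC h1.
have kS i : k i.+1 = (k i + theta i)%N.
  by case: i => [|i] /=; [rewrite k10'|rewrite k1S addnA].
(* Z^T kills E, leaving Z^T F K_i, whose kernel is the coordinate space of the intersection of K_i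
   with S, of dimension k1_i. *)
have ZFK i t : t \in I -> (\rank ((Z t)^T *m dae_im E F (K i) t) + k1 i)%N = k i.
  move=> tI; have [ZZ ZE] := HZ t tI; have [_ rK1 _ _ _] := HW1 t tI.
  have ZE0 := trmx_orth ZE.
  have [X0 [CX0 KX0]] := factor_through (Ki1 i) (CCK i) (rK i) (CKsub i).
  have -> : (Z t)^T *m dae_im E F (K i) t = row_mx 0 ((Z t)^T *m F t *m K i t).
    by rewrite mul_mx_row mulmxA ZE0 mul0mx /dae mulmxDr !mulmxA ZE0 !mul0mx addr0.
  have -> : \rank (row_mx (0 : 'M[R]_(_, k i)) ((Z t)^T *m F t *m K i t)) =
            \rank ((Z t)^T *m F t *m K i t).
    rewrite -!dim_imcol; congr (\dim _); apply/vspaceP => y.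
    apply/mem_imcol_row/mem_imcol => [[a [b ->]]|[b ->]]; first by exists b; rewrite mul0mx add0r.
    by exists 0, b; rewrite mul0mx add0r.
  have <- : \dim (kercol ((Z t)^T *m F t *m K i t)) = k1 i.
    have -> : kercol ((Z t)^T *m F t *m K i t) = imcol (X0 t).
      apply/vspaceP => c; rewrite mem_kercol; apply/eqP/mem_imcol => [Hc|[e ->]].
        have : K i t *m c \in imcol (C t).
          by rewrite CS // (preim_imE _ ZE) mem_kercol mulmxA Hc.
        move=> /mem_imcol[w Kw].
        have : C t *m w \in imcol (K i t) by rewrite -Kw mem_imcol_mul.
        move=> /(CtoK _ _ _ tI)/mem_imcol[e we]; exists e.
        apply/eqP; rewrite -subr_eq0; apply/eqP.
        apply: (col_inj (rK i t tI)).
        by rewrite mulmxBr Kw we !mulmxA KX0 // subrr.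
      have : C t *m (K1 i t *m e) \in imcol (C t) by exact: mem_imcol_mul.
      rewrite CS // (preim_imE _ ZE) mem_kercol => /eqP.
      by rewrite -!mulmxA [K i t *m _]mulmxA -KX0 // -mulmxA.
    rewrite dim_imcol; apply/full_col_inj => e Xe.
    apply: (col_inj (rK1 i)).
    apply: (col_inj (rC t tI)).
    by rewrite mulmxA KX0 // -mulmxA Xe mulmx0.
  by rewrite dim_kercol subnKC // rank_leq_col.
exists k, K; split; last first.
  by move=> t tI; rewrite rE.
split=> // t tI; have [ZZ ZE] := HZ t tI.
have dims_ i := dim_add_imE (dae_im E F (K i) t) ZE.
split.
- exact: TE.
- by move=> i; exact: rK.
- move=> i; apply/vspaceP => x; rewrite mem_preimcol.
  by apply/idP/idP => [/(memK _ _ _ tI)/(main _ _ _ tI)|/(main _ _ _ tI)/(memK _ _ _ tI)].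
- move=> i; have [_ H] := dims_ i; apply: etrans (esym H) _.
  apply: etrans _ (ZFK i t tI); rewrite addnC; congr (_ + _)%N.
  apply: etrans _ (rL1 i t tI); rewrite -dim_imcol; symmetry.
  apply: (@dim_inj_image _ _ _ (Y t)^T) => [x|y].
    by rewrite memv_cap => /andP[_ xE]; exact: Yinj.
  split=> [yL|[x]].
    exists (E t *m ((X t)^T *m y)); last by rewrite YEXm.
    rewrite memv_cap mem_imcol_mul andbT; apply/main => //.
    by rewrite YEXm.
  rewrite memv_cap => /andP[xL /mem_imcol[z xz]] ->.
  by rewrite xz; apply/main => //; rewrite -xz.
- move=> i; have [-> _] := dims_ i; rewrite rE //.
  have := ZFK i t tI; have := thr; case: i => [|i]; rewrite /= ?k10' ?k1S; lia.
Qed.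

(** Each level uses one derivative to form F1 and one to lift the frames, hence [mu.*2]. For mu = 0
    the matrix E is nonsingular, and all K_i are zero, with frames of no columns. *)
Lemma wong_exists mu j n r theta (E F : R -> 'M[R]_n) :
  reg I r theta mu 0 E F -> (forall i, (mu <= i)%N -> theta i = 0%N) ->
  mxCn I (j + mu.*2).+1 E -> mxCn I (j + mu.*2).+1 F ->
  exists k (K : forall i, R -> 'M[R]_(n, k i)), wong j.+1 E F theta K /\
    forall t, t \in I -> (k 0%N + \rank (E t))%N = n.
Proof.
elim: mu j n r theta E F => [|mu IHmu] j n r theta E F regE th0 CE CF.
  exists (fun=> 0%N), (fun _ _ => 0); split; last by move=> t tI; rewrite mxrank_unit // regE.
  split=> [i|i|t tI]; [exact: mxCn_cst|by rewrite th0|].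
  have uE : E t \in unitmx by exact: regE.
  have im0 (x : 'cV[R]_n) p (A : 'M[R]_(n, p)) : A = 0 -> x \in imcol A <-> x = 0.
    move=> ->; split=> [/mem_imcol[z ->]|->]; [exact: mul0mx|exact: mem0v].
  have z (A : 'M[R]_(n, 0 + 0)) : A = 0 by apply/matrixP => ? [].
  split=> [|i|i|i|i]; rewrite ?mxrank0 ?(z (dae_im _ _ _ _)) ?mxrank0 //.
  - apply/vspaceP => x; rewrite mem_kercol; apply/idP/eqP => [/(im0 _ _ _ (erefl _)) ->|Ex].
      exact: mulmx0.
    by rewrite -(mulKmx uE x) Ex mulmx0 mem0v.
  - apply/vspaceP => x; rewrite mem_preimcol.
    apply/idP/idP => [/(im0 _ _ _ (erefl _)) ->|/(im0 _ _ _ (erefl _)) Ex].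
      by rewrite mulmx0 mem0v.
    by rewrite -(mulKmx uE x) Ex mulmx0 mem0v.
  - rewrite th0 // addn0; have -> : imcol (0 : 'M[R]_(n, 0 + 0)) = 0%VS.
      by apply/vspaceP => x; rewrite memv0; apply/idP/eqP => /(im0 _ _ _ (erefl _)).
    by rewrite addv0 dim_imcol mxrank_unit.
have [pr _] := regE.
have [t0 [_ [t0I _ _]]] := nd.
have thr := pre_regular_le t0I pr.
have rE t : t \in I -> \rank (E t) = r 0%N by case/pr.
have nr : ((n - r 0) + r 0)%N = n by lia.
have rn : (r 0 + (n - r 0))%N = n by lia.
have [Y [CY HY]] := im_frame nd CE rE.
have [Z [CZ HZ]] := orth_frame nd CE rE nr.
have CZF : mxCn I (j + mu.+1.*2).+1 (fun t => (Z t)^T *m F t) by apply: mxCnM => //; exact: mxCnT.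
have rZF t : t \in I -> \rank ((Z t)^T *m F t) = (n - r 0)%N.
  move=> tI; have [full _ _] := pr t tI; have [ZZ ZE] := HZ t tI.
  by apply/eqP; exact: row_free_ZF full ZE (orthonormal_rank ZZ).
have [C [CC HC]] := ker_frame nd CZF rZF rn.
have basY := (onb_fun nd CY HY).1.
have basC : is_basis_fun I C (fun t => preimcol (F t) (imcol (E t))).
  apply: (onb_fun nd CC _).1 => t tI; have [-> ->] := HC t tI; split=> //.
  by have [_ ZE] := HZ t tI; rewrite (preim_imE _ ZE).
pose E1 t := (Y t)^T *m E t *m C t.
pose F1 t := (Y t)^T *m (F t *m C t + E t *m mxderive I C t).
have red : reduction I E F Y C E1 F1 by split.
have [N NE] : exists N, N = (j.+1 + mu.*2)%N by eexists.
have jmu : (j + mu.+1.*2 = N.+1)%N by lia.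
rewrite jmu in CE CF CY CC.
have low p q (A : R -> 'M[R]_(p, q)) : mxCn I N.+2 A -> mxCn I N.+1 A by apply: mxCn_le.
have CYT : mxCn I N.+1 (fun t => (Y t)^T) by apply: mxCnT => //; exact: low.
have CE1 : mxCn I N.+1 E1.
  by apply: mxCnM; [exact: nd|apply: mxCnM; [exact: nd|exact: CYT|exact: low]|exact: low].
have CF1 : mxCn I N.+1 F1.
  apply: mxCnM; [exact: nd|exact: CYT|].
  apply: mxCnD; [exact: nd| |]; (apply: mxCnM; [exact: nd|exact: low|]).
    exact: low.
  exact: mxCn_mxderive.
have /reg_shift reg1 : reg I r theta mu 1 E1 F1.
  by apply: reg_reduction regE red _ => //; apply: (mxCn_le nd) CE1.
have lowj p q (A : R -> 'M[R]_(p, q)) : mxCn I N.+1 A -> mxCn I j.+1 A.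
  by apply: mxCn_le => //; lia.
have := IHmu j.+1 _ _ _ _ _ reg1; rewrite -NE => /(_ _ CE1 CF1) [|k1 [K1 [W1 k10]]].
  by move=> i mui; apply: th0.
apply: (wong_step _ _ _ _ _ pr red k10 W1).
- exact/lowj/low.
- exact: lowj.
- exact: lowj.
- exact/lowj/low.
- exact/lowj/low.
Qed.

End Wong.

(** * Tractability index *)

Section TractabilityCore.
Context {R : realType}.
Variable I : interval R.
Hypothesis nd : nondegenerate_interval I.
Variables (m p : nat) (A : R -> 'M[R]_(m, p)) (D : R -> 'M[R]_(p, m)) (E F : R -> 'M[R]_m).
Variables (theta w : nat -> nat) (K : forall i, R -> 'M[R]_(m, w i)).
Hypothesis HW : wong I 1 E F theta K.
Variables (Dm : R -> 'M[R]_(m, p)) (Q G B Pi : nat -> R -> 'M[R]_m) (kappa : nat).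
Hypotheses (CD : mxCn I 1 D) (CDm : mxCn I 1 Dm).
Hypothesis H0 : forall t, t \in I ->
  [/\ E t = A t *m D t, A t *m (D t *m Dm t) = A t, D t *m Dm t *m D t = D t,
      Dm t *m D t *m Dm t = Dm t & Dm t *m D t = 1%:M - Q 0%N t].
Hypothesis H00 : forall t, t \in I ->
  [/\ G 0%N t = E t, B 0%N t = F t - A t *m mxderive I D t & Pi 0%N t = 1%:M - Q 0%N t].
Hypothesis Hrec : forall i t, (i < kappa)%N -> t \in I ->
  [/\ G i.+1 t = G i t + B i t *m Q i t,
      B i.+1 t = B i t *m (1%:M - Q i t) - G i.+1 t *m Dm t *m
         mxderive I (fun t => D t *m Pi i.+1 t *m Dm t) t *m (D t *m Pi i t)
    & Pi i.+1 t = Pi i t *m (1%:M - Q i.+1 t)].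
Hypothesis CPi : forall i, (i < kappa)%N -> mxCn I 1 (fun t => D t *m Pi i t *m Dm t).

Let La i t := imcol (dae_im I E F (K i) t).
(** L_(i-1), with L_(-1) = 0. *)
Let Lpre i t := if i is j.+1 then La j t else 0%VS.

(** Vanishing on K_l is the condition that ker Q_(l+1) contains X_(l+1), once N_0 + ... + N_l = K_l
    is known to meet N_(l+1) trivially. *)
Definition good_projector j := forall t, t \in I ->
  [/\ Q j t *m Q j t = Q j t, imcol (Q j t) = kercol (G j t) &
      if j is l.+1 then Q j t *m K l t = 0 else True].

(** The induction hypothesis: G_j agrees with E modulo L_(j-1), maps K_(j-1) onto L_(j-1), and its
    kernel complements K_(j-1) in K_j. *)
Definition level_ranks j := forall t, t \in I ->
  (forall z, (G j t - E t) *m z \in Lpre j t) /\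
  if j is l.+1 then
    [/\ imcol (G j t *m K l t) = La l t,
        imcol (K j t) = (imcol (K l t) + kercol (G j t))%VS,
        (imcol (K l t) :&: kercol (G j t))%VS = 0%VS
      & (\rank (G j t) + theta l)%N = m]
  else True.

Let Kle i j t : t \in I -> (i <= j)%N -> (imcol (K i t) <= imcol (K j t))%VS.
Proof.
move=> tI /subnKC <-; elim: (j - i)%N => [|n IHn]; first by rewrite addn0.
by rewrite addnS; apply: subv_trans IHn _; have [] := wong_mono nd HW (i + n) tI.
Qed.

Let Lale i j t : t \in I -> (i <= j)%N -> (La i t <= La j t)%VS.
Proof.
move=> tI /subnKC <-; elim: (j - i)%N => [|n IHn]; first by rewrite addn0.
by rewrite addnS; apply: subv_trans IHn _; have [] := wong_mono nd HW (i + n) tI.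
Qed.

Let EKL i t (x : 'cV_m) : t \in I -> x \in imcol (K i t) -> E t *m x \in Lpre i t.
Proof.
move=> tI; have [_ _ /(_ t tI)[im_K0 _ im_KS _ _]] := HW.
case: i => [|i]; first by rewrite im_K0 mem_kercol /= => /eqP ->; exact: mem0v.
by rewrite im_KS mem_preimcol.
Qed.

Let Lpre_La i t : t \in I -> (Lpre i t <= La i t)%VS.
Proof. by move=> tI; case: i => [|i] /=; [exact: sub0v|exact: Lale]. Qed.

Section Step.
Variable i : nat.
Hypothesis ik : (i < kappa)%N.
Hypothesis Hg : forall j, (j <= i)%N -> good_projector j.
Hypothesis Hc : forall j, (j <= i)%N -> level_ranks j.

Section AtPoint.
Variable t : R.
Hypothesis tI : t \in I.

Lemma Q_idem j : (j <= i)%N -> Q j t *m Q j t = Q j t.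
Proof. by move=> ji; have [] := Hg ji tI. Qed.

Lemma im_Q j : (j <= i)%N -> imcol (Q j t) = kercol (G j t).
Proof. by move=> ji; have [] := Hg ji tI. Qed.

Lemma im_K0 : imcol (K 0%N t) = imcol (Q 0%N t).
Proof.
have [_ _ /(_ t tI)[-> _ _ _ _]] := HW.
by rewrite im_Q //; have [-> _ _] := H00 tI.
Qed.

Lemma im_KS j : (j < i)%N -> imcol (K j.+1 t) = (imcol (K j t) + imcol (Q j.+1 t))%VS.
Proof. by move=> ji; rewrite im_Q //; have [_ []] := Hc ji tI. Qed.

Lemma Q_mul_K j x : (j < i)%N -> x \in imcol (K j t) -> Q j.+1 t *m x = 0.
Proof.
by move=> ji /mem_imcol[z ->]; have [_ _] := Hg ji tI; rewrite mulmxA => ->; rewrite mul0mx.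
Qed.

Lemma Q_in_K j x : (j <= i)%N -> Q j t *m x \in imcol (K j t).
Proof.
move=> ji; have xQ := mem_imcol_mul (Q j t) x.
case: j ji xQ => [|j] ji xQ; first by rewrite im_K0.
by rewrite im_KS //; apply: (subvP (addvSr _ _)).
Qed.

Lemma Q_mul_lower j l : (l < j)%N -> (j <= i)%N -> Q j t *m Q l t = 0.
Proof.
case: j => // j lj ji; apply: eq_mulmx_col => x; rewrite mul0mx -mulmxA.
have lj' : (l <= j)%N by [].
apply: Q_mul_K => //; apply: (subvP (Kle tI lj')); apply: Q_in_K.
exact: leq_trans lj' (ltnW ji).
Qed.

Lemma Pi_succ j : (j < i)%N -> Pi j.+1 t = Pi j t *m (1%:M - Q j.+1 t).
Proof. by move=> ji; have [_ _] := Hrec (ltn_trans ji ik) tI. Qed.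

Lemma Pi_zero : Pi 0%N t = 1%:M - Q 0%N t.
Proof. by have [] := H00 tI. Qed.

(** Q_j kills Q_h for h < j, so the first factors 1 - Q_h of Pi_l are invisible to it until 1 - Q_j
    itself occurs. *)
Lemma Q_mul_Pi j l : (j <= i)%N -> (l <= i)%N -> Q j t *m Pi l t = if (l < j)%N then Q j t else 0.
Proof.
move=> ji; elim: l => [|l IHl] li.
  rewrite Pi_zero mulmxBr mulmx1; case: posnP => [j0|j0]; first by rewrite j0 Q_idem // subrr.
  by rewrite Q_mul_lower // subr0.
rewrite Pi_succ // mulmxA IHl ?(ltnW li) //; case: (ltngtP l.+1 j) => lj.
- by rewrite mulmxBr mulmx1 Q_mul_lower // subr0.
- by rewrite mul0mx.
- by rewrite -lj mulmxBr mulmx1 Q_idem // subrr.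
Qed.

Lemma sub_Pi_in_K j x : (j <= i)%N -> x - Pi j t *m x \in imcol (K j t).
Proof.
elim: j x => [|j IHj] x ji.
  by rewrite Pi_zero mulmxBl mul1mx subKr; exact: Q_in_K.
rewrite Pi_succ // -mulmxA mulmxBl mul1mx mulmxBr opprB addrC.
rewrite -addrA [- _ + x]addrC; apply: memvD; last first.
  by apply: (subvP (Kle tI (leqnSn j))); apply: IHj; exact: ltnW.
rewrite -[Pi j t *m _](subKr (Q j.+1 t *m x)); apply: memvB; first exact: Q_in_K.
by apply: (subvP (Kle tI (leqnSn j))); apply: IHj; exact: ltnW.
Qed.

(** Together with [sub_Pi_in_K]: Pi_j is a projector with kernel K_j. The absorption rules below
    follow from K_l being contained in K_j for l <= j. *)
Lemma Pi_mul_K j x : (j <= i)%N -> x \in imcol (K j t) -> Pi j t *m x = 0.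
Proof.
elim: j x => [|j IHj] x ji.
  rewrite im_K0 => /mem_imcol[z ->].
  by rewrite Pi_zero mulmxA mulmxBl mul1mx Q_idem // subrr mul0mx.
rewrite im_KS // => /memv_addP[x1 Kx1 [_ /mem_imcol[z ->] ->]].
rewrite Pi_succ // -mulmxA.
have -> : (1%:M - Q j.+1 t) *m (x1 + Q j.+1 t *m z) = x1.
  by rewrite mulmxBl mul1mx mulmxDr (Q_mul_K ji Kx1) add0r [Q _ t *m (_ *m _)]mulmxA Q_idem // addrK.
by rewrite IHj // ltnW.
Qed.

Lemma Pi_absorbl j l : (l <= j)%N -> (j <= i)%N -> Pi j t *m Pi l t = Pi j t.
Proof.
move=> lj ji; apply: eq_mulmx_col => x.
have : Pi j t *m (x - Pi l t *m x) = 0.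
  apply: Pi_mul_K => //; apply: (subvP (Kle tI lj)); apply: sub_Pi_in_K.
  exact: leq_trans ji.
by rewrite mulmxBr mulmxA => /eqP; rewrite subr_eq0 => /eqP.
Qed.

Lemma Pi_absorbr j l : (l <= j)%N -> (j <= i)%N -> Pi l t *m Pi j t = Pi j t.
Proof.
move=> /subnKC <-; elim: (j - l)%N => [|n IHn]; first by rewrite addn0 => li; exact: Pi_absorbl.
by rewrite addnS => ji; rewrite Pi_succ // mulmxA IHn // ltnW.
Qed.

Lemma G_succ j : (j <= i)%N -> G j.+1 t = G j t + B j t *m Q j t.
Proof. by move=> ji; have [] := Hrec (leq_ltn_trans ji ik) tI. Qed.

(** G_l - E is the sum of the B_h Q_h with h < l, and Q_h Pi_j = 0 for h <= j. *)
Lemma G_mul_Pi l j : (l <= j.+1)%N -> (j <= i)%N -> G l t *m Pi j t = E t *m Pi j t.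
Proof.
elim: l => [|l IHl] lj ji; first by have [-> _ _] := H00 tI.
rewrite G_succ ?(leq_trans _ ji) // mulmxDl IHl ?(ltnW lj) // -mulmxA Q_mul_Pi //.
  by rewrite ltnNge -ltnS lj /= mulmx0 addr0.
exact: leq_trans ji.
Qed.

Lemma G_mul_K l x : (l <= i)%N -> x \in imcol (K l t) -> G l t *m x \in Lpre l t.
Proof.
move=> li xK; have [Gz _] := Hc li tI.
rewrite -[G l t](subrK (E t)) mulmxDl; apply: memvD; first exact: Gz.
exact: EKL.
Qed.

Lemma B_unfold j : (j < i)%N -> B j.+1 t =
  (B 0%N t - \sum_(h < j.+1) G h.+1 t *m Dm t *m mxderive I (fun t => D t *m Pi h.+1 t *m Dm t) t *m D t) *m Pi j t.
Proof.
elim: j => [|j IHj] ji.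
  have [_ -> _] := Hrec (ltn_trans ji ik) tI.
  by rewrite big_ord1 Pi_zero mulmxBl !mulmxA.
have [_ -> _] := Hrec (ltn_trans ji ik) tI.
rewrite IHj ?(ltnW ji) // -mulmxA -Pi_succ ?(ltnW ji) // [in RHS]big_ord_recr /=.
by rewrite opprD addrA [RHS]mulmxBl !mulmxA.
Qed.

Hypothesis BiQ : (forall y, y \in kercol (G i t) -> B i t *m y \in La i t) /\
  (forall e, exists2 y, y \in kercol (G i t) & dae I E F (K i) t *m e - B i t *m y \in Lpre i t).

(** Linear algebra at one point, given [BiQ]: modulo L_(i-1), B_i on N_i produces the values F y + E
    y' on K_i. Then G_(i+1) maps K_i onto L_i, injectively as the dimensions agree, so K_i meets
    N_(i+1) trivially. Moreover K_(i+1) contains N_(i+1), and im E + L_i contains im G_(i+1). The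
    first gives m - rank G_(i+1) <= theta_i, the second the reverse. *)
Lemma level_ranks_point :
  (forall z, (G i.+1 t - E t) *m z \in La i t) /\
    [/\ imcol (G i.+1 t *m K i t) = La i t,
        imcol (K i.+1 t) = (imcol (K i t) + kercol (G i.+1 t))%VS,
        (imcol (K i t) :&: kercol (G i.+1 t))%VS = 0%VS
      & (\rank (G i.+1 t) + theta i)%N = m].
Proof.
have [_ wS /(_ t tI)[_ rK KSw rL dimL]] := HW.
case: BiQ => BL Bdae.
have GE z : (G i.+1 t - E t) *m z \in La i t.
  rewrite G_succ // addrAC mulmxDl; apply: memvD.
    by apply: (subvP (Lpre_La i tI)); have [] := Hc (leqnn i) tI.
  by rewrite -mulmxA; apply: BL; rewrite -im_Q // mem_imcol_mul.
split=> //.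
have GKL : imcol (G i.+1 t *m K i t) = La i t.
  apply/eqP; rewrite eqEsubv; apply/andP; split.
    apply/subvP => _ /mem_imcol[x ->]; rewrite -mulmxA -[G i.+1 t](subrK (E t)) mulmxDl.
    apply: memvD => //; apply: (subvP (Lpre_La i tI)); apply: EKL => //.
    exact: mem_imcol_mul.
  have sub y : y \in imcol (K i t) -> G i.+1 t *m y \in imcol (G i.+1 t *m K i t).
    by move=> /mem_imcol[x ->]; rewrite mulmxA mem_imcol_mul.
  (* On K_(i-1) the projector Q_i vanishes, so G_(i+1) acts there as G_i, whose image is L_(i-1). A
     separate index [l] allows case analysis. *)
  have Lsub' l : l = i -> (Lpre l t <= imcol (G i.+1 t *m K i t))%VS.
    case: l => [|j] ji; first exact: sub0v.
    have lji : (j < i)%N by rewrite -ji.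
    have [_ [GjL _ _ _]] := Hc lji tI; rewrite -[Lpre _ _]/(La j t) -GjL; apply/subvP => _ /mem_imcol[x ->].
    have QiK : Q i t *m (K j t *m x) = 0 by rewrite -[i in Q i]ji Q_mul_K // mem_imcol_mul.
    have <- : G i.+1 t *m (K j t *m x) = G j.+1 t *m K j t *m x.
      by rewrite G_succ // mulmxDl -[B _ t *m _ *m _]mulmxA QiK mulmx0 addr0 -[i in G i]ji mulmxA.
    by apply: sub; apply: (subvP (Kle tI (ltnW lji))); exact: mem_imcol_mul.
  have Lsub := Lsub' _ (erefl i).
  apply/subvP => _ /mem_imcol_row[c1 [c2 ->]]; apply: memvD.
    rewrite -mulmxA; apply: (subvP Lsub); apply: EKL => //; exact: mem_imcol_mul.
  have [y yN Hy] := Bdae c2.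
  rewrite -[dae _ _ _ _ _ *m c2](subrK (B i t *m y)); apply: memvD; first exact: (subvP Lsub).
  have yQ : Q i t *m y = y.
    by move: yN; rewrite -im_Q // => /mem_imcol[z ->]; rewrite mulmxA Q_idem.
  have -> : B i t *m y = G i.+1 t *m y.
    by rewrite G_succ // mulmxDl -mulmxA yQ; move: yN; rewrite mem_kercol => /eqP ->; rewrite add0r.
  by apply: sub; rewrite -yQ; exact: Q_in_K.
have inj : forall e : 'cV_(w i), G i.+1 t *m K i t *m e = 0 -> e = 0.
  by apply/full_col_inj; rewrite -dim_imcol GKL dim_imcol rL.
have cap0 : (imcol (K i t) :&: kercol (G i.+1 t))%VS = 0%VS.
  apply/eqP; rewrite -subv0; apply/subvP => x; rewrite memv_cap memv0.
  move=> /andP[/mem_imcol[e ->]]; rewrite mem_kercol mulmxA => /eqP/inj ->.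
  by rewrite mulmx0.
have NK : (kercol (G i.+1 t) <= imcol (K i.+1 t))%VS.
  apply/subvP => z; rewrite mem_kercol KSw mem_preimcol => /eqP Gz.
  have -> : E t *m z = - ((G i.+1 t - E t) *m z) by rewrite mulmxBl Gz sub0r opprK.
  by rewrite memvN.
have rGle : (\rank (G i.+1 t) + theta i <= m)%N.
  apply: (@leq_trans (\dim (imcol (E t) + imcol (dae_im I E F (K i) t)) + theta i)%N); last by rewrite (dimL i).
  rewrite leq_add2r -dim_imcol; apply: dimvS; apply/subvP => _ /mem_imcol[z ->].
  rewrite -[G i.+1 t](subrK (E t)) mulmxDl addrC; apply: memv_add; last exact: GE.
  exact: mem_imcol_mul.
have dsum : \dim (imcol (K i t) + kercol (G i.+1 t)) = (w i + (m - \rank (G i.+1 t)))%N.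
  have := dimv_sum_cap (imcol (K i t)) (kercol (G i.+1 t)).
  by rewrite cap0 dimv0 addn0 dim_kercol dim_imcol rK.
have subK : (imcol (K i t) + kercol (G i.+1 t) <= imcol (K i.+1 t))%VS.
  by rewrite subv_add NK andbT; exact: Kle.
have dK : \dim (imcol (K i.+1 t)) = (w i + theta i)%N.
  by rewrite dim_imcol; exact: etrans (rK i.+1) (wS i).
have := dimvS subK; rewrite dsum dK leq_add2l => dle.
have rGE : (\rank (G i.+1 t) + theta i)%N = m.
  by apply/eqP; rewrite eqn_leq rGle /= -leq_subLR.
split=> //; symmetry; apply: eq_dimv_sub => //.
rewrite dsum dK leq_add2l leq_subRL; last exact: rank_leq_row.
exact: rGle.
Qed.

End AtPoint.

(** Differentiating D K_0 = 0 gives D' K_0 = - D K_0', so (F - A D') K_0 = F K_0 + E K_0'. *)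
Lemma B_kernel_zero t : t \in I -> i = 0%N ->
  (forall y, y \in kercol (G i t) -> B i t *m y \in La i t) /\
  (forall e, exists2 y, y \in kercol (G i t) & dae I E F (K i) t *m e - B i t *m y \in Lpre i t).
Proof.
move=> tI i0; have [CK _ HWt] := HW.
have DK s : s \in I -> D s *m K 0%N s = 0.
  move=> sI; have [_ _ DDD _ DmD] := H0 sI; rewrite -DDD.
  have /imcolP[Z ->] : (imcol (K 0%N s) <= imcol (Q 0%N s))%VS by rewrite im_K0.
  rewrite -[D s *m _ *m D s]mulmxA DmD -mulmxA [(_ - _) *m _]mulmxA mulmxBl mul1mx.
  by rewrite Q_idem // subrr mul0mx mulmx0.
have BK : B 0%N t *m K 0%N t = dae I E F (K 0%N) t.
  have [_ -> _] := H00 tI; have [Et _ _ _ _] := H0 tI.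
  have dDK : mxderive I D t *m K 0%N t + D t *m mxderive I (K 0%N) t = 0.
    rewrite -mxderiveM //.
    rewrite -(mxderive_cst nd (0 : 'M[R]_(p, w 0%N)) tI).
    symmetry; apply: mxderive_ext => //; last exact: mxCn_cst.
    by move=> s sI; rewrite DK.
  rewrite /dae mulmxBl Et -!mulmxA; congr (_ + _).
  by rewrite -[D t *m _](addKr (mxderive I D t *m K 0%N t)) dDK addr0 mulmxN.
have kE : kercol (G i t) = imcol (K 0%N t) by rewrite im_K0 // -im_Q // i0.
split=> [y|e].
  rewrite kE i0 => /mem_imcol[e ->]; rewrite mulmxA BK.
  by apply/mem_imcol_row; exists 0, e; rewrite mulmx0 add0r.
(* [K i] and [K 0] have different types, so the coordinates are transported along i = 0. *)
exists (K 0%N t *m castmx (f_equal w i0, erefl 1%N) e); first by rewrite kE mem_imcol_mul.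
have : forall l (li : l = 0%N) (e : 'cV_(w l)),
    dae I E F (K l) t *m e - B l t *m (K 0%N t *m castmx (f_equal w li, erefl 1%N) e) = 0.
  by move=> l li; subst l => e'; rewrite castmx_id mulmxA BK subrr.
by move=> ->; exact: mem0v.
Qed.

(** For y in N_i the C^1 section T (D y) of K_i, with D y frozen at t, has value Pi_l y at t, which
    is y modulo K_l. The proof shows that B_i y is F x + E x' for this section x, modulo L_l. *)
Lemma B_kernel_succ l t : t \in I -> l.+1 = i ->
  (forall y, y \in kercol (G i t) -> B i t *m y \in La i t) /\
  (forall e, exists2 y, y \in kercol (G i t) & dae I E F (K i) t *m e - B i t *m y \in Lpre i t).
Proof.
move=> tI li; have [CK _ HWt] := HW.
have lti : (l < i)%N by rewrite li.
have lei : (l <= i)%N by exact: ltnW.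
have rK s : s \in I -> \rank (K i s) = w i by move=> /HWt[].
pose phi h s := D s *m Pi h s *m Dm s.
have Cphi h : (h <= i)%N -> mxCn I 1 (phi h).
  by move=> hi; apply: CPi; exact: leq_ltn_trans ik.
have PiSl s : s \in I -> Pi i s = Pi l s - Pi l s *m Q i s.
  by move=> sI; rewrite -li Pi_succ ?li // mulmxBr mulmx1.
pose T s := Pi l s *m Q i s *m Dm s.
pose Phi s := D s *m T s.
have PhiE s : s \in I -> Phi s = phi l s - phi i s.
  move=> sI; rewrite /phi PiSl // mulmxBr mulmxBl opprB addrC subrK /Phi /T.
  by rewrite !mulmxA.
have CPhi : mxCn I 1 Phi.
  apply: (@mxCn_ext _ _ nd _ _ _ (fun s => phi l s - phi i s)).
    by move=> s sI; rewrite PhiE.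
  by apply: mxCnB => //; exact: Cphi.
have P0Pi h s : (h <= i)%N -> s \in I -> Dm s *m (D s *m Pi h s) = Pi h s.
  move=> hi sI; have [_ _ _ _ DmD] := H0 sI; have [_ _ P0] := H00 sI.
  by rewrite mulmxA DmD -P0 Pi_absorbr.
have TE s : s \in I -> T s = Dm s *m Phi s.
  by move=> sI; rewrite /Phi /T !mulmxA -[Dm s *m D s *m _]mulmxA P0Pi.
have CT : mxCn I 1 T.
  by apply: (@mxCn_ext _ _ nd _ _ _ (fun s => Dm s *m Phi s)); [move=> s sI; rewrite TE|exact: mxCnM].
have TK s : s \in I -> (imcol (T s) <= imcol (K i s))%VS.
  move=> sI; apply/subvP => _ /mem_imcol[x ->]; rewrite /T -!mulmxA.
  rewrite -[Pi l s *m _](subKr (Q i s *m (Dm s *m x))); apply: memvB; first exact: Q_in_K.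
  by apply: (subvP (Kle sI lei)); exact: sub_Pi_in_K.
have [X [CX KX]] := factor_through nd (CK i) CT rK TK.
have phiPhi h s : (h <= l)%N -> s \in I -> phi h s *m Phi s = Phi s.
  move=> hl sI; have hi := leq_trans hl lei.
  rewrite /phi -[LHS]mulmxA -TE // /Phi /T !mulmxA.
  by rewrite -[D s *m _ *m Pi l s]mulmxA Pi_absorbr.
have phiPhi0 s : s \in I -> phi i s *m Phi s = 0.
  move=> sI; rewrite /phi -[LHS]mulmxA -TE // /T !mulmxA.
  have PiQ0 : Pi i s *m Q i s = 0 by rewrite PiSl // mulmxBl -mulmxA Q_idem // subrr.
  rewrite -[D s *m _ *m Pi l s]mulmxA Pi_absorbl // -[D s *m _ *m Q i s]mulmxA PiQ0.
  by rewrite mulmx0 mul0mx.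
pose dPhi := mxderive I Phi t.
(* From phi_h Phi = Phi; in [dphi0], likewise, from phi_i Phi = 0. *)
have dphi h : (h <= l)%N -> mxderive I (phi h) t *m Phi t = dPhi - phi h t *m dPhi.
  move=> hl; apply: (@addIr _ (phi h t *m dPhi)); rewrite subrK.
  have Ch : mxCn I 1 (phi h) by exact/Cphi/(leq_trans hl).
  rewrite -mxderiveM //.
  apply: mxderive_ext => //; last exact: mxCnM.
  by move=> s sI; rewrite phiPhi.
have dphi0 : mxderive I (phi i) t *m Phi t = - (phi i t *m dPhi).
  apply/eqP; rewrite -subr_eq0 opprK; apply/eqP.
  rewrite -mxderiveM //; last exact: Cphi.
  rewrite -(mxderive_cst nd (0 : 'M[R]_p) tI).
  symmetry; apply: mxderive_ext => //; last exact: mxCn_cst.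
  by move=> s sI; rewrite phiPhi0.
have [Et ADDm _ _ DmD] := H0 tI.
have Dmphi h : (h <= i)%N -> Dm t *m phi h t = Pi h t *m Dm t.
  by move=> hi; rewrite /phi -[D t *m _ *m _]mulmxA mulmxA; rewrite -[Dm t *m D t *m _]mulmxA [D t *m (_ *m _)]mulmxA mulmxA P0Pi.
have alg (g P : 'M[R]_m) (ph dP : 'M[R]_p) (dm : 'M[R]_(m, p)) (c : 'cV[R]_p) :
    dm *m ph = P *m dm ->
    g *m dm *m (dP - ph *m dP) *m c = g *m (dm *m dP *m c - P *m (dm *m dP *m c)).
  move=> H; rewrite !mulmxBr mulmxBl !mulmxA.
  by rewrite -[g *m dm *m ph]mulmxA H !mulmxA.
have daeT : B 0%N t *m T t + A t *m dPhi = dae I E F T t.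
  have [_ -> _] := H00 tI; rewrite /dae /dPhi /Phi mxderiveM // mulmxBl mulmxDr Et !mulmxA.
  by rewrite addrA subrK.
(* B_i y - dae T (D y) consists of the correction terms of B_i and of A Phi'. For h < l, G_(h+1) is
   applied to an element of ker Pi_(h+1) = K_(h+1), with result in L_h. The last term combines with
   A Phi' to E applied to an element of K_i, which lies in L_l. *)
have key y : y \in kercol (G i t) -> B i t *m y - dae I E F T t *m (D t *m y) \in La l t /\
    T t *m (D t *m y) = Pi l t *m y.
  rewrite -im_Q // => /mem_imcol[z yE].
  have Qy : Q i t *m y = y by rewrite yE mulmxA Q_idem.
  set c := D t *m y.
  have Tc : T t *m c = Pi l t *m y.
    rewrite /T /c -!mulmxA [Dm t *m _]mulmxA DmD mulmxBl mul1mx mulmxBr.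
    by rewrite [Q i t *m (Q 0%N t *m y)]mulmxA Q_mul_lower ?mul0mx ?subr0 ?Qy // -li.
  split=> //.
  have -> : B i t *m y = B 0%N t *m (T t *m c) -
      \sum_(h < l.+1) G h.+1 t *m Dm t *m (mxderive I (phi h.+1) t *m Phi t) *m c.
    rewrite -[in B i]li B_unfold ?li // -mulmxA -Tc mulmxBl; congr (_ - _).
    rewrite mulmx_suml; apply: eq_bigr => h _.
    by rewrite /Phi /phi !mulmxA.
  rewrite -daeT mulmxDl -[B 0%N t *m T t *m c]mulmxA.
  set x := B 0%N t *m (T t *m c); set Sg := \sum_(_ < _) _.
  rewrite opprD addrA [x - Sg - x]addrAC subrr sub0r -opprD memvN /Sg.
  rewrite big_ord_recr /= -addrA; apply: memvD.
    apply: memv_suml => h _.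
    have hl : (h.+1 <= l)%N by exact: ltn_ord.
    have hi := leq_trans hl lei.
    have -> : G h.+1 t *m Dm t *m (mxderive I (phi h.+1) t *m Phi t) *m c =
        G h.+1 t *m (Dm t *m dPhi *m c - Pi h.+1 t *m (Dm t *m dPhi *m c)).
      by rewrite dphi //; apply: alg; exact: Dmphi.
    apply: (subvP (Lale tI (ltnW hl))).
    apply: (@G_mul_K _ tI h.+1) => //; exact: sub_Pi_in_K.
  have -> : G l.+1 t *m Dm t *m (mxderive I (phi l.+1) t *m Phi t) *m c + A t *m dPhi *m c =
     E t *m (Dm t *m dPhi *m c - Pi i t *m (Dm t *m dPhi *m c)).
    rewrite li dphi0 -{1}ADDm mulmxBr Et addrC; congr (_ + _); first by rewrite !mulmxA.
    rewrite mulmxN mulNmx; congr (- _).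
    have -> : G i t *m Dm t *m (phi i t *m dPhi) = G i t *m (Dm t *m phi i t) *m dPhi.
      by move: (phi i t) => ph; rewrite !mulmxA.
    rewrite Dmphi // [G i t *m _]mulmxA (G_mul_Pi tI (leqnSn i)) // -Et.
    by move: (dPhi) => dP; rewrite !mulmxA.
  have -> : La l t = Lpre i t by rewrite -li.
  by apply: EKL => //; exact: sub_Pi_in_K.
have daeTK : dae I E F T t = dae I E F (K i) t *m X t + E t *m K i t *m mxderive I X t.
  exact: dae_mul.
have LpreE : Lpre i t = La l t by rewrite -li.
have EKLl (q : 'cV_(w i)) : E t *m (K i t *m q) \in La l t.
  by rewrite -LpreE; apply: EKL => //; exact: mem_imcol_mul.
split=> [y yN|e].
  have [yL _] := key y yN.
  rewrite -[B i t *m y](subrK (dae I E F T t *m (D t *m y))); apply: memvD.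
    by apply: (subvP (Lale tI lei)).
  rewrite daeTK mulmxDl; apply/mem_imcol_row; exists (mxderive I X t *m (D t *m y)), (X t *m (D t *m y)).
  by rewrite addrC !mulmxA.
have : K i t *m e \in imcol (K i t) by exact: mem_imcol_mul.
have -> : imcol (K i t) = (imcol (K l t) + kercol (G i t))%VS.
  by rewrite -im_Q // -[in LHS]li im_KS ?li.
move=> /memv_addP[x' Kx' [y yN Kie]]; exists y => //.
have [yL Tc] := key y yN; rewrite LpreE.
(* K_i e and T (D y) differ by an element K_l e'', so by the product rule the dae-values differ by
   dae K_l e'' and terms in E K_i, all inside L_l. *)
suff H : dae I E F (K i) t *m e - dae I E F T t *m (D t *m y) \in La l t.
  have -> : dae I E F (K i) t *m e - B i t *m y =
      (dae I E F (K i) t *m e - dae I E F T t *m (D t *m y)) -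
      (B i t *m y - dae I E F T t *m (D t *m y)).
    by rewrite opprB addrA subrK.
  exact: memvB.
have Kl1 : mxCn I 1 (K l) by exact: CK.
have Klsub s : s \in I -> (imcol (K l s) <= imcol (K i s))%VS by move=> sI; exact: Kle.
have [Th [CTh KTh]] := factor_through nd (CK i) Kl1 rK Klsub.
have [e'' Ke''] : exists e'', K i t *m e = T t *m (D t *m y) + K l t *m e''.
  have : K i t *m e - T t *m (D t *m y) \in imcol (K l t).
    rewrite Tc Kie -addrA; apply: memvD => //; exact: sub_Pi_in_K.
  by move=> /mem_imcol[e'' He]; exists e''; rewrite -He addrC subrK.
have eE : e = X t *m (D t *m y) + Th t *m e''.
  apply/eqP; rewrite -subr_eq0; apply/eqP.
  apply: (col_inj (rK t tI)).
  by rewrite mulmxBr Ke'' mulmxDr !mulmxA -KX // -KTh // subrr.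
have daeKl := dae_mul nd E F tI (CK i) CTh KTh.
have -> : dae I E F (K i) t *m e - dae I E F T t *m (D t *m y) =
   dae I E F (K l) t *m e'' - E t *m (K i t *m (mxderive I Th t *m e'' + mxderive I X t *m (D t *m y))).
  rewrite daeTK daeKl eE !mulmxDr !mulmxDl !mulmxA.
  by rewrite [X in X - _ = _]addrC addrKA [RHS]addrKA.
apply: memvB => //.
by apply/mem_imcol_row; exists 0, e''; rewrite mulmx0 add0r.
Qed.

End Step.

Lemma level_ranks_all i : (i <= kappa)%N -> (forall j, (j < i)%N -> good_projector j) ->
  level_ranks i.
Proof.
elim/ltn_ind: i => -[|i] IHi ik Hg t tI.
  split=> // z; have [-> _ _] := H00 tI; rewrite subrr mul0mx; exact: mem0v.
have Hc j : (j <= i)%N -> level_ranks j.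
  move=> ji; apply: IHi => //; first exact: leq_trans ji (ltnW ik).
  by move=> l lj; apply: Hg; exact: leq_trans lj (leqW ji).
apply: (@level_ranks_point i) => //.
have [i0|i0] := posnP i; first exact: B_kernel_zero.
by apply: (B_kernel_succ ik Hg Hc tI (prednK i0)).
Qed.

End TractabilityCore.

(** * Admissible sequences: forced ranks and existence *)

Section TractabilityIndex.
Context {R : realType}.
Variable I : interval R.
Hypothesis nd : nondegenerate_interval I.

(* [D *m Tc *m Ri] is the projector R of the proper factorization, and
   [P_0 *m Tc *m Ri] the generalized inverse D^-: both are C^1. *)
Lemma oblique_projector m p r (E : R -> 'M[R]_m) (A : R -> 'M[R]_(m, p)) (D : R -> 'M[R]_(p, m)) :
  mxCn I 1 E -> (forall t, t \in I -> \rank (E t) = r) -> proper_factorization I E A D ->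
  exists (Tc : R -> 'M[R]_(m, r)) (Ri : R -> 'M[R]_(r, p)),
  [/\ mxCn I 1 Tc, mxCn I 1 Ri & forall t, t \in I ->
    [/\ kercol (D t) = kercol (E t), Ri t *m D t *m Tc t = 1%:M,
        A t *m (D t *m Tc t *m Ri t) = A t & D t *m Tc t *m Ri t *m D t = D t]].
Proof.
move=> CE rE [CA CD [Pk [CPk HPk]] _ HEA]; have [t0 [_ [t0I _ _]]] := nd.
have rm : (r <= m)%N by rewrite -(rE t0 t0I) rank_leq_col.
have [T [CT HT]] := ker_frame nd CE rE (subnK rm).
have rE' t : t \in I -> \rank (E t)^T = r by move=> tI; rewrite mxrank_tr rE.
have [Tc [CTc HTc]] := im_frame nd (mxCnT CE) rE'.
have kD t : t \in I -> kercol (D t) = kercol (E t).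
  move=> tI; have [Et [_ cap0]] := HEA t tI; apply/vspaceP => z; rewrite !mem_kercol Et -mulmxA.
  apply/eqP/eqP => [->|ADz]; first exact: mulmx0.
  have : D t *m z \in (kercol (A t) :&: imcol (D t))%VS.
    by rewrite memv_cap mem_kercol ADz eqxx mem_imcol_mul.
  by rewrite cap0 memv0 => /eqP.
pose J t := D t *m Tc t.
have CJ : mxCn I 1 J by exact: mxCnM.
have Jinj t (x : 'cV_r) : t \in I -> J t *m x = 0 -> x = 0.
  move=> tI; rewrite -mulmxA => /eqP; rewrite -mem_kercol kD //; have [TT TE] := HT t tI.
  have [TcTc TcE] := HTc t tI.
  move=> xk; have : Tc t *m x \in (imcol (T t) :&: imcol (Tc t))%VS.
    by rewrite memv_cap TE xk mem_imcol_mul.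
  have [_ ->] : is_dsum (imcol (T t)) (imcol (Tc t)) fullv.
    by apply: dsum_orth; rewrite TE TcE (orth_kercolT TE).
  rewrite memv0 => /eqP Tx; by rewrite -[x]mul1mx -TcTc -mulmxA Tx mulmx0.
have Jim t (z : 'cV_m) : t \in I -> exists x, D t *m z = J t *m x.
  move=> tI; have [TT TE] := HT t tI; have [TcTc TcE] := HTc t tI.
  have [sum_ _] : is_dsum (imcol (T t)) (imcol (Tc t)) fullv.
    by apply: dsum_orth; rewrite TE TcE (orth_kercolT TE).
  have : z \in fullv by exact: memvf.
  rewrite -sum_ => /memv_addP[z1 Tz1 [_ /mem_imcol[x ->] ->]]; exists x.
  have : z1 \in kercol (D t) by rewrite kD // -TE.
  by rewrite mem_kercol mulmxDr => /eqP ->; rewrite add0r mulmxA.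
(* S J is the Gram matrix of J modulo ker A, as [Pk] is the orthoprojector onto ker A. It is
   nonsingular because im D meets ker A trivially, so (S J)^(-1) S inverts J and kills ker A. *)
pose S t := (J t)^T *m (1%:M - Pk t).
have CS : mxCn I 1 S.
  by apply: mxCnM => //; [exact: mxCnT|apply: mxCnB => //; exact: mxCn_cst].
have uS t : t \in I -> S t *m J t \in unitmx.
  move=> tI; apply: square_unit => x SJx.
  have Hv : (J t)^T *m ((1%:M - Pk t) *m (J t *m x)) = 0 by rewrite -[RHS]SJx /S !mulmxA.
  set v := J t *m x in Hv.
  have [PP Pim Pker] := HPk t tI; have [Et [_ cap0]] := HEA t tI.
  set u := (1%:M - Pk t) *m v in Hv.
  have uker : u \in orthcomp (kercol (A t)).
    by rewrite -Pker mem_kercol /u mulmxA mulmxBr mulmx1 PP subrr mul0mx.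
  have Pv : Pk t *m v \in kercol (A t) by rewrite -Pim mem_imcol_mul.
  have uv : v^T *m u = 0 by rewrite /v trmx_mul -mulmxA Hv mulmx0.
  have Pu : (Pk t *m v)^T *m u = 0 by move/mem_orthcomp: uker; apply.
  have u0 : u = 0.
    apply: gram_eq0; rewrite {1}/u mulmxBl mul1mx linearB /= mulmxBl.
    by rewrite uv Pu subrr.
  have vP : v = Pk t *m v by apply/eqP; rewrite -subr_eq0 -{1}[v]mul1mx -mulmxBl -/u u0.
  apply: (Jinj t) => //; rewrite -/v; apply/eqP; rewrite -memv0 -cap0 memv_cap {1}vP Pv.
  by rewrite /v /J -mulmxA mem_imcol_mul.
pose Ri t := invmx (S t *m J t) *m S t.
have CRi : mxCn I 1 Ri by apply: mxCnM => //; apply: mxCnV => //; exact: mxCnM.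
exists Tc, Ri; split=> // t tI; have [PP Pim Pker] := HPk t tI; have [Et [sum_ cap0]] := HEA t tI.
have RiJ : Ri t *m J t = 1%:M by rewrite /Ri -mulmxA mulVmx // uS.
have RiA (a : 'cV_p) : a \in kercol (A t) -> Ri t *m a = 0.
  rewrite -Pim => /mem_imcol[z ->].
  have SP : S t *m (Pk t *m z) = 0.
    by rewrite /S -mulmxA [(1%:M - Pk t) *m _]mulmxA mulmxBl mul1mx PP subrr mul0mx mulmx0.
  by rewrite /Ri -mulmxA SP mulmx0.
have JE : D t *m Tc t = J t by [].
clearbody Ri S J; split.
- exact: kD.
- by rewrite -mulmxA JE.
- apply: eq_mulmx_col => y; have : y \in fullv by exact: memvf.
  rewrite -sum_ => /memv_addP[a Aa [_ /mem_imcol[z ->] ->]].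
  have [x ->] := Jim t z tI.
  rewrite JE mulmxDr [RHS]mulmxDr -!mulmxA RiA // !mulmx0 add0r [Ri t *m _]mulmxA RiJ mul1mx.
  by move: Aa; rewrite mem_kercol => /eqP ->; rewrite add0r.
- apply: eq_mulmx_col => y; have [x Dx] := Jim t y tI.
  by rewrite JE -mulmxA Dx -[_ *m Ri t *m _]mulmxA [Ri t *m _]mulmxA RiJ mul1mx.
Qed.

Section Factorization.
Variables (m p r : nat) (E F : R -> 'M[R]_m) (A : R -> 'M[R]_(m, p)) (D : R -> 'M[R]_(p, m)).
Variables (theta w : nat -> nat) (K : forall i, R -> 'M[R]_(m, w i)).
Hypothesis CE : mxCn I 1 E.
Hypothesis rE : forall t, t \in I -> \rank (E t) = r.
Hypothesis HW : wong I 1 E F theta K.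
Hypothesis HAD : proper_factorization I E A D.

Let CD : mxCn I 1 D. Proof. by case: HAD. Qed.
Let EAD t : t \in I -> E t = A t *m D t.
Proof. by case: HAD => _ _ _ _ H /H[]. Qed.

(** Inductively N_0 + ... + N_i = K_i meets N_(i+1) trivially. Hence X_(i+1) is all of K_i, and the
    given projectors satisfy [good_projector]. *)
Lemma admissible_ranks kappa rT : admissible I A D F kappa rT ->
  forall i, (i <= kappa)%N ->
    if i is j.+1 then (rT i + theta j)%N = m else rT i = r.
Proof.
move=> [Rp [Dm [Q [G [B [Pi [X [CQ0 Hbase Hrec Hdim Hrank]]]]]]]].
have [Tc [Ri [CTc CRi HR]]] := oblique_projector CE rE HAD.
have DQ0 t : t \in I -> D t *m Q 0%N t = 0.
  move=> tI; have [_ [_ imQ] _ _] := Hbase t tI; apply: kercol_mul0.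
  by rewrite imQ.
(* D^- is prescribed by pointwise identities; this formula shows that it is C^1. *)
have DmE t : t \in I -> Dm t = (1%:M - Q 0%N t) *m Tc t *m Ri t.
  move=> tI; have [[RR imR kR] _ [DmDDm _ DDm DmD] _] := Hbase t tI.
  have [_ _ ADT DTD] := HR t tI.
  have RpE : Rp t = D t *m Tc t *m Ri t.
    have RpD : Rp t *m D t = D t.
      have /imcolP[Z ->] : (imcol (D t) <= imcol (Rp t))%VS by rewrite imR.
      by rewrite mulmxA RR.
    have Rp0 : Rp t *m (1%:M - D t *m Tc t *m Ri t) = 0.
      apply: kercol_mul0; rewrite kR; apply/subvP => _ /mem_imcol[x ->].
      by rewrite mem_kercol mulmxA mulmxBr mulmx1 ADT subrr mul0mx.
    move: Rp0; rewrite mulmxBr mulmx1 !mulmxA RpD => /eqP.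
    by rewrite subr_eq0 => /eqP.
  by rewrite -[LHS]DmDDm -mulmxA DDm RpE !mulmxA DmD.
have CDm : mxCn I 1 Dm.
  apply: (@mxCn_ext _ _ nd _ _ _ (fun t => (1%:M - Q 0%N t) *m Tc t *m Ri t)).
    by move=> t tI; rewrite DmE.
  by apply: mxCnM => //; apply: mxCnM => //; apply: mxCnB => //; exact: mxCn_cst.
have H0 t : t \in I -> [/\ E t = A t *m D t, A t *m (D t *m Dm t) = A t,
    D t *m Dm t *m D t = D t, Dm t *m D t *m Dm t = Dm t & Dm t *m D t = 1%:M - Q 0%N t].
  move=> tI; have [_ _ [DmDDm DDmD DDm DmD] _] := Hbase t tI; have [_ _ ADT _] := HR t tI.
  split=> //; first exact: EAD.
  rewrite (_ : D t *m Dm t = D t *m Tc t *m Ri t) //.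
  by rewrite DmE // !mulmxA mulmxBr mulmx1 DQ0 // subr0.
have H00 t : t \in I -> [/\ G 0%N t = E t, B 0%N t = F t - A t *m mxderive I D t
    & Pi 0%N t = 1%:M - Q 0%N t].
  by move=> tI; have [_ _ _ [-> -> ->]] := Hbase t tI; rewrite EAD.
have Hrec' i t : (i < kappa)%N -> t \in I ->
  [/\ G i.+1 t = G i t + B i t *m Q i t,
      B i.+1 t = B i t *m (1%:M - Q i t) - G i.+1 t *m Dm t *m
         mxderive I (fun t => D t *m Pi i.+1 t *m Dm t) t *m (D t *m Pi i t)
    & Pi i.+1 t = Pi i t *m (1%:M - Q i.+1 t)].
  by move=> ik tI; have [-> -> -> _ _] := Hrec i t ik tI.
have CPi i : (i < kappa)%N -> mxCn I 1 (fun t => D t *m Pi i t *m Dm t).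
  by move=> /ltnW /Hrank[].
have good0 : good_projector I K Q G 0.
  move=> t tI; have [_ [QQ imQ] _ _] := Hbase t tI; have [kD _ _ _] := HR t tI.
  by split=> //; rewrite imQ kD; have [-> _ _] := H00 t tI.
have lev i := level_ranks_all nd HW CD CDm H0 H00 Hrec' CPi (i := i).
have all i : (i <= kappa)%N -> (forall j, (j <= i)%N -> good_projector I K Q G j) /\
    forall t, t \in I -> (\sum_(j < i.+1) kercol (G j t))%VS = imcol (K i t).
  elim: i => [|i IHi] ik.
    split=> [[|//] _|t tI]; first exact: good0.
    rewrite big_ord1; have [-> _ _] := H00 t tI.
    by have [_ _ /(_ t tI)[]] := HW.
  have [goodi sumi] := IHi (ltnW ik).
  have levi := lev i.+1 ik goodi.
  have goodi1 : good_projector I K Q G i.+1.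
    move=> t tI; have [_ [_ _ cap0 _]] := levi t tI.
    have [_ _ _ [QQ imQ] [[sumX _] XQ]] := Hrec i t ik tI; split=> //.
    apply: kercol_mul0; apply: subv_trans XQ; rewrite -sumi // -sumX.
    by rewrite sumi // cap0 add0v.
  split=> [j|t tI].
    by rewrite leq_eqVlt ltnS => /orP[/eqP->|/goodi].
  rewrite big_ord_recr /= sumi //; have [_ [_ -> _ _]] := levi t tI.
  by [].
have [t0 [_ [t0I _ _]]] := nd.
move=> i ik; have [rG _ _] := Hrank i ik; case: i ik rG => [|i] ik rG.
  by rewrite -(rG t0 t0I) -(rE t0I); have [-> _ _] := H00 t0 t0I.
have [goodi _] := all i (ltnW ik).
have [_ [_ _ _ <-]] := lev i.+1 ik goodi t0 t0I.
by rewrite (rG t0 t0I).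
Qed.

Lemma projector_exists (N W : {vspace 'cV[R]_m}) : (N :&: W)%VS = 0%VS ->
  exists Q : 'M[R]_m, [/\ Q *m Q = Q, imcol Q = N & (W <= kercol Q)%VS].
Proof.
move=> NW0.
have [BN [BNE rBN]] := vs_imcol N.
have [BW [BWE rBW]] := vs_imcol (W + (N + W)^C)%VS.
have dir : forall (x : 'cV[R]_m), x \in N -> x \in (W + (N + W)^C)%VS -> x = 0.
  move=> x xN /memv_addP[y yW [z zC xE]].
  have : z \in ((N + W) :&: (N + W)^C)%VS.
    rewrite memv_cap zC andbT (_ : z = x - y); last by rewrite xE addrAC subrr add0r.
    by rewrite memvB //; [apply: (subvP (addvSl _ _))|apply: (subvP (addvSr _ _))].
  rewrite capv_compl memv0 => /eqP z0; move: xE; rewrite z0 addr0 => xy.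
  by apply/eqP; rewrite -memv0 -NW0 memv_cap xN xy.
have all x : x \in (N + (W + (N + W)^C))%VS.
  by rewrite addvA addv_complf memvf.
pose M := row_mx BN BW.
have rM : forall x : 'cV_(_ + _), M *m x = 0 -> x = 0.
  move=> x; rewrite -[x]vsubmxK mul_row_col => Hx.
  have x1 : BN *m usubmx x = 0.
    apply: dir; first by have := mem_imcol_mul BN (usubmx x); rewrite BNE.
    have -> : BN *m usubmx x = - (BW *m dsubmx x) by apply/eqP; rewrite -addr_eq0 Hx.
    by rewrite memvN; have := mem_imcol_mul BW (dsubmx x); rewrite BWE.
  move: Hx; rewrite x1 add0r => x2.
  by rewrite (col_inj rBN x1) (col_inj rBW x2) col_mx0.
have MK := linvK (proj2 (full_col_inj M) rM).
pose Q := BN *m usubmx (linv M).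
have linvE2 : usubmx (linv M) *m BN = 1%:M /\ usubmx (linv M) *m BW = 0.
  move: MK; rewrite -[linv M]vsubmxK mul_col_row scalar_mx_block => /eq_block_mx[? ? _ _].
  by rewrite vsubmxK.
exists Q; split.
- by rewrite /Q mulmxA -[_ *m _ *m BN]mulmxA linvE2.1 mulmx1.
- rewrite -BNE; apply/eqP; rewrite eqEsubv; apply/andP; split; apply/imcolP.
    by exists (usubmx (linv M)).
  by exists BN; rewrite /Q -mulmxA linvE2.1 mulmx1.
- apply/subvP => x xW; rewrite mem_kercol; apply/eqP.
  have : x \in imcol BW by rewrite BWE; exact: (subvP (addvSl W _) _ xW).
  by move=> /mem_imcol[y ->]; rewrite /Q -mulmxA [usubmx _ *m _]mulmxA linvE2.2 mul0mx mulmx0.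
Qed.

(** A pointwise choice with default 0. Smoothness is obtained not for these projectors but for the
    products Pi_i. *)
Let proj N W := xget (0 : 'M[R]_m) [set Q | [/\ Q *m Q = Q, imcol Q = N & (W <= kercol Q)%VS]].

Let projP N W : (N :&: W)%VS = 0%VS ->
  [/\ proj N W *m proj N W = proj N W, imcol (proj N W) = N & (W <= kercol (proj N W))%VS].
Proof. by move=> /projector_exists[Q HQ]; rewrite /proj; case: xgetP => [y _ //|/(_ Q)[]]. Qed.

(* Widely orthogonal projectors, along [K_i + K_(i+1)^\bot], make [Pi i] the
   orthoprojector along the smooth subspace [K_i]. *)
Lemma admissible_exists kappa : admissible I A D F kappa
  (fun i => if i is j.+1 then (m - theta j)%N else r).
Proof.
have [Tc [Ri [CTc CRi HR]]] := oblique_projector CE rE HAD.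
have [CK wS HWt] := HW.
have rK i t : t \in I -> \rank (K i t) = w i by move=> /HWt[].
pose O i t := orthoproj (w i) (K i t).
have CO i : mxCn I 1 (O i) by apply: Cn_orthoproj => // t; exact: rK.
have OP i t : t \in I -> [/\ (O i t)^T = O i t, O i t *m O i t = O i t & imcol (O i t) = imcol (K i t)].
  by move=> tI; have [_] := orthoprojE (rK i t tI).
have OK i t x : t \in I -> x \in imcol (K i t) -> O i t *m x = x.
  by move=> tI; have [_ OO <-] := OP i t tI; move=> /mem_imcol[z ->]; rewrite mulmxA OO.
have Oorth i t x : t \in I -> x \in orthcomp (imcol (K i t)) -> O i t *m x = 0.
  move=> tI; have [OT _ <-] := OP i t tI; rewrite orth_kercol OT mem_kercol => /eqP //.
have Ocompl i t x : t \in I -> x - O i t *m x \in orthcomp (imcol (K i t)).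
  move=> tI; have [OT OO <-] := OP i t tI; rewrite orth_kercol OT mem_kercol.
  by rewrite mulmxBr mulmxA OO subrr.
pose Dm t := (1%:M - O 0%N t) *m Tc t *m Ri t.
have CDm : mxCn I 1 Dm.
  by apply: mxCnM => //; apply: mxCnM => //; apply: mxCnB => //; exact: mxCn_cst.
(* G, B, Q and Pi are defined by a joint recursion, since the new B involves the derivative formed
   from the new Pi; they are carried as one state. *)
pose step i (S : (R -> 'M[R]_m) * (R -> 'M[R]_m) * (R -> 'M[R]_m) * (R -> 'M[R]_m)) :=
  let: (G, B, Q, Pi) := S in
  let G' t := G t + B t *m Q t in
  let Q' t := proj (kercol (G' t)) (imcol (K i t) + orthcomp (imcol (K i.+1 t)))%VS in
  let Pi' t := Pi t *m (1%:M - Q' t) in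
  let B' t := B t *m (1%:M - Q t) - G' t *m Dm t *m
     mxderive I (fun t => D t *m Pi' t *m Dm t) t *m (D t *m Pi t) in
  (G', B', Q', Pi').
pose S := fix S i := if i is j.+1 then step j (S j) else
  ((fun t => A t *m D t), (fun t => F t - A t *m mxderive I D t), O 0%N, (fun t => 1%:M - O 0%N t)).
pose G i := (S i).1.1.1; pose B i := (S i).1.1.2; pose Q i := (S i).1.2; pose Pi i := (S i).2.
have SE i : S i = (G i, B i, Q i, Pi i) by rewrite /G /B /Q /Pi; case: (S i) => [[[]]].
have Hrec i t : [/\ G i.+1 t = G i t + B i t *m Q i t,
      B i.+1 t = B i t *m (1%:M - Q i t) - G i.+1 t *m Dm t *m
         mxderive I (fun t => D t *m Pi i.+1 t *m Dm t) t *m (D t *m Pi i t),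
      Pi i.+1 t = Pi i t *m (1%:M - Q i.+1 t)
    & Q i.+1 t = proj (kercol (G i.+1 t)) (imcol (K i t) + orthcomp (imcol (K i.+1 t)))%VS].
  by rewrite /G /B /Q /Pi /= (SE i).
have base t : [/\ G 0%N t = A t *m D t, B 0%N t = F t - A t *m mxderive I D t, Q 0%N t = O 0%N t
    & Pi 0%N t = 1%:M - O 0%N t] by [].
clearbody G B Q Pi.
have imO t : t \in I -> imcol (O 0%N t) = kercol (D t).
  by move=> tI; have [_ _ ->] := OP 0%N t tI; have [-> _ _ _] := HWt t tI; have [-> _ _ _] := HR t tI.
have DO t : t \in I -> D t *m O 0%N t = 0 by move=> tI; apply: kercol_mul0; rewrite imO.
have DmD t : t \in I -> Dm t *m D t = 1%:M - O 0%N t.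
  move=> tI; have [_ _ _ DTD] := HR t tI; have [_ OO _] := OP 0%N t tI.
  have : (1%:M - O 0%N t) *m (Tc t *m Ri t *m D t - 1%:M) = 0.
    have /imcolP[Z ->] : (imcol (Tc t *m Ri t *m D t - 1%:M) <= imcol (O 0%N t))%VS.
      rewrite imO //; apply/subvP => _ /mem_imcol[x ->].
      by rewrite mem_kercol mulmxA mulmxBr mulmx1 !mulmxA DTD subrr mul0mx.
    by rewrite mulmxA mulmxBl mul1mx OO subrr mul0mx.
  by rewrite mulmxBr mulmx1 => /eqP; rewrite subr_eq0 /Dm !mulmxA => /eqP.
have DDm t : t \in I -> D t *m Dm t = D t *m Tc t *m Ri t.
  by move=> tI; rewrite /Dm !mulmxA mulmxBr mulmx1 DO // subr0.
have H0 t : t \in I -> [/\ E t = A t *m D t, A t *m (D t *m Dm t) = A t,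
    D t *m Dm t *m D t = D t, Dm t *m D t *m Dm t = Dm t & Dm t *m D t = 1%:M - Q 0%N t].
  move=> tI; have [_ _ ADT DTD] := HR t tI; have [_ _ -> _] := base t.
  have [_ OO _] := OP 0%N t tI.
  rewrite DmD // DDm //; split=> //; first exact: EAD.
  by rewrite /Dm !mulmxA mulmxBl mul1mx mulmxBr mulmx1 OO subrr subr0.
have H00 t : t \in I -> [/\ G 0%N t = E t, B 0%N t = F t - A t *m mxderive I D t
    & Pi 0%N t = 1%:M - Q 0%N t].
  by move=> tI; have [-> -> -> ->] := base t; rewrite EAD.
have Hrec' kap i t : (i < kap)%N -> t \in I ->
  [/\ G i.+1 t = G i t + B i t *m Q i t,
      B i.+1 t = B i t *m (1%:M - Q i t) - G i.+1 t *m Dm t *m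
         mxderive I (fun t => D t *m Pi i.+1 t *m Dm t) t *m (D t *m Pi i t)
    & Pi i.+1 t = Pi i t *m (1%:M - Q i.+1 t)].
  by move=> _ _; have [-> -> -> _] := Hrec i t.
have CofPi i : (forall t, t \in I -> Pi i t = 1%:M - O i t) ->
    mxCn I 1 (Pi i) /\ mxCn I 1 (fun t => D t *m Pi i t *m Dm t).
  move=> PiO.
  have CP : mxCn I 1 (Pi i).
    apply: (@mxCn_ext _ _ nd _ _ _ (fun t => 1%:M - O i t)); first by move=> t tI; rewrite PiO.
    by apply: mxCnB => //; exact: mxCn_cst.
  by split=> //; do 2!apply: mxCnM => //.
have all i : (forall j, (j <= i)%N -> [/\ good_projector I K Q G j,
      level_ranks I E F theta K G j & forall t, t \in I -> Pi j t = 1%:M - O j t]) /\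
    forall t, t \in I -> (\sum_(j < i.+1) kercol (G j t))%VS = imcol (K i t).
  elim: i => [|i [IHi sumi]].
    have g0 : good_projector I K Q G 0.
      move=> t tI; have [-> _ -> _] := base t; have [_ OO imO'] := OP 0%N t tI; split=> //.
      by rewrite imO' -EAD //; have [-> _ _ _] := HWt t tI.
    split=> [[|//] _|t tI]; last first.
      by rewrite big_ord1; have [-> _ _] := H00 t tI; have [-> _ _ _] := HWt t tI.
    split=> //; last by move=> t tI; have [_ _ _ ->] := base t.
    by apply: (level_ranks_all (kappa := 0) nd HW CD CDm H0 H00 (Hrec' 0%N)).
  have lev : level_ranks I E F theta K G i.+1.
    apply: (level_ranks_all (kappa := i.+1) nd HW CD CDm H0 H00 (Hrec' i.+1)) => // j ji.
      by have [_ _ /CofPi[]] := IHi j ji.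
    by have [] := IHi j ji.
  have Qp t : t \in I -> [/\ Q i.+1 t *m Q i.+1 t = Q i.+1 t, imcol (Q i.+1 t) = kercol (G i.+1 t)
      & (imcol (K i t) + orthcomp (imcol (K i.+1 t)) <= kercol (Q i.+1 t))%VS].
    move=> tI; have [_ _ _ ->] := Hrec i t; apply: projP.
    have [_ [_ KiE cap0 _]] := lev t tI.
    apply/eqP; rewrite -subv0; apply/subvP => n; rewrite memv_cap memv0.
    move=> /andP[nG /memv_addP[k kK [v vo nE]]].
    have vK : v \in imcol (K i.+1 t).
      rewrite KiE (_ : v = n - k); last by rewrite nE addrAC subrr add0r.
      by rewrite memvB //; [apply: (subvP (addvSr _ _))|apply: (subvP (addvSl _ _))].
    have v0 : v = 0 by rewrite -(OK _ _ _ tI vK) Oorth.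
    by rewrite -memv0 -cap0 memv_cap nG andbT nE v0 addr0.
  have good : good_projector I K Q G i.+1.
    move=> t tI; have [QQ imQ Wk] := Qp t tI; split=> //.
    by apply: kercol_mul0; apply: subv_trans Wk; exact: addvSl.
  (* Split z = k + n + v with k in K_i, n in N_(i+1) and v orthogonal to K_(i+1). Then 1 - Q_(i+1)
     removes n, and Pi_i = 1 - O_i removes k and keeps v, which is orthogonal to K_i too. *)
  have PiO t : t \in I -> Pi i.+1 t = 1%:M - O i.+1 t.
    move=> tI; have [QQ imQ Wk] := Qp t tI; have [_ _ -> _] := Hrec i t.
    have [_ _ /(_ t tI) ->] := IHi i (leqnn i).
    have [_ [_ KiE _ _]] := lev t tI.
    apply: eq_mulmx_col => z; set v := z - O i.+1 t *m z.
    have vo : v \in orthcomp (imcol (K i.+1 t)) by exact: Ocompl.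
    have : O i.+1 t *m z \in imcol (K i.+1 t) by have [_ _ <-] := OP i.+1 t tI; exact: mem_imcol_mul.
    rewrite KiE => /memv_addP[k kK [n nG OE]].
    have QW y : y \in (imcol (K i t) + orthcomp (imcol (K i.+1 t)))%VS -> Q i.+1 t *m y = 0.
      by move=> yW; apply/eqP; rewrite -mem_kercol; apply: (subvP Wk).
    have Qv : Q i.+1 t *m v = 0 by apply: QW; apply: (subvP (addvSr _ _)).
    have Qk : Q i.+1 t *m k = 0 by apply: QW; apply: (subvP (addvSl _ _)).
    have Qn : Q i.+1 t *m n = n by move: nG; rewrite -imQ => /mem_imcol[y ->]; rewrite mulmxA QQ.
    have Ov : O i t *m v = 0.
      apply: Oorth => //; apply/mem_orthcomp => y yK; move/mem_orthcomp: vo; apply.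
      by rewrite KiE; apply: (subvP (addvSl _ _)).
    have zE : z = k + n + v by rewrite -OE /v addrC subrK.
    rewrite -mulmxA [(1%:M - O i.+1 t) *m z]mulmxBl mul1mx -/v.
    clearbody v.
    have -> : (1%:M - Q i.+1 t) *m z = k + v.
      by rewrite mulmxBl mul1mx zE !mulmxDr Qv Qk Qn add0r addr0 addrAC addrK.
    by rewrite mulmxBl mul1mx mulmxDr OK // Ov addr0 addrAC subrr add0r.
  split=> [j|t tI].
    by rewrite leq_eqVlt ltnS => /orP[/eqP->|/IHi]; first by split.
  by rewrite big_ord_recr /= sumi //; have [_ [_ -> _ _]] := lev t tI.
have good i := let: And3 h _ _ := (all i).1 i (leqnn i) in h.
have lev i := let: And3 _ h _ := (all i).1 i (leqnn i) in h.
have PiO i := let: And3 _ _ h := (all i).1 i (leqnn i) in h.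
have sumK i := (all i).2.
have Nhat0 i t : t \in I -> (\sum_(j < i.+1) kercol (G j t) :&: kercol (G i.+1 t))%VS = 0%VS.
  by move=> tI; rewrite sumK //; have [_ []] := lev i.+1 t tI.
(* The intersections with N_i are zero, so the complement X_i is the whole sum. *)
pose X i t := (\sum_(j < i) kercol (G j t))%VS.
exists (fun t => D t *m Tc t *m Ri t), Dm, Q, G, B, Pi, X; split.
- by apply: (@mxCn_ext _ _ nd _ _ _ (O 0%N)) => // t tI; have [_ _ ->] := base t.
- move=> t tI; have [kD RiD ADT DTD] := HR t tI; have [GE BE QE PE] := base t.
  have [_ OO _] := OP 0%N t tI.
  have [_ _ _ _ H] := HAD; have [_ [_ cap0]] := H t tI.
  split.
  + split.
    * by rewrite /is_projector !mulmxA -[_ *m Ri t *m D t *m Tc t]mulmxA [_ *m Ri t *m (_ *m _)]mulmxA;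
        rewrite DTD.
    * apply/eqP; rewrite eqEsubv; apply/andP; split; apply/imcolP.
        by exists (Tc t *m Ri t); rewrite mulmxA.
      by exists (D t).
    * apply/vspaceP => y; rewrite !mem_kercol; apply/eqP/eqP => [Ry|Ay].
        by rewrite -ADT -mulmxA Ry mulmx0.
      apply/eqP; rewrite -memv0 -cap0 memv_cap mem_kercol mulmxA ADT Ay eqxx.
      by rewrite -!mulmxA mem_imcol_mul.
  + by rewrite QE imO.
  + have [_ _ ? ? ?] := H0 t tI; split=> //; exact: DDm.
  + by rewrite GE BE PE QE.
- move=> i t ik tI; have [G1 B1 P1 _] := Hrec i t; split=> //.
    by have [] := good i.+1 t tI.
  rewrite /is_dsum Nhat0 // add0v cap0v; split=> //.
  rewrite /X sumK //; apply/subvP => _ /mem_imcol[x ->]; rewrite mem_kercol mulmxA.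
  by have [_ _ ->] := good i.+1 t tI; rewrite mul0mx.
- case=> // i _; exists 0%N => t tI; by rewrite Nhat0 // dimv0.
- move=> i _; have [CP CDP] := CofPi i (PiO i); split=> //; last exact: (mxCn_le nd) CP.
  move=> t tI; case: i CP CDP => [|i] _ _.
    by have [-> _ _] := H00 t tI; exact: rE.
  have [_ [_ _ _ H]] := lev i.+1 t tI.
  exact: etrans (esym (addnK (theta i) _)) (congr1 (subn^~ (theta i)) H).
Qed.

End Factorization.

End TractabilityIndex.

(** * From the definition of regularity to the three indices *)

Section Assembly.
Context {R : realType}.
Variable I : interval R.
Hypothesis nd : nondegenerate_interval I.

Lemma reduction_step_reduction n r (E F : R -> 'M[R]_n) (E1 F1 : R -> 'M[R]_r) :
  reduction_step I E F E1 F1 -> exists Y C, reduction I E F Y C E1 F1.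
Proof.
move=> [Y [Z [C [HY [CZ HZ] [CC HC] H]]]]; exists Y, C; split=> //; split=> // t tI.
have /is_basisP[ZE _] := HZ t tI.
by rewrite (preim_imE (F t) ZE); exact: HC.
Qed.

(** Rank 0 means E = 0, so F is onto, hence nonsingular, and S = 0. Empty bases give a reduced pair
    of size 0, which is nonsingular. *)
Lemma reg_rank0 r theta i n (E F : R -> 'M[R]_n) :
  pre_regular I E F (r i) (theta i) -> r i = 0%N -> reg I r theta 1 i E F.
Proof.
move=> pr r0; split=> //.
have z (x : 'cV[R]_(r i)) : x = 0 by apply/matrixP => a; have := ltn_ord a; rewrite {2}r0.
have rk0 : \rank (0 : 'M[R]_(n, r i)) = r i by apply/full_col_inj => x _.
have basis0 (U : R -> {vspace 'cV[R]_n}) : (forall t, t \in I -> U t = 0%VS) ->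
    is_basis_fun I (fun=> 0 : 'M[R]_(n, r i)) U.
  move=> U0; split; first exact: mxCn_cst.
  move=> t tI; apply/is_basisP; rewrite U0 //; split=> //.
  apply/vspaceP => x; rewrite memv0; apply/mem_imcol/eqP => [[y ->]|->]; first exact: mul0mx.
  by exists 0; rewrite mulmx0.
have E0 t : t \in I -> E t = 0.
  by move=> /pr[_ rE _]; apply/eqP; rewrite -mxrank_eq0 rE r0.
exists (fun=> 0), (fun=> 0).
have [||E1 [F1 red]] := @reduction_exists R I n (r i) E F (fun=> 0) (fun=> 0).
- apply: basis0 => t tI; rewrite E0 //; apply/vspaceP => x; rewrite memv0.
  by apply/mem_imcol/eqP => [[y ->]|->]; [exact: mul0mx|exists 0; rewrite mulmx0].
- apply: basis0 => t tI; have [full _ _] := pr t tI; rewrite E0 //.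
  have uF : F t \in unitmx.
    rewrite -row_full_unit /row_full; apply/eqP; rewrite -dim_imcol.
    have -> : imcol (F t) = fullv.
      apply/eq_fullv => y; move/eq_fullv: full => /(_ y)/mem_imcol_row[a [b ->]].
      by rewrite E0 // mul0mx add0r mem_imcol_mul.
    by rewrite dimvf /dim /= muln1.
  apply/vspaceP => x; rewrite memv0; apply/mem_preim_im/eqP => [[y]|->].
    by rewrite mul0mx => Fx; rewrite -(mulKmx uF x) Fx mulmx0.
  by exists 0; rewrite !mulmx0.
exists E1, F1; split=> // t tI; apply: square_unit => x _; exact: z.
Qed.

Lemma regular_reg m (E F : R -> 'M[R]_m) mu r theta :
  regular I E F mu r theta -> reg I r theta mu 0 E F.
Proof.
move=> [mu0 _ _ _ [E_ [F_ [[E0 F0] pr step last]]]].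
suff H k i : (i + k.+1 = mu)%N -> reg I r theta k.+1 i (E_ i) (F_ i).
  by have := H mu.-1 0%N; rewrite prednK // add0n E0 F0; apply.
elim: k i => [|k IHk] i ik.
  have im : mu.-1 = i by rewrite -ik addn1.
  have imu : (i < mu)%N by rewrite -ik addn1.
  move: last; rewrite im => -[[_ /reduction_step_reduction[Y [C red]] uE]|r0].
    by split; [exact: pr|exists Y, C, (E_ i.+1), (F_ i.+1)].
  by apply: reg_rank0 => //; exact: pr.
have imu : (i.+1 < mu)%N by rewrite -ik -addn1 ltn_add2l.
have [Y [C red]] := reduction_step_reduction (step i imu).
split; first exact/pr/ltnW.
exists Y, C, (E_ i.+1), (F_ i.+1); split=> //.
by apply: IHk; rewrite addSnnS.
Qed.

Lemma reg_ext r theta theta' k i n (E F : R -> 'M[R]_n) :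
  (forall j, (i <= j < i + k)%N -> theta j = theta' j) ->
  reg I r theta k i E F -> reg I r theta' k i E F.
Proof.
elim: k i n E F => //= k IHk i n E F Ht [pr [Y [C [E1 [F1 [red regk]]]]]].
split; first by rewrite -Ht // leqnn addnS ltnS leq_addr.
exists Y, C, E1, F1; split=> //; apply: IHk regk => j /andP[ij jk]; apply: Ht.
by rewrite ltnW // addnS -addSn.
Qed.

(** With an orthonormal frame Y of im E take A = Y and D = Y^T E. Then ker A = 0 and im D is the
    full space, with constant projectors 0 and 1. *)
Lemma proper_factorization_exists k n r (E : R -> 'M[R]_n) : mxCn I k.+1 E ->
  (forall t, t \in I -> \rank (E t) = r) ->
  exists (A : R -> 'M[R]_(n, r)) (D : R -> 'M[R]_(r, n)), proper_factorization I E A D.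
Proof.
move=> CE rE; have [Y [CY HY]] := im_frame nd CE rE.
have CE1 : mxCn I 1 E by exact: mxCn_le CE.
have CY1 : mxCn I 1 Y by exact: mxCn_le CY.
have Yinj t (x : 'cV_r) : t \in I -> Y t *m x = 0 -> x = 0.
  by move=> /HY[YY _] Yx; rewrite -[x]mul1mx -YY -mulmxA Yx mulmx0.
have kA t : t \in I -> kercol (Y t) = 0%VS.
  move=> tI; apply/vspaceP => x; rewrite mem_kercol memv0; apply/eqP/eqP => [|->].
    exact: Yinj.
  exact: mulmx0.
have YE t : t \in I -> Y t *m ((Y t)^T *m E t) = E t.
  move=> tI; have [YY YEE] := HY t tI.
  have /imcolP[Z ->] : (imcol (E t) <= imcol (Y t))%VS by rewrite YEE.
  by rewrite [_^T *m _]mulmxA YY mul1mx.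
have iD t : t \in I -> imcol ((Y t)^T *m E t) = fullv.
  move=> tI; have [YY YEE] := HY t tI; apply/eq_fullv => y.
  have : Y t *m y \in imcol (Y t) by exact: mem_imcol_mul.
  rewrite YEE => /mem_imcol[x Hx]; apply/mem_imcol; exists x.
  by rewrite -mulmxA -Hx mulmxA YY mul1mx.
have orth0 : orthcomp (0%VS : {vspace 'cV[R]_r}) = fullv.
  apply/eq_fullv => y; apply/mem_orthcomp => z; rewrite memv0 => /eqP ->.
  by rewrite trmx0 mul0mx.
have orthf : orthcomp (fullv : {vspace 'cV[R]_r}) = 0%VS.
  apply/eqP; rewrite -subv0; apply/subvP => y /mem_orthcomp /(_ y (memvf y)) /gram_eq0 ->.
  exact: mem0v.
have im0 : imcol (0 : 'M[R]_r) = 0%VS.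
  apply/vspaceP => x; rewrite memv0; apply/mem_imcol/eqP => [[y ->]|->]; first exact: mul0mx.
  by exists 0; rewrite mulmx0.
have im1 : imcol (1%:M : 'M[R]_r) = fullv.
  by apply/eq_fullv => y; apply/mem_imcol; exists y; rewrite mul1mx.
have ker0 : kercol (0 : 'M[R]_r) = fullv.
  by apply/eq_fullv => y; rewrite mem_kercol mul0mx.
have ker1 : kercol (1%:M : 'M[R]_r) = 0%VS.
  by apply/vspaceP => y; rewrite mem_kercol mul1mx memv0.
exists Y, (fun t => (Y t)^T *m E t); split.
- exact: mxCn_le CY.
- by apply: mxCnM => //; exact: mxCnT.
- exists (fun=> 0); split; first exact: mxCn_cst.
  by move=> t tI; rewrite /is_projector mul0mx kA // orth0 im0 ker0.
- exists (fun=> 1%:M); split; first exact: mxCn_cst.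
  by move=> t tI; rewrite /is_projector mul1mx iD // orthf im1 ker1.
- move=> t tI; rewrite YE // /is_dsum kA // iD // add0v cap0v.
  by [].
Qed.

End Assembly.

Theorem theorem4p3 (R : realType) (m : nat) :
  exists K : nat,
  forall (I : interval R) (E F : R -> 'M[R]_m) (mu : nat)
         (r theta : nat -> nat),
    nondegenerate_interval I ->
    mxCn I K E -> mxCn I K F ->
    regular I E F mu r theta ->
    (mu = 1%N -> theta 0%N = 0%N) ->
    ((1 < mu)%N ->
      [/\ (forall i, (i.+2 < mu)%N -> (theta i.+1 <= theta i)%N),
          (theta mu.-1 < theta mu.-2)%N
        & theta mu.-1 = 0%N]) ->
    [/\ exists rS a s d u : nat -> nat,
          [/\ strangeness_index I E F mu.-1 rS a s d u,
              rS 0%N = r 0%N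
            & forall i, (i < mu)%N ->
                [/\ s i = theta i,
                    d i = (rS i - theta i)%N,
                    a i = (m - r i - theta i)%N,
                    u i = 0%N
                  & rS i.+1 = d i]],
        exists rT : nat -> nat,
          [/\ tractability_index I E F mu rT,
              rT 0%N = r 0%N
            & forall i, (1 <= i <= mu)%N -> rT i = (m - theta i.-1)%N]
      & exists rD : nat -> nat,
          [/\ dissection_index I E F mu rD,
              rD 0%N = r 0%N
            & forall i, (1 <= i <= mu)%N -> rD i = (m - theta i.-1)%N]].
Proof.
(* Since mu <= m, this covers the 2 mu + 1 derivatives for the spaces K_i and the mu + 1 for
   strangeness and dissection. *)
exists (m.*2.+2) => I E F mu r theta nd CE CF Hreg H1 H2.
have [t0 [_ [t0I _ _]]] := nd.
have [mu0 r0m _ rdec _] := Hreg.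
have regE := regular_reg nd Hreg.
have th_last : theta mu.-1 = 0%N.
  by move: mu0; rewrite leq_eqVlt => /orP[/eqP mu1|/H2[]//]; rewrite -mu1; apply: H1.
have muS : mu.-1.+1 = mu by exact: prednK.
have pr : pre_regular I E F (r 0%N) (theta 0%N) by move: regE; rewrite -muS => -[].
have rE t : t \in I -> \rank (E t) = r 0%N by case/pr.
(* The ranks decrease strictly, starting below m. *)
have mule : (mu <= m)%N.
  suff H i : (i < mu)%N -> (r i + i < m)%N by have := H mu.-1; rewrite muS => /(_ (leqnn _)); lia.
  elim: i => [|i IHi] imu; first by rewrite addn0.
  by have := IHi (ltnW imu); have := rdec i imu; lia.
have th_pos i : (i.+1 < mu)%N -> (0 < theta i)%N.
  move=> imu; have mu1 : (1 < mu)%N by exact: leq_ltn_trans imu.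
  have [mono lst _] := H2 mu1.
  (* Induction on the distance to the end of the chain, where theta_(mu-2) > theta_(mu-1) starts
     it. *)
  suff H k : (k + i.+2 = mu)%N -> (0 < theta i)%N by apply: (H (mu - i.+2)%N); rewrite subnK.
  elim: k i imu => [|k IHk] i imu ik.
    by move: lst; rewrite -ik /=; exact: leq_ltn_trans.
  apply: leq_trans (IHk i.+1 _ _) (mono i _); lia.
have th_mono i : (i.+1 < mu)%N -> (theta i.+1 <= theta i)%N.
  move=> imu; have [mono _ _] := H2 (leq_ltn_trans (ltn0Sn i) imu).
  have [i2|i2] := ltnP i.+2 mu; first exact: mono.
  have -> : i.+1 = mu.-1 by lia.
  by rewrite th_last.
have r_rec i : (i.+1 < mu)%N -> (r i.+1 + theta i)%N = r i by exact: (reg_rank nd regE).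
have thr0 : (theta 0%N + r 0%N <= m)%N by exact: pre_regular_le t0I pr.
have last_lt : ((if mu.-1 is l.+1 then m - theta l else r 0) < m)%N.
  case El: mu.-1 => [|l] //.
  by have := @th_pos l; rewrite -muS El ltnSn => /(_ isT); lia.
have CEk : mxCn I mu.-1.+2 E by apply: mxCn_le CE => //; lia.
have CFk : mxCn I mu.-1.+2 F by apply: mxCn_le CF => //; lia.
split.
- have regS : reg I r theta mu.-1.+1 0 E F by rewrite muS.
  have [E_ [F_ [E0 F0 chain]]] := strangeness_chain nd regS CEk CFk th_last.
  pose j i := minn i mu.-1.
  exists (fun i => r (j i)), (fun i => m - r (j i) - theta (j i))%N, (fun i => theta (j i)),
    (fun i => r (j i) - theta (j i))%N, (fun=> 0%N); split.
  + split; first by exists E_, F_.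
    rewrite /j minnn; split=> // i imu.
    by rewrite (minn_idPl (ltnW imu)); have := @th_pos i; lia.
  + by rewrite /j min0n.
  + move=> i imu; have ji : j i = i by rewrite /j; apply/minn_idPl; lia.
    rewrite ji; split=> //; have [imu1|imu1] := ltnP i.+1 mu.
      have -> : j i.+1 = i.+1 by rewrite /j; apply/minn_idPl; lia.
      by rewrite -(r_rec i imu1) addnK.
    have im : i = mu.-1 by lia.
    have -> : j i.+1 = mu.-1 by rewrite /j; apply/minn_idPr; lia.
    by rewrite im th_last subn0.
- exists (fun i => if i is l.+1 then (m - theta l)%N else r 0%N); split=> //; last by case.
  (* The sequence K_i runs over all i and is constant from index mu on, whereas [theta] is arbitrary
     there; it is cut off by 0. *)
  pose theta' i := if (i < mu)%N then theta i else 0%N.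
  have th'E i : (i < mu)%N -> theta' i = theta i by rewrite /theta' => ->.
  have regE' : reg I r theta' mu 0 E F.
    by apply: reg_ext regE => // l /andP[_]; rewrite add0n => /th'E.
  have th0 i : (mu <= i)%N -> theta' i = 0%N by move=> mui; rewrite /theta' ltnNge mui.
  have CE3 : mxCn I (0 + mu.*2).+1 E by apply: mxCn_le CE => //; lia.
  have CF3 : mxCn I (0 + mu.*2).+1 F by apply: mxCn_le CF => //; lia.
  have [k [K [HW _]]] := wong_exists nd regE' th0 CE3 CF3.
  have CE1 : mxCn I 1 E by apply: mxCn_le CE.
  split.
    have [A [D HAD]] := proper_factorization_exists nd CE1 rE.
    by exists (r 0%N), A, D.
  move=> p A D HAD; split.
  + have [Rp [Dm [Q [G [B [Pi [X [CQ h1 h2 h3 h4]]]]]]]] := admissible_exists nd CE1 rE HW HAD mu.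
    exists Rp, Dm, Q, G, B, Pi, X; split=> // i imu.
    have [rG h5 h6] := h4 i imu; split=> // t tI; rewrite rG //.
    by case: i imu {rG h5 h6} => // i imu; rewrite th'E.
  + by rewrite -muS th_last subn0.
  + case=> [|i] imu; first by lia.
    by rewrite leq_sub2l // th_mono.
  + by rewrite -{2}muS th_last subn0; exact: last_lt.
  (* Minimality: every admissible sequence has the forced ranks, and r < m as well as theta_l > 0
     for l + 1 < mu keep them below m. *)
  + move=> kappa rT' kmu adm.
    have := admissible_ranks nd CE1 rE HW HAD adm (leqnn kappa).
    case: kappa kmu adm => [|l] lmu adm; first by move=> -> h; move: r0m; rewrite h ltnn.
    by rewrite th'E ?(ltnW lmu) //; have := th_pos l lmu; lia.
- have CE2 : mxCn I mu.+1 E by apply: mxCn_le CE => //; lia.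
  have CF2 : mxCn I mu.+1 F by apply: mxCn_le CF => //; lia.
  have [E_ [F_ [E0 F0 chain]]] := dissection_chain nd regE CE2 CF2.
  exists (fun i => if i is l.+1 then (m - theta l)%N else r 0%N); split=> //; last by case.
  have th_le i : (i < mu)%N -> (theta i <= m)%N.
    elim: i => [_|i IHi imu]; first by lia.
    by apply: leq_trans (th_mono i imu) (IHi (ltnW imu)).
  (* For i > 0 the size of level i is r_(i-1) = r_i + theta_(i-1), so a_i = theta_(i-1) - theta_i
     and the sums telescope to m - theta_i. *)
  exists r, (fun i => dims m r i - r i - theta i)%N, E_, F_; split=> //.
  + split=> // -[|i] imu /=; first by lia.
    by have := r_rec i imu; have := th_mono i imu; have := th_le i (ltnW imu); lia.
  + rewrite -{2 3}muS th_last subn0; split=> //; exact: last_lt.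
Qed.
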